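(* Let $\Omega\subseteq\mathbb{C}^n$ be a bounded strongly pseudoconvex domain with smooth boundary, with defining function $\rho$, and let $h$ be a holomorphic function defined in an open neighborhood of $\overline{\Omega}$. Then there exist constants $N>0$, $C>0$ such that for any $w,z\in\Omega$ and any $f\in\mathrm{Hol}(\Omega)$, $$|h(z)f(w)|\leq C\,\frac{F(z,w)^N}{|\rho(w)|^{N+n+1}}\int_{E(w,1)}|h(\lambda)f(\lambda)|\,dv_n(\lambda).$$
   Context: $\mathrm{Hol}(\Omega)$ is the set of holomorphic functions on $\Omega$; $v_n$ is Lebesgue measure on $\mathbb{C}^n$. A bounded domain $\Omega\subset\mathbb{C}^n$ is bounded strongly pseudoconvex with smooth boundary, with defining function $\rho$, if $\rho\in C^\infty(\mathbb{C}^n)$ is real-valued, $\Omega=\{\rho<0\}$, $|\mathrm{grad}\,\rho|\neq0$ on $\partial\Omega$, and for some $k>0$, $\sum_{i,j=1}^n\frac{\partial^2\rho(\zeta)}{\partial z_i\partial\bar z_j}\xi_i\bar\xi_j\ge k|\xi|^2$ for all $\zeta\in\partial\Omega$, $\xi\in\mathbb{C}^n$. Define $$X(z,w)=-\rho(z)-\sum_{j=1}^n\frac{\partial\rho(z)}{\partial z_j}(w_j-z_j)-\frac12\sum_{j,k=1}^n\frac{\partial^2\rho(z)}{\partial z_j\partial z_k}(w_j-z_j)(w_k-z_k),$$ $$F(z,w)=|\rho(z)|+|\rho(w)|+|\mathrm{Im}\,X(z,w)|+|z-w|^2.$$ Kobayashi metric: $F_K(z,\xi)=\inf\{\alpha>0:\exists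 f:\mathbb{D}\to\Omega\text{ holomorphic}, f(0)=z, f'(0)=\xi/\alpha\}$ ($\mathbb{D}$ the open unit disc); $\beta(z,w)=\inf_\gamma\int_0^1F_K(\gamma(t),\gamma'(t))\,dt$ over $C^1$ curves $\gamma:[0,1]\to\Omega$ with $\gamma(0)=z$, $\gamma(1)=w$; $E(w,r)=\{z\in\Omega:\beta(z,w)<r\}$. *)

(* Defs.v *)
From HB Require Import structures.
From mathcomp Require Import all_boot all_order all_algebra.
From mathcomp Require Import all_classical all_reals all_analysis.
From mathcomp Require Import complex ring lra.
Set Implicit Arguments.
Unset Strict Implicit.
Unset Printing Implicit Defensive.
Import Order.TTheory GRing.Theory Num.Theory.
Import numFieldNormedType.Exports.
Local Open Scope classical_set_scope.
Local Open Scope complex_scope.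
Local Open Scope ring_scope.

(* R[i] as a normed space over itself, so that [differentiable] on 'rV[R[i]]_n
   is complex (C-linear) differentiability. *)
HB.instance Definition _ (R : realType) := NormedModule.copy R[i] R[i]^o.

Section Borel.
Context (R : realType) (n : nat).
Local Notation Borel := <<s (@open 'rV[R[i]]_n) >>.

Let Borel_set0 : Borel set0.
Proof. exact: sigma_algebra0. Qed.

Let Borel_setC A : Borel A -> Borel (~` A).
Proof. exact: sigma_algebraC. Qed.

Let Borel_bigcup (F : _^nat) : (forall i, Borel (F i)) -> Borel (\bigcup_i (F i)).
Proof. exact: sigma_algebra_bigcup. Qed.

HB.instance Definition _ := @isMeasurable.Build default_measure_display
  'rV[R[i]]_n Borel Borel_set0 Borel_setC Borel_bigcup.
End Borel.

Section LebesgueCn.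
Context (R : realType).

(* ((v, x), y) |-> (x + i y, v), identifying C^n x R x R with C^(n+1). *)
Definition row_cons (n : nat) (p : 'rV[R[i]]_n * R * R) : 'rV[R[i]]_n.+1 :=
  row_mx (p.1.2 +i* p.2)%:M p.1.1.

Lemma row_cons0 n p : @row_cons n p ord0 ord0 = p.1.2 +i* p.2.
Proof. by rewrite mxE; case: splitP => // j _; rewrite mxE (ord1 j) mulr1n. Qed.

Lemma row_consS n p j : @row_cons n p ord0 (lift ord0 j) = p.1.1 ord0 j.
Proof.
rewrite mxE; case: splitP => k; first by rewrite (ord1 k).
by rewrite lift0 => -[jk]; congr (_ _ _); exact/val_inj.
Qed.

Local Lemma rat_approx (x e : R) : 0 < e -> exists q : rat, `|x - ratr q| < e.
Proof.
move=> e0; have [|q] := @rat_in_itvoo R (x - e) (x + e).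
  by rewrite ltrBlDr -addrA ltrDl addr_gt0.
by rewrite in_itv/= => /andP[h1 h2]; exists q; rewrite ltr_distlC h1.
Qed.

Local Lemma normC_le (x y : R) : `|x +i* y| <= (`|x| + `|y|)%:C.
Proof.
rewrite normc_def lecR/= -[leRHS]ger0_norm ?addr_ge0// -sqrtr_sqr.
rewrite ler_wsqrtr// sqrrD !real_normK ?num_real// lerD2r lerDl.
by rewrite mulrn_wge0// mulr_ge0.
Qed.

Lemma measurable_row_cons n : measurable_fun [set: _] (@row_cons n).
Proof.
apply: (measurability (@open 'rV[R[i]]_n.+1)) => // _ [U oU <-].
rewrite setTI.
pose I := ('rV[rat * rat]_n * (rat * rat) * nat)%type.
pose e (k : nat) : R := k.+1%:R^-1 / 4.
pose c (q : rat * rat) : R[i] := ratr q.1 +i* ratr q.2.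
pose B (i : I) : set ('rV[R[i]]_n * R * R) :=
  ball (map_mx c i.1.1) (e i.2)%:C `*`
  ball (ratr i.1.2.1 : R) (e i.2) `*` ball (ratr i.1.2.2 : R) (e i.2).
have e0 k : 0 < e k by rewrite divr_gt0// invr_gt0.
rewrite (_ : _ @^-1` U = \bigcup_(i in [set: I])
    if `[< B i `<=` @row_cons n @^-1` U >] then B i else set0); last first.
  apply/seteqP; split => [[[v x] y] /= Up|p [i _]]; last first.
    by case: asboolP => // BU /BU.
  have /nbhs_ballP[d /= d0 dU] : nbhs (row_cons (v, x, y)) U.
    exact: open_nbhs_nbhs.
  have dE : d = (complex.Re d)%:C.
    apply/eqP; rewrite eq_complex eqxx/=; move: d0; rewrite ltcE => /andP[/= + _].
    by rewrite eq_sym => /eqP ->.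
  have Rd0 : 0 < complex.Re d by move: d0; rewrite dE ltcR.
  have [k kd] : exists k : nat, k.+1%:R^-1 < complex.Re d.
    by have [k] := ltr_add_invr Rd0; rewrite add0r => ?; exists k.
  have ltr0n_2 : 0 < 2 :> R by [].
  have [a xa] := rat_approx x (e0 k).
  have [b yb] := rat_approx y (e0 k).
  have /choice[q vq] j : exists q, `|c q - v ord0 j| < (e k)%:C.
    case vj : (v ord0 j) => [r s].
    have [q1 rq1] := rat_approx r (divr_gt0 (e0 k) ltr0n_2).
    have [q2 sq2] := rat_approx s (divr_gt0 (e0 k) ltr0n_2).
    exists (q1, q2); rewrite (le_lt_trans (normC_le _ _))// ltcR.
    by rewrite [ltRHS]splitr ltrD// distrC.
  exists (\row_j q j, (a, b), k) => //.
  case: asboolP => [_|[]].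
    split; last by rewrite /= -ball_normE/= distrC.
    split; last by rewrite /= -ball_normE/= distrC.
    split; first by rewrite ltcR.
    move=> i j; rewrite ord1 !mxE -ball_normE/=; exact: vq.
  move=> [[v' x'] y'] [/= [/= [_ Bv] Bx] By].
  apply: dU; split => // i j; rewrite ord1 {i} -ball_normE/=.
  have [->|[l ->]] : j = ord0 \/ exists l, j = lift ord0 l.
    by case: (unliftP ord0 j) => [l ->|->]; [right; exists l|left].
  - rewrite !row_cons0/= (le_lt_trans (normC_le _ _))// dE ltcR.
    apply: lt_trans kd; rewrite (_ : _^-1 = 2 * e k + 2 * e k); last first.
      by rewrite /e; field.
    move: Bx By; rewrite -!ball_normE/= => Bx By.
    rewrite ltrD//.
      rewrite -(subrKA (ratr a)) (le_lt_trans (ler_normD _ _))//.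
      by rewrite mulr_natl mulr2n ltrD.
    rewrite -(subrKA (ratr b)) (le_lt_trans (ler_normD _ _))//.
    by rewrite mulr_natl mulr2n ltrD.
  - rewrite !row_consS/=; move: (Bv ord0 l); rewrite !mxE -ball_normE/= => Bvl.
    rewrite -(subrKA (c (q l))) (le_lt_trans (ler_normD _ _))//.
    have dk : (e k)%:C + (e k)%:C < d.
      rewrite dE -rmorphD ltcR; apply: le_lt_trans kd.
      have := e0 k; rewrite /e; move: (k.+1%:R^-1) => u; lra.
    by apply: lt_trans dk; rewrite ltrD// distrC.
apply: countable_bigcupT_measurable => [|i].
  exact: countableP.
case: asboolP => // _.
apply: measurableX; last by rewrite ball_itv; exact: measurable_itv.
apply: measurableX; last by rewrite ball_itv; exact: measurable_itv.
by apply: sub_sigma_algebra; exact: ball_open.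
Qed.

End LebesgueCn.

Arguments row_cons {R n}.

(* Lebesgue measure on C^n = R^(2n), as an iterated product of copies of the
   one-dimensional Lebesgue measure. *)
Fixpoint lebesgue_Cn (R : realType) (n : nat) : set 'rV[R[i]]_n -> \bar R :=
  match n with
  | 0 => \d_(0 : 'rV[R[i]]_0)
  | m.+1 => pushforward
      (@lebesgue_Cn R m \x @lebesgue_measure R \x @lebesgue_measure R)%E row_cons
  end.
Arguments lebesgue_Cn {R n}.

Section LebesgueCnMeasure.
Context (R : realType).
Local Open Scope ereal_scope.

Let step n (m : {measure set 'rV[R[i]]_n -> \bar R})
  (mu := pushforward (m \x @lebesgue_measure R \x @lebesgue_measure R)
           (@row_cons R n)) :
  [/\ mu set0 = 0, (forall A, 0 <= mu A) & semi_sigma_additive mu].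
Proof.
pose p : {measure set _ -> \bar R} :=
  m \x @lebesgue_measure R \x @lebesgue_measure R.
rewrite /mu /pushforward; split.
- by rewrite preimage_set0; exact: (measure0 p).
- by move=> A; exact: (measure_ge0 p).
- move=> F mF tF mUF; rewrite preimage_bigcup.
  apply: (@measure_semi_sigma_additive _ _ _ p (fun k => row_cons @^-1` F k)).
  + by move=> k; rewrite -[X in measurable X]setTI; exact: measurable_row_cons.
  + apply/trivIsetP => /= i j _ _ ij; rewrite -preimage_setI.
    by move/trivIsetP : tF => /(_ _ _ _ _ ij) ->//; rewrite preimage_set0.
  + rewrite -preimage_bigcup -[X in measurable X]setTI.
    exact: measurable_row_cons.
Qed.

Let lebesgue_Cn_measure n :
  [/\ @lebesgue_Cn R n set0 = 0, (forall A, 0 <= @lebesgue_Cn R n A) &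
      semi_sigma_additive (@lebesgue_Cn R n)].
Proof.
elim: n => [|n [m0 m_ge0 m_add]].
  split; [exact: measure0|by move=> A; exact: measure_ge0|].
  exact: measure_semi_sigma_additive.
pose mM := isMeasure.Build _ _ _ (@lebesgue_Cn R n) m0 m_ge0 m_add.
pose m : {measure set _ -> \bar R} := HB.pack (@lebesgue_Cn R n) mM.
exact: (step m).
Qed.

HB.instance Definition _ n := isMeasure.Build _ _ _ (@lebesgue_Cn R n)
  (let: And3 m0 _ _ := lebesgue_Cn_measure n in m0)
  (let: And3 _ m_ge0 _ := lebesgue_Cn_measure n in m_ge0)
  (let: And3 _ _ m_add := lebesgue_Cn_measure n in m_add).

End LebesgueCnMeasure.


Section Definitions.
Context (R : realType) (n : nat).
Local Notation Cn := 'rV[R[i]]_n.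
Implicit Types (z w xi : Cn) (Omega : set Cn) (rho : Cn -> R).

Definition holomorphic_on (V W : normedModType R[i]) (A : set V) (f : V -> W) :=
  forall p, A p -> differentiable f p.

(* Squared Euclidean norm; the library norm `|z| on 'rV is the sup norm. *)
Definition sqnorm z : R := \sum_(j < n) Normc.normc (z ord0 j) ^+ 2.

(* Real coordinate directions of C^n = R^(2n): d/dx_j for [false], d/dy_j for
   [true], where z_j = x_j + i y_j. *)
Definition real_dir (d : bool * 'I_n) : Cn :=
  (if d.1 then 'i%C else 1) *: delta_mx ord0 d.2.

Definition along (g : Cn -> R) (d : bool * 'I_n) z : R -> R :=
  fun t => g (z + t%:C *: real_dir d).

Definition pderiv (g : Cn -> R) (d : bool * 'I_n) z : R := derive1 (along g d z) 0.

Definition iter_pderiv (g : Cn -> R) (s : seq (bool * 'I_n)) : Cn -> R :=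
  foldl pderiv g s.

Definition smooth (g : Cn -> R) :=
  forall s : seq (bool * 'I_n), continuous (iter_pderiv g s) /\
    forall d z, derivable (along (iter_pderiv g s) d z) 0 1.

Definition gradient (g : Cn -> R) z : 'rV[R]_(n + n) :=
  row_mx (\row_j pderiv g (false, j) z) (\row_j pderiv g (true, j) z).

Definition cpderiv (g : Cn -> R[i]) (d : bool * 'I_n) z : R[i] :=
  pderiv (fun u => complex.Re (g u)) d z +i*
  pderiv (fun u => complex.Im (g u)) d z.

(* Wirtinger derivatives d/dz_j and d/d(conj z_j). *)
Definition dz (j : 'I_n) (g : Cn -> R[i]) z : R[i] :=
  2^-1 * (cpderiv g (false, j) z - 'i%C * cpderiv g (true, j) z).

Definition dzbar (j : 'I_n) (g : Cn -> R[i]) z : R[i] :=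
  2^-1 * (cpderiv g (false, j) z + 'i%C * cpderiv g (true, j) z).

Definition boundary (A : set Cn) : set Cn := closure A `\` A°.

Definition levi_form rho z xi : R[i] :=
  \sum_(i < n) \sum_(j < n)
    dz i (dzbar j (fun u => (rho u)%:C)) z * xi ord0 i * (xi ord0 j)^*%C.

Definition bounded_domain Omega :=
  [/\ open Omega, connected Omega, Omega !=set0 & bounded_set Omega].

(* The order on R[i] only compares numbers with the same imaginary part: the
   last inequality includes that the Levi form is real. *)
Definition strongly_pseudoconvex Omega rho :=
  [/\ smooth rho, Omega = [set z | rho z < 0],
      forall z, boundary Omega z -> gradient rho z != 0 &
      exists2 k : R, 0 < k & forall z xi, boundary Omega z ->
        (k * sqnorm xi)%:C <= levi_form rho z xi].

Definition X_fun rho z w : R[i] :=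
  let r u := (rho u)%:C in
  - r z
  - \sum_(j < n) dz j r z * (w ord0 j - z ord0 j)
  - 2^-1 * \sum_(j < n) \sum_(k < n)
      dz j (dz k r) z * (w ord0 j - z ord0 j) * (w ord0 k - z ord0 k).

Definition F_fun rho z w : R :=
  `|rho z| + `|rho w| + `|complex.Im (X_fun rho z w)| + sqnorm (z - w).

Definition unit_disc : set R[i] := [set t | `|t| < 1].

Definition kobayashi_metric Omega z xi : \bar R :=
  ereal_inf [set a%:E | a in [set a : R | 0 < a /\
    exists f : R[i] -> Cn, [/\ holomorphic_on unit_disc f,
      (forall t, unit_disc t -> Omega (f t)), f 0 = z &
      derive1 f 0 = (a%:C)^-1 *: xi]]].

(* gamma is a C^1 curve on [0, 1] in Omega with derivative dgamma, one-sided
   at the end points. *)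
Definition C1_curve Omega z w (gamma dgamma : R -> Cn) :=
  [/\ (forall t : R, t \in `[0, 1] -> Omega (gamma t)), gamma 0 = z, gamma 1 = w,
      (forall t : R, t \in `[0, 1] ->
        ((s - t)%:C)^-1 *: (gamma s - gamma t) @[s --> within `[0, 1] t^']
          --> dgamma t) &
      {within `[0, 1], continuous dgamma}].

Definition kobayashi_dist Omega z w : \bar R :=
  ereal_inf [set l | exists gamma dgamma, C1_curve Omega z w gamma dgamma /\
    l = (\int[lebesgue_measure]_(t in `[0%R, 1%R])
          kobayashi_metric Omega (gamma t) (dgamma t))%E].

Definition kobayashi_ball Omega w (r : R) : set Cn :=
  [set z | Omega z /\ (kobayashi_dist Omega z w < r%:E)%E].

End Definitions.

(* Main.v *)
(* Write [delta = |rho w|] and [F = F_fun rho z w >= delta].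

   Around [w] the domain contains an anisotropic polydisc of size [delta] along
   the complex normal and [sqrt delta] tangentially; a fixed fraction of it lies
   in the Kobayashi ball [E(w, 1)] because an affine disc through a point bounds
   the Kobayashi metric there.  Conversely [z - w] has size [sqrt F] tangentially
   and [F] normally.  Hence both scales are swept by the same family of parabolas
   [T |-> w + T b + T^2 a nu], with [b] complex tangential, [nu] normal and
   [|b|, |a| <= 1]: [T] of size [r ~ sqrt delta] gives the polydisc, and
   [T] of size [d ~ sqrt F] reaches [z].

   The restrictions of [h] to these parabolas are one-variable functions, bounded
   on a fixed disc and not all small there (uniformly in [w], by compactness and
   the identity theorem).  Such a family is doubling: its maximum over the disc of
   radius [d] is at most [K (d / r)^m] times its maximum [Mr] over the disc of
   radius [r].  In particular some member behaves like a polynomial at scale [r],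
   so that for every [f] its product with [f] is, at some point [q] of the
   polydisc, at least [c Mr |f w|].  The mean value property of [h f] on a
   sheared polydisc around [q], of volume comparable to [delta^(n+1)], then
   bounds [|h z f w|] by the integral. *)
From HB Require Import structures.
Require Import Defs.
From mathcomp Require Import all_boot all_order all_algebra.
From mathcomp Require Import all_classical all_reals all_analysis.
From mathcomp Require Import measurable_realfun complex ring lra.
Set Implicit Arguments.
Unset Strict Implicit.
Unset Printing Implicit Defensive.
Import Order.TTheory GRing.Theory Num.Theory.
Import numFieldNormedType.Exports.
Local Open Scope classical_set_scope.
Local Open Scope complex_scope.
Local Open Scope ring_scope.

(** The obstacle is the zeros of [h]. The mean value property at [w] would bound [|h w f w|], which
    may vanish although [h z f w] does not, so [h z] has to be compared with [h] at a point that
    also sees [f w]. On a suitable square a polynomial-like restriction of [h] is bounded below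
    along the whole boundary, all roots being avoided, while Cauchy's formula gives a boundary point
    at which [f] is at least a fifth of its central value: the two bounds multiply there. A single
    parabola does not suffice: doubling needs a lower bound at a fixed scale, and the parabola that
    reaches [z] need not have one uniformly in [w] and [z]. The supremum over the family makes [Mr]
    common to both comparisons. Polynomial-like means that the Taylor polynomial of degree [m]
    dominates at scale [r]: its remainder, measured on the square of half-side [Th * r], is
    [O(1 / Th)] times [Mr], which fixes [Th] after [m] and [K]. Since [d / r] is of order
    [sqrt (F / delta)], doubling yields a half-integral power, rounded up to [N = m + 1]. All discs
    are squares, because contours are rectangles. *)

Local Notation nrm := Normc.normc.

(** * Modulus, real and imaginary parts of complex numbers *)

Section ComplexModulus.
Context (R : realType).
Implicit Types (z u : R[i]) (g : R[i] -> R[i]).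

Lemma normCE z : `|z| = (nrm z)%:C.
Proof. by rewrite normc_def; case: z. Qed.

Lemma nrm_ge0 z : 0 <= nrm z.
Proof. by case: z => a b /=; rewrite sqrtr_ge0. Qed.

Lemma nrm0 : nrm (0 : R[i]) = 0. Proof. exact: Normc.normc0. Qed.

Lemma nrm1 : nrm (1 : R[i]) = 1. Proof. exact: Normc.normc1. Qed.

Lemma nrm_eq0 z : (nrm z == 0) = (z == 0).
Proof. by apply/eqP/eqP => [/Normc.eq0_normc//|->]; rewrite nrm0. Qed.

Lemma nrm_gt0 z : (0 < nrm z) = (z != 0).
Proof. by rewrite lt_def nrm_ge0 andbT nrm_eq0. Qed.

Lemma nrmD z u : nrm (z + u) <= nrm z + nrm u.
Proof. exact: le_normcD. Qed.

Lemma nrmN z : nrm (- z) = nrm z.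
Proof. exact: normcN. Qed.

Lemma nrmBC z u : nrm (z - u) = nrm (u - z).
Proof. by rewrite -nrmN opprB. Qed.

Lemma nrmB z u : nrm (z - u) <= nrm z + nrm u.
Proof. by rewrite (le_trans (nrmD _ _))// nrmN. Qed.

Lemma lerB_nrm z u : nrm z - nrm u <= nrm (z - u).
Proof. by rewrite lerBlDr (le_trans _ (nrmD _ _))// subrK. Qed.

Lemma nrmM z u : nrm (z * u) = nrm z * nrm u.
Proof. exact: Normc.normcM. Qed.

Lemma nrmV z : nrm z^-1 = (nrm z)^-1.
Proof. exact: Normc.normcV. Qed.

Lemma nrmX z k : nrm (z ^+ k) = nrm z ^+ k.
Proof. by elim: k => [|k IH]; rewrite ?expr0 ?nrm1// !exprS nrmM IH. Qed.

Lemma nrm_real (x : R) : nrm x%:C = `|x|.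
Proof. by rewrite /= expr0n/= addr0 sqrtr_sqr. Qed.

Lemma nrm_i : nrm ('i : R[i]) = 1.
Proof. by rewrite /= expr0n/= add0r expr1n sqrtr1. Qed.

Lemma Re_le_nrm z : `|complex.Re z| <= nrm z.
Proof.
case: z => a b /=; rewrite -[leLHS]sqrtr_sqr.
by rewrite ler_wsqrtr// lerDl sqr_ge0.
Qed.

Lemma Im_le_nrm z : `|complex.Im z| <= nrm z.
Proof.
case: z => a b /=; rewrite -[leLHS]sqrtr_sqr.
by rewrite ler_wsqrtr// lerDr sqr_ge0.
Qed.

Lemma nrm_le_ReIm z : nrm z <= `|complex.Re z| + `|complex.Im z|.
Proof.
rewrite {1}(complexE z) (le_trans (nrmD _ _))//.
by rewrite nrmM nrm_i mul1r !nrm_real.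
Qed.

Lemma nrm_sum (I : Type) (r : seq I) (P : pred I) (F : I -> R[i]) :
  nrm (\sum_(i <- r | P i) F i) <= \sum_(i <- r | P i) nrm (F i).
Proof.
elim/big_ind2 : _ => //; first by rewrite nrm0.
by move=> a b c d ab cd; rewrite (le_trans (nrmD _ _))// lerD.
Qed.

Lemma ReD z u : complex.Re (z + u) = complex.Re z + complex.Re u.
Proof. by case: z u => [a b] [c d]. Qed.

Lemma ImD z u : complex.Im (z + u) = complex.Im z + complex.Im u.
Proof. by case: z u => [a b] [c d]. Qed.

Lemma ReN z : complex.Re (- z) = - complex.Re z.
Proof. by case: z. Qed.

Lemma ImN z : complex.Im (- z) = - complex.Im z.
Proof. by case: z. Qed.

Lemma ReM z u : complex.Re (z * u) =
  complex.Re z * complex.Re u - complex.Im z * complex.Im u.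
Proof. by case: z u => [a b] [c d]. Qed.

Lemma ImM z u : complex.Im (z * u) =
  complex.Re z * complex.Im u + complex.Im z * complex.Re u.
Proof. by case: z u => [a b] [c d]. Qed.

Lemma eqC z u : complex.Re z = complex.Re u -> complex.Im z = complex.Im u ->
  z = u.
Proof. by case: z u => [a b] [c d] /= -> ->. Qed.

Lemma posC_real (d : R[i]) : 0 < d -> d = (complex.Re d)%:C /\ 0 < complex.Re d.
Proof.
case: d => a b; rewrite ltcE /= => /andP[/eqP b0 a0]; split => //.
by rewrite b0.
Qed.

Lemma nbhs_nrmP z (P : set R[i]) : nbhs z P <->
  exists2 e : R, 0 < e & forall u, nrm (u - z) < e -> P u.
Proof.
split.
  move=> /nbhs_ballP[d /= /posC_real[-> d0] dP]; exists (complex.Re d) => // u uz.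
  by apply: dP; rewrite -ball_normE/= normCE ltcR nrmBC.
move=> [e e0 eP]; apply/nbhs_ballP; exists e%:C; first by rewrite /= ltcR.
by move=> u; rewrite -ball_normE/= normCE ltcR nrmBC; exact: eP.
Qed.

Lemma continuous_nrmP (T : topologicalType) (F : T -> R[i]) x :
  {for x, continuous F} <->
  forall e : R, 0 < e -> \forall y \near x, nrm (F y - F x) < e.
Proof.
split=> [cF e e0|cF P /nbhs_nrmP[e e0 eP]].
  by apply: (cF [set u | nrm (u - F x) < e]); apply/nbhs_nrmP; exists e.
by apply: filterS (cF _ e0) => y; exact: eP.
Qed.

Lemma continuous_Re (T : topologicalType) (F : T -> R[i]) x :
  {for x, continuous F} -> {for x, continuous (fun y => complex.Re (F y))}.
Proof.
move=> /continuous_nrmP cF; apply/cvgrPdist_lt => e /cF; apply: filterS => y.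
by apply: le_lt_trans; rewrite distrC -ReN -ReD Re_le_nrm.
Qed.

Lemma continuous_Im (T : topologicalType) (F : T -> R[i]) x :
  {for x, continuous F} -> {for x, continuous (fun y => complex.Im (F y))}.
Proof.
move=> /continuous_nrmP cF; apply/cvgrPdist_lt => e /cF; apply: filterS => y.
by apply: le_lt_trans; rewrite distrC -ImN -ImD Im_le_nrm.
Qed.

Lemma continuous_nrm (T : topologicalType) (F : T -> R[i]) x :
  {for x, continuous F} -> {for x, continuous (fun y => nrm (F y))}.
Proof.
move=> /continuous_nrmP cF; apply/cvgrPdist_lt => e /cF; apply: filterS => y.
apply: le_lt_trans.
by rewrite distrC ler_norml lerB_nrm andbT lerNl opprB nrmBC lerB_nrm.
Qed.

(** The first-order expansion with an explicit error, in the form that Goursat's argument consumes;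
    [D] is the complex derivative. *)
Lemma differentiable_eps g z : differentiable g z ->
  exists D, forall e : R, 0 < e -> exists2 d : R, 0 < d &
    forall u, nrm (u - z) < d -> nrm (g u - g z - D * (u - z)) <= e * nrm (u - z).
Proof.
move=> /derivable1_diffP/cvg_ex[D]; rewrite /= => gD; exists D => e e0.
have /nbhs_nrmP[d d0 dP] : nbhs (0 : R[i]) [set h : R[i] | h != 0 ->
    nrm (D - h^-1 *: (g (h *: 1 + z) - g z)) < e].
  have ec0 : 0 < e%:C :> R[i] by rewrite ltcR.
  move/cvgrPdist_lt : gD => /(_ _ ec0); rewrite near_withinE.
  by apply: filterS => h gh h0; have := gh h0; rewrite normCE ltcR.
exists d => // u uz.
have [->|neq] := eqVneq u z; first by rewrite !subrr mulr0 subr0 nrm0 mulr0.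
have uz0 : u - z != 0 by rewrite subr_eq0.
have := dP (u - z); rewrite subr0 => /(_ uz uz0).
rewrite [_ *: 1]mulr1 subrK => lt_e.
rewrite (_ : _ - _ = - ((u - z) * (D - (u - z)^-1 *: (g u - g z)))).
  by rewrite nrmN nrmM mulrC ler_wpM2r ?nrm_ge0// ltW.
rewrite -[_ *: _]/((u - z)^-1 * (g u - g z)).
by rewrite [in RHS]mulrBr [in RHS]mulrA divff// mul1r opprB [D * _]mulrC.
Qed.

End ComplexModulus.

(** * Cauchy formula and Taylor expansion on squares *)

Section Cint.
Context (R : realType).
Notation mu := (@lebesgue_measure R).
Implicit Types (a b c d x y : R) (f : R -> R) (F G : R -> R[i]).

(** The neighbourhoods are two-sided also at [a] and [b], as for restrictions of functions of [R[i]]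
    continuous at each point of a segment; sub-intervals then inherit the property at once. *)
Definition cont_on (V : topologicalType) a b (F : R -> V) :=
  forall x, a <= x <= b -> {for x, continuous F}.

Lemma cont_on_integrable a b f : cont_on a b f ->
  mu.-integrable `[a, b] (EFin \o f).
Proof.
move=> cf; apply: continuous_compact_integrable; first exact: segment_compact.
apply: continuous_in_subspaceT => x; rewrite inE/= in_itv/=; exact: cf.
Qed.

Definition cint a b F : R[i] :=
  (\int[mu]_(x in `[a, b]) complex.Re (F x)) +i*
  (\int[mu]_(x in `[a, b]) complex.Im (F x)).

Lemma cont_on_Re a b F : cont_on a b F -> cont_on a b (fun x => complex.Re (F x)).
Proof. by move=> cF x /cF; exact: continuous_Re. Qed.

Lemma cont_on_Im a b F : cont_on a b F -> cont_on a b (fun x => complex.Im (F x)).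
Proof. by move=> cF x /cF; exact: continuous_Im. Qed.

Lemma cont_onD a b F G : cont_on a b F -> cont_on a b G ->
  cont_on a b (fun x => F x + G x).
Proof. by move=> cF cG x /[dup] /cF cFx /cG; exact: continuousD. Qed.

Lemma cont_onN a b F : cont_on a b F -> cont_on a b (fun x => - F x).
Proof. by move=> cF x /cF cFx; exact: continuousN. Qed.

Lemma cont_onB a b F G : cont_on a b F -> cont_on a b G ->
  cont_on a b (fun x => F x - G x).
Proof. by move=> cF /cont_onN; exact: cont_onD. Qed.

Lemma cont_onM a b F G : cont_on a b F -> cont_on a b G ->
  cont_on a b (fun x => F x * G x).
Proof. by move=> cF cG x /[dup] /cF cFx /cG; exact: continuousM. Qed.

Lemma cont_on_cst a b (v : R[i]) : cont_on a b (fun=> v).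
Proof. by move=> x _; exact: cst_continuous. Qed.

Lemma eq_cint a b F G : (forall x, a <= x <= b -> F x = G x) ->
  cint a b F = cint a b G.
Proof.
move=> FG; rewrite /cint; congr (_ +i* _); apply: eq_Rintegral => x;
by rewrite inE/= in_itv/= => /FG ->.
Qed.

Lemma cintD a b F G : cont_on a b F -> cont_on a b G ->
  cint a b (fun x => F x + G x) = cint a b F + cint a b G.
Proof.
move=> cF cG; rewrite {1}/cint.
under eq_Rintegral do rewrite ReD.
under [X in _ +i* X]eq_Rintegral do rewrite ImD.
by rewrite !RintegralD//; apply: cont_on_integrable;
  do ?[exact: cont_on_Re|exact: cont_on_Im].
Qed.

Lemma cintZ a b (v : R[i]) F : cont_on a b F ->
  cint a b (fun x => v * F x) = v * cint a b F.
Proof.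
move=> cF; rewrite {1}/cint.
have iR := cont_on_integrable (cont_on_Re cF).
have iI := cont_on_integrable (cont_on_Im cF).
have ZR r : mu.-integrable `[a, b] (EFin \o (fun x => r * complex.Re (F x))).
  exact: (integrableZl _ r iR).
have ZI r : mu.-integrable `[a, b] (EFin \o (fun x => r * complex.Im (F x))).
  exact: (integrableZl _ r iI).
under eq_Rintegral do rewrite ReM.
under [X in _ +i* X]eq_Rintegral do rewrite ImM.
rewrite RintegralB// RintegralD// !RintegralZl//.
by apply: eqC; rewrite ?ReM ?ImM.
Qed.

Lemma cintB a b F G : cont_on a b F -> cont_on a b G ->
  cint a b (fun x => F x - G x) = cint a b F - cint a b G.
Proof.
move=> cF cG; rewrite (cintD cF (cont_onN cG)).
congr (_ + _); rewrite -[RHS]mulN1r -(cintZ _ cG).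
by apply: eq_cint => x _; rewrite mulN1r.
Qed.

Lemma cint_cst a b (v : R[i]) : a <= b -> cint a b (fun=> v) = v * (b - a)%:C.
Proof.
move=> ab; rewrite /cint !Rintegral_cst//=.
rewrite lebesgue_measure_itv/= lte_fin.
have ba : fine (if a < b then (b%:E - a%:E)%E else 0%E) = b - a :> R.
  by move: ab; rewrite le_eqVlt => /predU1P[->|->//]; rewrite ltxx subrr.
by rewrite ba; apply: eqC; rewrite ?ReM ?ImM/=; ring.
Qed.

Lemma cint_split a c b F : a <= c -> c <= b -> cont_on a b F ->
  cint a b F = cint a c F + cint c b F.
Proof.
move=> ac cb cF; rewrite /cint; apply: eqC; rewrite ?ReD ?ImD/=.
  have iR := cont_on_integrable (cont_on_Re cF).
  rewrite -(@Rintegral_itv_obnd_cbnd _ c (BRight b)); last first.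
    apply: integrableS iR => //; apply: subset_itv; rewrite ?bnd_simp//.
  rewrite -(@Rintegral_itvB _ _ (BLeft a) (BRight b) c)// ?bnd_simp//.
  by rewrite addrC subrK.
have iI := cont_on_integrable (cont_on_Im cF).
rewrite -(@Rintegral_itv_obnd_cbnd _ c (BRight b)); last first.
  apply: integrableS iI => //; apply: subset_itv; rewrite ?bnd_simp//.
rewrite -(@Rintegral_itvB _ _ (BLeft a) (BRight b) c)// ?bnd_simp//.
by rewrite addrC subrK.
Qed.

(** Real and imaginary parts are bounded separately by the integral of the modulus, whence the
    factor 2. *)
Lemma nrm_cint_le_integral a b F : cont_on a b F ->
  ((nrm (cint a b F))%:E <= 2%:E * \int[mu]_(x in `[a, b]) (nrm (F x))%:E)%E.
Proof.
move=> cF.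
have iR := cont_on_integrable (cont_on_Re cF).
have iI := cont_on_integrable (cont_on_Im cF).
have cnF : cont_on a b (fun x => nrm (F x)) by move=> x /cF; exact: continuous_nrm.
have mF := measurable_int _ (cont_on_integrable cnF).
apply: (@le_trans _ _ (`|\int[mu]_(x in `[a, b]) complex.Re (F x)|%:E +
  `|\int[mu]_(x in `[a, b]) complex.Im (F x)|%:E)%E).
  by rewrite lee_fin; exact: (nrm_le_ReIm (cint a b F)).
rewrite mule_natl mule2n leeD// EFin_normr_Rintegral//.
  have mR := measurable_int _ iR.
  apply: (le_trans (le_abse_integral _ _ _)) => //.
  apply: ge0_le_integral => //=.
  - exact: (measurable_int _ (integrable_abse iR)).
  - by move=> x _; rewrite lee_fin Re_le_nrm.
have mI := measurable_int _ iI.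
apply: (le_trans (le_abse_integral _ _ _)) => //.
apply: ge0_le_integral => //=.
- exact: (measurable_int _ (integrable_abse iI)).
- by move=> x _; rewrite lee_fin Im_le_nrm.
Qed.

Lemma nrm_cint_le a b F (M : R) : a <= b -> cont_on a b F ->
  (forall x, a <= x <= b -> nrm (F x) <= M) ->
  nrm (cint a b F) <= 2 * M * (b - a).
Proof.
move=> ab cF FM; rewrite -lee_fin (le_trans (nrm_cint_le_integral cF))//.
rewrite -mulrA EFinM lee_pmul2l//.
apply: (@le_trans _ _ (\int[mu]_(x in `[a, b]) (cst M%:E) x)%E).
  apply: le_integral => //=.
  - apply: (@cont_on_integrable a b (fun x => nrm (F x))) => x /cF.
    exact: continuous_nrm.
  - by apply: (@cont_on_integrable a b (cst M)) => x _; exact: cst_continuous.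
  - by move=> x; rewrite inE/= in_itv/= => /FM; rewrite lee_fin.
rewrite integral_cst//= lebesgue_measure_itv/= lte_fin.
by move: ab; rewrite le_eqVlt => /predU1P[->|->//]; rewrite ltxx subrr mule0 mulr0.
Qed.

Lemma cint_shift a b t F : a <= b -> cont_on (a + t) (b + t) F ->
  cint (a + t) (b + t) F = cint a b (fun x => F (x + t)).
Proof.
move=> ab cF.
have shift (f : R -> R) : cont_on (a + t) (b + t) f ->
    \int[mu]_(x in `[a + t, b + t]) f x = \int[mu]_(x in `[a, b]) f (x + t).
  move=> cf; congr fine.
  have D1 x : derive1 (fun x => x + t) x = 1 :> R.
    rewrite derive1E.
    suff /@derive_val : is_derive x 1 (fun x => x + t : R) 1 by [].
    by apply: is_derive_eq; rewrite addr0.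
  have D1f : derive1 (fun x => x + t) = cst 1 :> (R -> R) by apply/funext.
  have cs : continuous (fun x => x + t : R).
    by move=> x; apply: continuousD; [exact: cvg_id|exact: cvg_cst].
  rewrite (@integration_by_substitution_increasing _ (fun x => x + t) f)//.
  - by apply: eq_integral => x _ /=; rewrite D1f /= mulr1.
  - by move=> x y _ _ xy; rewrite ltrD2r.
  - by rewrite D1f => x _; exact: cst_continuous.
  - by rewrite D1f; exact: is_cvg_cst.
  - by rewrite D1f; exact: is_cvg_cst.
  - split => //.
    + by apply: cvg_at_right_filter; exact: cs.
    + by apply: cvg_at_left_filter; exact: cs.
  - apply: continuous_in_subspaceT => x; rewrite inE/= in_itv/=; exact: cf.
by rewrite /cint !shift//; [exact: cont_on_Im|exact: cont_on_Re].
Qed.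

End Cint.

Section Goursat.
Context (R : realType).
Implicit Types (a b c d x y : R).

Lemma nested_intervals (lo w : nat -> R) :
  (forall n, lo n <= lo n.+1) -> (forall n, lo n.+1 + w n.+1 <= lo n + w n) ->
  (forall n, 0 <= w n) -> exists x, forall n, lo n <= x <= lo n + w n.
Proof.
move=> lolo hihi w0.
have lomono m n : (m <= n)%N -> lo m <= lo n.
  by move=> /subnK <-; elim: (n - m)%N => [//|k IH]; rewrite (le_trans IH)// addSn.
have himono m n : (m <= n)%N -> lo n + w n <= lo m + w m.
  move=> /subnK <-; elim: (n - m)%N => [//|k IH]; rewrite addSn.
  exact: (le_trans _ IH).
have lohi m n : lo m <= lo n + w n.
  have [mn|/ltnW nm] := leqP m n.
    by rewrite (le_trans (lomono _ _ mn))// lerDl.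
  by rewrite (le_trans _ (himono _ _ nm))// lerDl.
have ub n : ubound (range lo) (lo n + w n) by move=> _ [m _ <-].
exists (sup (range lo)) => n; apply/andP; split.
  apply: ub_le_sup; first by exists (lo 0%N + w 0%N); exact: ub.
  by exists n.
by apply: ge_sup; [exists (lo 0%N), 0%N | exact: ub].
Qed.

(* Bisection: the rectangle is repeatedly replaced by a quarter carrying at
   least a quarter of the modulus of [J]. *)
Lemma rect_additive_eq0 (J : R -> R -> R -> R -> R[i]) a b c d :
  a <= b -> c <= d ->
  (forall a' m b' c' d', a <= a' -> a' <= m -> m <= b' -> b' <= b ->
     c <= c' -> c' <= d' -> d' <= d ->
     J a' b' c' d' = J a' m c' d' + J m b' c' d') ->
  (forall a' b' c' m d', a <= a' -> a' <= b' -> b' <= b ->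
     c <= c' -> c' <= m -> m <= d' -> d' <= d ->
     J a' b' c' d' = J a' b' c' m + J a' b' m d') ->
  (forall x y, a <= x <= b -> c <= y <= d -> forall e, 0 < e ->
     exists2 r, 0 < r & forall a' b' c' d', a <= a' <= x -> x <= b' <= b ->
       c <= c' <= y -> y <= d' <= d -> b' - a' < r -> d' - c' < r ->
       nrm (J a' b' c' d') <= e * (b' - a' + (d' - c')) ^+ 2) ->
  J a b c d = 0.
Proof.
move=> ab cd Jx Jy Jloc.
pose W n := (b - a) * 2^-1 ^+ n; pose H n := (d - c) * 2^-1 ^+ n.
have W2 n : W n = W n.+1 + W n.+1 by rewrite /W exprS; field.
have H2 n : H n = H n.+1 + H n.+1 by rewrite /H exprS; field.
have W0 n : 0 <= W n by rewrite mulr_ge0 ?subr_ge0// exprn_ge0.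
have H0 n : 0 <= H n by rewrite mulr_ge0 ?subr_ge0// exprn_ge0.
pose K n (p : R * R) := J p.1 (p.1 + W n) p.2 (p.2 + H n).
pose ok n (p : R * R) :=
  [&& a <= p.1, p.1 + W n <= b, c <= p.2 & p.2 + H n <= d].
have step n (p : R * R) : exists q : R * R, ok n p ->
    [/\ ok n.+1 q, nrm (K n p) <= 4 * nrm (K n.+1 q), p.1 <= q.1 <= p.1 + W n.+1
      & p.2 <= q.2 <= p.2 + H n.+1].
  have [okp|] := boolP (ok n p); last by exists p.
  have /and4P[pa pb pc pd] := okp.
  have W0' := W0 n.+1; have H0' := H0 n.+1.
  have KE : K n p = K n.+1 p + K n.+1 (p.1, p.2 + H n.+1) +
     (K n.+1 (p.1 + W n.+1, p.2) + K n.+1 (p.1 + W n.+1, p.2 + H n.+1)).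
    move: pb pd; rewrite /K W2 H2 !addrA /= => pb pd.
    rewrite (Jx p.1 (p.1 + W n.+1)); [|lra..].
    rewrite (Jy p.1 _ p.2 (p.2 + H n.+1)); [|lra..].
    rewrite (Jy (p.1 + W n.+1) _ p.2 (p.2 + H n.+1)); [by rewrite addrA|lra..].
  (* If each quarter carried less than a quarter of the modulus, the triangle inequality applied to
     [KE] would fail. *)
  have [q [qok qK]] : exists q : R * R,
      ((q.1 = p.1 \/ q.1 = p.1 + W n.+1) /\ (q.2 = p.2 \/ q.2 = p.2 + H n.+1)) /\
      nrm (K n p) <= 4 * nrm (K n.+1 q).
    apply: contrapT => no.
    have {}no q1 q2 : (q1 = p.1 \/ q1 = p.1 + W n.+1) ->
        (q2 = p.2 \/ q2 = p.2 + H n.+1) -> 4 * nrm (K n.+1 (q1, q2)) < nrm (K n p).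
      by move=> q1p q2p; rewrite ltNge; apply/negP => le; apply: no; exists (q1, q2).
    have n1 := no _ _ (or_introl erefl) (or_introl erefl).
    have n2 := no _ _ (or_introl erefl) (or_intror erefl).
    have n3 := no _ _ (or_intror erefl) (or_introl erefl).
    have n4 := no _ _ (or_intror erefl) (or_intror erefl).
    have : nrm (K n p) <= nrm (K n.+1 p) + nrm (K n.+1 (p.1, p.2 + H n.+1)) +
       (nrm (K n.+1 (p.1 + W n.+1, p.2)) + nrm (K n.+1 (p.1 + W n.+1, p.2 + H n.+1))).
      by rewrite KE (le_trans (nrmD _ _))// lerD// nrmD.
    move: n1 n2 n3 n4; rewrite -surjective_pairing; lra.
  exists q => _; rewrite /ok.
  move: pb pd; rewrite W2 H2 => pb pd.
  by case: qok => -[->|->] [->|->]; split => //; try lra; apply/and4P; split; lra.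
have {step} [f fP] : exists f : nat -> R * R -> R * R, forall n p, ok n p ->
    [/\ ok n.+1 (f n p), nrm (K n p) <= 4 * nrm (K n.+1 (f n p)),
      p.1 <= (f n p).1 <= p.1 + W n.+1 & p.2 <= (f n p).2 <= p.2 + H n.+1].
  have /choice[g gP] : forall np : nat * (R * R), exists q, ok np.1 np.2 ->
    [/\ ok np.1.+1 q, nrm (K np.1 np.2) <= 4 * nrm (K np.1.+1 q),
      np.2.1 <= q.1 <= np.2.1 + W np.1.+1 & np.2.2 <= q.2 <= np.2.2 + H np.1.+1].
    by move=> [n p]; exact: step.
  by exists (fun n p => g (n, p)) => n p; exact: (gP (n, p)).
pose s := fix s n := if n is m.+1 then f m (s m) else (a, c).
have W00 : W 0%N = b - a by rewrite /W expr0 mulr1.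
have H00 : H 0%N = d - c by rewrite /H expr0 mulr1.
have oks n : ok n (s n).
  elim: n => [|n IH]; last by have [] := fP _ _ IH.
  by rewrite -[s 0%N]/(a, c) /ok /= W00 H00; apply/and4P; split; lra.
have Ks n : nrm (K 0%N (s 0%N)) <= 4 ^+ n * nrm (K n (s n)).
  elim: n => [|n IH]; first by rewrite expr0 mul1r.
  rewrite (le_trans IH)// exprSr -mulrA ler_wpM2l ?exprn_ge0//.
  by have [] := fP _ _ (oks n).
have [x xP] : exists x, forall n, (s n).1 <= x <= (s n).1 + W n.
  apply: nested_intervals => // n; have [_ _ /andP[]//] := fP _ _ (oks n).
  by move=> _ +; rewrite -[s n.+1]/(f n (s n)) (W2 n); lra.
have [y yP] : exists y, forall n, (s n).2 <= y <= (s n).2 + H n.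
  apply: nested_intervals => // n; have [_ _ _ /andP[]//] := fP _ _ (oks n).
  by move=> _ +; rewrite -[s n.+1]/(f n (s n)) (H2 n); lra.
apply/eqP; rewrite -nrm_eq0 eq_le nrm_ge0 andbT.
have K0E : K 0%N (s 0%N) = J a b c d by rewrite /K W00 H00 /= [a + _]addrC [c + _]addrC !subrK.
have xab : a <= x <= b by have := xP 0%N; rewrite W00 /= [a + _]addrC subrK.
have ycd : c <= y <= d by have := yP 0%N; rewrite H00 /= [c + _]addrC subrK.
(* After [n] bisections the rectangle still carries a share [4^-n] of the modulus, while the square
   of its semiperimeter has shrunk by the same factor: the quadratic local bound transfers to the
   whole rectangle. *)
have small e : 0 < e -> nrm (J a b c d) <= e * (b - a + (d - c)) ^+ 2.
  move=> e0; have [r r0 rP] := Jloc x y xab ycd e e0.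
  have [n nr] : exists n, (b - a + (d - c)) * 2^-1 ^+ n < r.
    have D0 : 0 < b - a + (d - c) + 1 by move: ab cd; lra.
    have : (fun n => (2^-1 : R) ^+ n) @ \oo --> 0.
      by apply: cvg_expr; rewrite ger0_norm// invf_lt1// ltr1n.
    have rD : 0 < r / (b - a + (d - c) + 1) by rewrite divr_gt0.
    move=> /cvgrPdist_lt/(_ _ rD)[n _ /(_ n (leqnn n))]/=.
    rewrite sub0r normrN ger0_norm ?exprn_ge0// ltr_pdivlMr// => lt_r.
    exists n; rewrite mulrC; apply: le_lt_trans lt_r.
    by rewrite ler_wpM2l ?exprn_ge0// lerDl.
  rewrite -K0E (le_trans (Ks n))//.
  have /and4P[sa sb sc sd] := oks n.
  have /andP[x1 x2] := xP n; have /andP[y1 y2] := yP n.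
  have wh : 0 <= W n + H n by rewrite addr_ge0.
  have WHr : W n + H n < r by rewrite /W /H -mulrDl.
  have := rP (s n).1 ((s n).1 + W n) (s n).2 ((s n).2 + H n).
  rewrite sa x1 x2 sb sc y1 y2 sd => /(_ isT isT isT isT).
  have addKn (u v : R) : u + v - u = v by rewrite addrC addKr.
  rewrite !addKn.
  have wr : W n < r by apply: le_lt_trans WHr; rewrite lerDl.
  have hr : H n < r by apply: le_lt_trans WHr; rewrite lerDr.
  move=> /(_ wr hr) Kn.
  apply: (@le_trans _ _ (4 ^+ n * (e * (W n + H n) ^+ 2))).
    by rewrite ler_wpM2l ?exprn_ge0.
  rewrite /W /H -mulrDl; set D := b - a + (d - c).
  rewrite (_ : 4 ^+ n * _ = e * D ^+ 2 * (4 * 2^-1 ^+ 2) ^+ n); last first.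
    rewrite [(4 * _) ^+ n]exprMn -(exprM 2^-1 2 n) mulnC exprM.
    by move: (4 ^+ n) (2^-1 ^+ n) => u v; ring.
  by rewrite (_ : 4 * _ = 1) ?expr1n ?mulr1//; field.
apply/ler_addgt0Pl => e e0; rewrite addr0.
have D0 : 0 < (b - a + (d - c)) ^+ 2 + 1 by rewrite ltr_pwDr// sqr_ge0.
have := small _ (divr_gt0 e0 D0) => /le_trans; apply.
by rewrite mulrAC ler_pdivrMr// ler_wpM2l ?(ltW e0)// lerDl.
Qed.

End Goursat.

Section Cauchy.
Context (R : realType).
Implicit Types (a b c d x y : R) (F G g : R[i] -> R[i]) (T z : R[i]).

(** Contour integral along the boundary, counterclockwise: bottom minus top, then [i] times right
    minus left. *)
Definition rectint F a b c d : R[i] :=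
  cint a b (fun x => F (x +i* c) - F (x +i* d)) +
  'i%C * cint c d (fun y => F (b +i* y) - F (a +i* y)).

Definition on_rect (P : R[i] -> Prop) a b c d :=
  forall x y, a <= x <= b -> c <= y <= d -> P (x +i* y).

Lemma nrm_real_part (x x' y : R) : nrm ((x' +i* y) - (x +i* y)) = `|x' - x|.
Proof. by rewrite /= subrr expr0n/= addr0 sqrtr_sqr. Qed.

Lemma nrm_imag_part (x y y' : R) : nrm ((x +i* y') - (x +i* y)) = `|y' - y|.
Proof. by rewrite /= subrr expr0n/= add0r sqrtr_sqr. Qed.

Lemma continuous_hline F x y : {for x +i* y, continuous F} ->
  {for x, continuous (fun t => F (t +i* y))}.
Proof.
move=> cF P /cF FP; have /nbhs_nrmP[e e0 eP] : nbhs (x +i* y) (F @^-1` P) by [].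
apply/nbhs_ballP; exists e => //= t; rewrite -ball_normE/= => te; apply: eP.
by rewrite nrm_real_part distrC.
Qed.

Lemma continuous_vline F x y : {for x +i* y, continuous F} ->
  {for y, continuous (fun t => F (x +i* t))}.
Proof.
move=> cF P /cF FP; have /nbhs_nrmP[e e0 eP] : nbhs (x +i* y) (F @^-1` P) by [].
apply/nbhs_ballP; exists e => //= t; rewrite -ball_normE/= => te; apply: eP.
by rewrite nrm_imag_part distrC.
Qed.

(** Continuity is asked on the sides only, since the integrands of interest have a pole inside. *)
Definition cont_sides F a b c d :=
  [/\ forall x, a <= x <= b -> {for x +i* c, continuous F},
      forall x, a <= x <= b -> {for x +i* d, continuous F},
      forall y, c <= y <= d -> {for a +i* y, continuous F} &
      forall y, c <= y <= d -> {for b +i* y, continuous F}].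

Lemma cont_sides_h F a b c d : cont_sides F a b c d ->
  cont_on a b (fun x => F (x +i* c)) /\ cont_on a b (fun x => F (x +i* d)).
Proof. by move=> [h1 h2 _ _]; split=> x xab; apply: continuous_hline; auto. Qed.

Lemma cont_sides_v F a b c d : cont_sides F a b c d ->
  cont_on c d (fun y => F (b +i* y)) /\ cont_on c d (fun y => F (a +i* y)).
Proof. by move=> [_ _ h1 h2]; split=> x xab; apply: continuous_vline; auto. Qed.

Lemma on_rect_sides F a b c d : a <= b -> c <= d ->
  on_rect (fun z => {for z, continuous F}) a b c d -> cont_sides F a b c d.
Proof. by move=> ab cd cF; split=> t td; apply: cF; rewrite ?lexx ?ab ?cd. Qed.

Lemma rectintD F G a b c d : cont_sides F a b c d -> cont_sides G a b c d ->
  rectint (fun z => F z + G z) a b c d = rectint F a b c d + rectint G a b c d.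
Proof.
move=> /[dup]/cont_sides_h[F1 F2]/cont_sides_v[F3 F4].
move=> /[dup]/cont_sides_h[G1 G2]/cont_sides_v[G3 G4].
have sw (p q r s : R[i]) : p + q - (r + s) = (p - r) + (q - s) by ring.
rewrite /rectint (eq_cint (fun x _ => sw _ _ _ _)).
rewrite (@eq_cint _ c d _ _ (fun x _ => sw _ _ _ _)).
rewrite (cintD (cont_onB F1 F2) (cont_onB G1 G2)).
rewrite (cintD (cont_onB F3 F4) (cont_onB G3 G4)); ring.
Qed.

Lemma rectintZ F a b c d v : cont_sides F a b c d ->
  rectint (fun z => v * F z) a b c d = v * rectint F a b c d.
Proof.
move=> /[dup]/cont_sides_h[F1 F2]/cont_sides_v[F3 F4].
rewrite /rectint (eq_cint (fun x _ => esym (mulrBr v _ _))).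
rewrite (@eq_cint _ c d _ _ (fun x _ => esym (mulrBr v _ _))).
rewrite (cintZ v (cont_onB F1 F2)) (cintZ v (cont_onB F3 F4)); ring.
Qed.

(** The differences over opposite sides are constant for an affine function, so the two integrals
    are explicit and cancel. *)
Lemma rectint_affine (u v : R[i]) a b c d : a <= b -> c <= d ->
  rectint (fun z => u + v * z) a b c d = 0.
Proof.
move=> ab cd; rewrite /rectint.
rewrite (@eq_cint _ a b _ (fun=> v * (0 +i* (c - d)))); last first.
  by move=> x _; apply: eqC; rewrite !(ReD, ImD, ReN, ImN, ReM, ImM)/=; ring.
rewrite (@eq_cint _ c d _ (fun=> v * (b - a)%:C)); last first.
  by move=> x _; apply: eqC; rewrite !(ReD, ImD, ReN, ImN, ReM, ImM)/=; ring.
by rewrite !cint_cst//; apply: eqC; rewrite !(ReD, ImD, ReN, ImN, ReM, ImM)/=; ring.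
Qed.

Lemma eq_rectint F G a b c d : a <= b -> c <= d ->
  on_rect (fun z => F z = G z) a b c d -> rectint F a b c d = rectint G a b c d.
Proof.
move=> ab cd FG; rewrite /rectint; congr (_ + _ * _); apply: eq_cint => t tab;
by rewrite !FG ?lexx ?ab ?cd.
Qed.

Lemma nrm_rectint_le F a b c d (M : R) : a <= b -> c <= d ->
  cont_sides F a b c d ->
  (forall x, a <= x <= b -> nrm (F (x +i* c)) <= M /\ nrm (F (x +i* d)) <= M) ->
  (forall y, c <= y <= d -> nrm (F (a +i* y)) <= M /\ nrm (F (b +i* y)) <= M) ->
  nrm (rectint F a b c d) <= 4 * M * (b - a + (d - c)).
Proof.
move=> ab cd /[dup]/cont_sides_h[F1 F2]/cont_sides_v[F3 F4] Mh Mv.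
have nB (p q : R[i]) : nrm p <= M -> nrm q <= M -> nrm (p - q) <= 2 * M.
  by move=> pM qM; rewrite (le_trans (nrmB _ _))//; lra.
rewrite (le_trans (nrmD _ _))// nrmM nrm_i mul1r.
have := nrm_cint_le ab (cont_onB F1 F2) (M := 2 * M).
move=> /(_ (fun x xab => nB _ _ (proj1 (Mh x xab)) (proj2 (Mh x xab)))).
have := nrm_cint_le cd (cont_onB F3 F4) (M := 2 * M).
move=> /(_ (fun x xab => nB _ _ (proj2 (Mv x xab)) (proj1 (Mv x xab)))).
lra.
Qed.

Lemma rectint_splitx F a m b c d : a <= m -> m <= b ->
  cont_sides F a b c d -> cont_sides F a m c d ->
  rectint F a b c d = rectint F a m c d + rectint F m b c d.
Proof.
move=> am mb /[dup]/cont_sides_h[F1 F2]/cont_sides_v[F3 F4].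
move=> /cont_sides_v[F5 _].
rewrite /rectint (cint_split am mb (cont_onB F1 F2)).
rewrite (@eq_cint _ c d _ (fun y => (F (m +i* y) - F (a +i* y)) +
   (F (b +i* y) - F (m +i* y)))); last by move=> y _; ring.
rewrite (cintD (cont_onB F5 F4) (cont_onB F3 F5)); ring.
Qed.

Lemma rectint_splity F a b c m d : c <= m -> m <= d ->
  cont_sides F a b c d -> cont_sides F a b c m ->
  rectint F a b c d = rectint F a b c m + rectint F a b m d.
Proof.
move=> cm md /[dup]/cont_sides_h[F1 F2]/cont_sides_v[F3 F4].
move=> /cont_sides_h[_ F5].
rewrite /rectint (cint_split cm md (cont_onB F3 F4)).
rewrite (@eq_cint _ a b _ (fun y => (F (y +i* c) - F (y +i* m)) +
   (F (y +i* m) - F (y +i* d)))); last by move=> y _; ring.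
rewrite (cintD (cont_onB F1 F5) (cont_onB F5 F2)); ring.
Qed.

(** Goursat: near a point the function is its affine expansion, whose integral vanishes, plus an
    error of at most [e / 4] times the semiperimeter. The contour bound [nrm_rectint_le] multiplies
    this by four semiperimeters, which is the local estimate of [rect_additive_eq0]. *)
Lemma rectint_differentiable_eq0 F a b c d : a <= b -> c <= d ->
  on_rect (fun z => differentiable F z) a b c d -> rectint F a b c d = 0.
Proof.
move=> ab cd dF.
have cF : on_rect (fun z => {for z, continuous F}) a b c d.
  by move=> x y xab ycd; apply: differentiable_continuous; exact: dF.
have cs a' b' c' d' : a <= a' -> a' <= b' -> b' <= b ->
    c <= c' -> c' <= d' -> d' <= d -> cont_sides F a' b' c' d'.
  move=> aa ab' bb cc cd' dd; apply: on_rect_sides => // x y xab ycd.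
  by apply: cF; lra.
apply: (rect_additive_eq0 ab cd) => [a' m b' c' d' *|a' b' c' m d' *|].
- by apply: rectint_splitx => //; apply: cs => //; lra.
- by apply: rectint_splity => //; apply: cs => //; lra.
move=> x y xab ycd e e0.
have [D FD] := differentiable_eps (dF x y xab ycd).
have e40 : 0 < e / 4 by rewrite divr_gt0.
(* Half of [r] for each side: the distance from a boundary point to [x +i* y] is at most the sum of
   the two side lengths. *)
have [r r0 rP] := FD _ e40; exists (r / 2); first by rewrite divr_gt0.
move=> a' b' c' d' /andP[a1 a2] /andP[b1 b2] /andP[c1 c2] /andP[d1 d2] br dr.
have ab' : a' <= b' by lra.
have cd' : c' <= d' by lra.
pose A z := F (x +i* y) - D * (x +i* y) + D * z.
pose E z := F z - A z.
have cA : continuous A.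
  move=> z; apply: (@continuousD _ _ _ (fun=> _) (fun z => D * z)).
    exact: cst_continuous.
  by apply: (@continuousM _ _ (fun=> D) id); [exact: cst_continuous|exact: cvg_id].
have csA : cont_sides A a' b' c' d' by split=> *; exact: cA.
have csE : cont_sides E a' b' c' d'.
  have [h1 h2 h3 h4] : cont_sides F a' b' c' d' by apply: cs; lra.
  by split=> t tP; apply: (@continuousB _ _ _ F A); do ?[exact: cA]; auto.
have FE : rectint F a' b' c' d' = rectint E a' b' c' d'.
  have A0 : rectint A a' b' c' d' = 0 by exact: rectint_affine.
  rewrite -[RHS]addr0 -A0 -(rectintD csE csA).
  by apply: (eq_rectint ab' cd') => u v _ _; rewrite /E subrK.
have Eb u v : a' <= u <= b' -> c' <= v <= d' ->
    nrm (E (u +i* v)) <= e / 4 * (b' - a' + (d' - c')).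
  move=> /andP[u1 u2] /andP[v1 v2].
  have uv : nrm ((u +i* v) - (x +i* y)) <= b' - a' + (d' - c').
    rewrite (le_trans (nrm_le_ReIm _))// lerD//= ler_norml; lra.
  rewrite (_ : E _ = F (u +i* v) - F (x +i* y) - D * ((u +i* v) - (x +i* y))).
    rewrite (le_trans (rP _ _)) ?ler_pM2l//.
    by apply: le_lt_trans uv _; lra.
  by rewrite /E /A; ring.
rewrite FE (le_trans (nrm_rectint_le _ _ csE (M := e / 4 * (b' - a' + (d' - c'))) _ _))//.
- by move=> u uab; split; apply: Eb => //; lra.
- by move=> v vcd; split; apply: Eb => //; lra.
- by rewrite expr2 le_eqVlt; apply/orP; left; apply/eqP; field.
Qed.

(* The contour can be shrunk around a singularity at [t1 +i* t2]. *)
Lemma rectint_frame F t1 t2 a b c d a' b' c' d' :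
  a < a' -> a' < t1 -> t1 < b' -> b' < b ->
  c < c' -> c' < t2 -> t2 < d' -> d' < d ->
  on_rect (fun z => z != t1 +i* t2 -> differentiable F z) a b c d ->
  rectint F a b c d = rectint F a' b' c' d'.
Proof.
move=> a1 a2 b1 b2 c1 c2 d1 d2 dF.
have dFx x y : a <= x <= b -> c <= y <= d -> x != t1 -> differentiable F (x +i* y).
  by move=> xab ycd xt; apply: dF => //; rewrite eq_complex/= negb_and xt.
have dFy x y : a <= x <= b -> c <= y <= d -> y != t2 -> differentiable F (x +i* y).
  by move=> xab ycd xt; apply: dF => //; rewrite eq_complex/= negb_and xt orbT.
have cs p q r s : a <= p -> p <= q -> q <= b -> c <= r -> r <= s -> s <= d ->
    p != t1 -> q != t1 -> r != t2 -> s != t2 -> cont_sides F p q r s.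
  move=> *; split=> t tP; apply: differentiable_continuous;
  by do ?[apply: dFx => //; lra|apply: dFy => //; lra].
have z p q r s : a <= p -> p <= q -> q <= b -> c <= r -> r <= s -> s <= d ->
    (q < t1 \/ t1 < p) \/ (s < t2 \/ t2 < r) -> rectint F p q r s = 0.
  move=> ap pq qb cr rs sd H; apply: rectint_differentiable_eq0 => // x y xP yP.
  case: H => [xt|yt].
    have xt1 : x != t1 by apply/eqP; case: xt; lra.
    by apply: dFx => //; lra.
  have yt2 : y != t2 by apply/eqP; case: yt; lra.
  by apply: dFy => //; lra.
have ne (u v : R) : u < v \/ v < u -> u != v.
  by case=> h; [rewrite lt_eqF|rewrite gt_eqF].
have [na na' nb' nb] : [/\ a != t1, a' != t1, b' != t1 & b != t1].
  by split; apply: ne; lra.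
have [nc nc' nd' nd] : [/\ c != t2, c' != t2, d' != t2 & d != t2].
  by split; apply: ne; lra.
have sy p : c <= p -> p <= d -> p != t2 ->
    forall q, p <= q -> q <= d -> q != t2 ->
    rectint F a b p d = rectint F a b p q + rectint F a b q d.
  move=> cp pd np q pq qd nq.
  by apply: rectint_splity => //; apply: cs => //; lra.
have sx p : a <= p -> p <= b -> p != t1 -> forall q, p <= q -> q <= b -> q != t1 ->
    rectint F p b c' d' = rectint F p q c' d' + rectint F q b c' d'.
  move=> ap pb np q pq qb nq.
  by apply: rectint_splitx => //; apply: cs => //; lra.
(* The bottom, top, left and right strips that fill the frame all avoid the singularity; they are
   cut off one after the other. *)
have z1 : rectint F a b c c' = 0 by apply: z; lra.
have z2 : rectint F a b d' d = 0 by apply: z; lra.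
have z3 : rectint F a a' c' d' = 0 by apply: z; lra.
have z4 : rectint F b' b c' d' = 0 by apply: z; lra.
rewrite (sy c _ _ nc c') ?z1 ?add0r //; [|lra..].
rewrite (sy c' _ _ nc' d') ?z2 ?addr0 //; [|lra..].
rewrite (sx a _ _ na a') ?z3 ?add0r //; [|lra..].
by rewrite (sx a' _ _ na' b') ?z4 ?addr0 //; lra.
Qed.

End Cauchy.

Section CauchyFormula.
Context (R : realType).
Implicit Types (a b c d x y : R) (F G g : R[i] -> R[i]) (T z : R[i]).

(** The value [2 pi i] of Cauchy's formula, kept as an integral; the estimates rely on the bound
    [nrm_kappa_ge] of its modulus. *)
Definition kappa : R[i] := rectint (fun z => z^-1) (-1) 1 (-1) 1.

Lemma differentiable_subV T z : z != T ->
  differentiable (fun u : R[i] => (u - T)^-1) z.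
Proof.
move=> zT; apply: (@differentiableV _ _ (fun u => u - T)); last by rewrite subr_eq0.
by apply: (@differentiableB _ _ _ (fun u => u) (fun=> T)).
Qed.

Lemma differentiable_divX g z m : differentiable g z -> z != 0 ->
  differentiable (fun u : R[i] => g u * u^-1 ^+ m) z.
Proof.
move=> dg z0; apply: (@differentiableM _ _ g (fun u => u^-1 ^+ m)) => //.
have dV : differentiable (fun u : R[i] => u^-1) z.
  by apply: (@differentiableV _ _ (fun u => u)).
elim: m => [|m IH].
  by rewrite (_ : (fun _ => _) = cst 1)//; apply/funext => u; rewrite expr0.
rewrite (_ : (fun _ => _) = (fun u : R[i] => u^-1) * (fun u => u^-1 ^+ m)).
  exact: differentiableM.
by apply/funext => u; rewrite exprS.
Qed.

Lemma rectint_inv_square (r : R) : 0 < r ->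
  rectint (fun z => z^-1) (- r) r (- r) r = kappa.
Proof.
(* A square that strictly contains both the square of half-side [r] and the one of half-side 1; both
   integrals equal the one along its boundary. *)
move=> r0; pose B := r + 1 + 1.
have dV : on_rect (fun z => z != 0 +i* 0 -> differentiable (fun u : R[i] => u^-1) z)
    (- B) B (- B) B.
  by move=> x y _ _ z0; apply: (@differentiableV _ _ (fun u => u)).
have E u : 0 < u -> u <= r + 1 ->
    rectint (fun z : R[i] => z^-1) (- B) B (- B) B = rectint (fun z => z^-1) (- u) u (- u) u.
  by move=> u0 ur; apply: (rectint_frame _ _ _ _ _ _ _ _ dV); rewrite /B; lra.
by rewrite -E; [rewrite (E 1) //; lra|lra|lra].
Qed.

Lemma rectint_shift F a b c d (t1 t2 : R) : a <= b -> c <= d ->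
  cont_sides F (a + t1) (b + t1) (c + t2) (d + t2) ->
  rectint F (a + t1) (b + t1) (c + t2) (d + t2) =
  rectint (fun z => F (z + (t1 +i* t2))) a b c d.
Proof.
move=> ab cd /[dup]/cont_sides_h[F1 F2]/cont_sides_v[F3 F4].
by rewrite /rectint (cint_shift ab (cont_onB F1 F2)) (cint_shift cd (cont_onB F3 F4)).
Qed.

(** On each pair of opposite sides the integrands combine, up to a factor [i], to
    [2 / (1 + x ^+ 2)], which is at least 1 on an interval of length 2. *)
Lemma kappa_im_ge : 4 <= complex.Im kappa.
Proof.
have I_ge (F : R -> R[i]) : (forall x, F x = 0 +i* (2 / (1 + x ^+ 2))) ->
    cont_on (-1) 1 F -> 2 <= complex.Im (cint (-1) 1 F) /\ complex.Re (cint (-1) 1 F) = 0.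
  move=> FE cF; split.
    rewrite [leLHS](_ : _ = \int[@lebesgue_measure R]_(x in `[(-1), 1]) 1); last first.
      rewrite Rintegral_cst//= lebesgue_measure_itv/= lte_fin.
      by rewrite (_ : -1 < 1) /=; lra.
    apply: le_Rintegral => //.
    - by apply: (@cont_on_integrable _ _ _ (fun=> 1)) => x _; exact: cst_continuous.
    - by apply: (@cont_on_integrable _ _ _ (fun x => complex.Im (F x))); exact: cont_on_Im.
    move=> x; rewrite /= in_itv/= => x1; rewrite FE/= ler_pdivlMr; last by nra.
    by nra.
  by rewrite /= (@eq_Rintegral _ _ _ _ _ (fun=> 0)) ?Rintegral_cst ?mul0r// => x _; rewrite FE.
have dV : on_rect (fun z => z != 0 +i* 0 -> differentiable (fun u : R[i] => u^-1) z)
    (- 1) 1 (- 1) 1.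
  by move=> x y _ _ z0; apply: (@differentiableV _ _ (fun u => u)).
have cs : cont_sides (fun u : R[i] => u^-1) (-1) 1 (-1) 1.
  split=> t tP; apply: differentiable_continuous; apply: dV => //; try lra;
  rewrite eq_complex/= negb_and; apply/orP; first [by left; lra|by right; lra].
have [F1 F2] := cont_sides_h cs; have [F3 F4] := cont_sides_v cs.
have sq0 (x : R) : 1 + x ^+ 2 != 0 by rewrite gt_eqF//; nra.
have sq0' (x : R) : x ^+ 2 + 1 != 0 by rewrite gt_eqF//; nra.
rewrite /kappa /rectint ImD ImM/= mul0r add0r mul1r.
have [|h _] := I_ge (fun x => (x +i* -1)^-1 - (x +i* 1)^-1) _ (cont_onB F1 F2).
  by move=> x; apply: eqC; rewrite !(ReD, ImD, ReN, ImN)/= ?sqrrN ?expr1n;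
     field; rewrite ?sq0 ?sq0'.
pose V y := (1 +i* y)^-1 - ((-1) +i* y)^-1.
have VE y : V y = (2 / (1 + y ^+ 2))%:C.
  by apply: eqC; rewrite /V !(ReD, ImD, ReN, ImN)/= ?sqrrN ?expr1n;
     field; rewrite ?sq0 ?sq0'.
have := cintZ 'i%C (cont_onB F3 F4).
have [|h2 _] := I_ge (fun y => 'i%C * V y) _
    (cont_onM (@cont_on_cst _ (-1) 1 'i%C) (cont_onB F3 F4)).
  by move=> x; rewrite VE; apply: eqC; rewrite ?ReM ?ImM/=; ring.
move=> E; move: h2; rewrite E ImM/= mul0r add0r mul1r => h2.
move: h h2 => /=; lra.
Qed.

Lemma nrm_kappa_ge : 4 <= nrm kappa.
Proof.
by rewrite (le_trans kappa_im_ge)// (le_trans _ (Im_le_nrm _))// ler_norm.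
Qed.

Lemma kappa_neq0 : kappa != 0.
Proof. by rewrite -nrm_gt0 (lt_le_trans _ nrm_kappa_ge). Qed.

(** The contour shrinks to a small square around [T], where [g] is split as [g T] plus an increment.
    The constant yields [kappa]; the increment is at most [e / 16] and the kernel at most [s^-1], so
    that the contour bound, 4 times the semiperimeter [4 * s], returns at most [e]. *)
Lemma cauchy_rect g (t1 t2 : R) a b c d :
  a < t1 -> t1 < b -> c < t2 -> t2 < d ->
  on_rect (fun z => differentiable g z) a b c d ->
  rectint (fun z => g z * (z - (t1 +i* t2))^-1) a b c d = kappa * g (t1 +i* t2).
Proof.
move=> at1 t1b ct2 t2d dg; set T := t1 +i* t2.
have dgT : differentiable g T by apply: dg; lra.
apply/eqP; rewrite -subr_eq0 -nrm_eq0 eq_le nrm_ge0 andbT.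
apply/ler_addgt0Pl => e e0; rewrite addr0.
have e16 : 0 < e / 16 by rewrite divr_gt0.
have /continuous_nrmP/(_ _ e16) := differentiable_continuous dgT.
move=> /nbhs_nrmP[r r0 rP].
have [s s0 [sr sa sb [sc sd]]] : exists2 s, 0 < s &
    [/\ 2 * s < r, a < t1 - s, t1 + s < b & c < t2 - s /\ t2 + s < d].
  exists (Num.min (Num.min (r / 4) ((t1 - a) / 2)) (Num.min ((b - t1) / 2)
     (Num.min ((t2 - c) / 2) ((d - t2) / 2)))).
    by rewrite !lt_min !divr_gt0 ?subr_gt0.
  have m1 x y : Num.min x y <= x by rewrite ge_min lexx.
  have m2 x y : Num.min x y <= y by rewrite ge_min lexx orbT.
  set s := Num.min _ _.
  have s1 : s <= r / 4 by rewrite (le_trans (m1 _ _)).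
  have s2 : s <= (t1 - a) / 2 by rewrite (le_trans (m1 _ _)).
  have s3 : s <= (b - t1) / 2 by rewrite (le_trans (m2 _ _)).
  have s4 : s <= (t2 - c) / 2 by rewrite (le_trans (m2 _ _))// (le_trans (m2 _ _)).
  have s5 : s <= (d - t2) / 2 by rewrite (le_trans (m2 _ _))// (le_trans (m2 _ _)).
  by repeat split; lra.
pose P z := g T * (z - T)^-1; pose Q z := (g z - g T) * (z - T)^-1.
have dP z : z != T -> differentiable P z.
  move=> zT; apply: (@differentiableM _ _ (fun=> g T) (fun z => (z - T)^-1)).
    exact: differentiable_cst.
  exact: differentiable_subV.
have dQ z : z != T -> differentiable g z -> differentiable Q z.
  move=> zT dgz; apply: (@differentiableM _ _ (fun z => g z - g T) (fun z => (z - T)^-1)).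
    by apply: (@differentiableB _ _ _ g (fun=> g T) z dgz); exact: differentiable_cst.
  exact: differentiable_subV.
have sides (G : R[i] -> R[i]) :
    (forall z, z != T -> differentiable g z -> {for z, continuous G}) ->
    cont_sides G (t1 - s) (t1 + s) (t2 - s) (t2 + s).
  move=> GP; split=> t tP; apply: GP; try (by apply: dg; lra);
  rewrite eq_complex/= negb_and; apply/orP; first [by left; lra|by right; lra].
have csP : cont_sides P (t1 - s) (t1 + s) (t2 - s) (t2 + s).
  by apply: sides => z zT _; apply: differentiable_continuous; exact: dP.
have csQ : cont_sides Q (t1 - s) (t1 + s) (t2 - s) (t2 + s).
  by apply: sides => z zT zg; apply: differentiable_continuous; exact: dQ.
have csV : cont_sides (fun z => (z - T)^-1) (t1 - s) (t1 + s) (t2 - s) (t2 + s).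
  by apply: sides => z zT _; apply: differentiable_continuous; exact: differentiable_subV.
have dgV : on_rect (fun z => z != T -> differentiable (fun z => g z * (z - T)^-1) z) a b c d.
  move=> x y xab ycd zT.
  apply: (@differentiableM _ _ g (fun z => (z - T)^-1)); first exact: dg.
  exact: differentiable_subV.
have -> : rectint (fun z => g z * (z - T)^-1) a b c d =
    rectint (fun z => g z * (z - T)^-1) (t1 - s) (t1 + s) (t2 - s) (t2 + s).
  by apply: (rectint_frame _ _ _ _ _ _ _ _ dgV); lra.
have s1 : t1 - s <= t1 + s by lra.
have s2 : t2 - s <= t2 + s by lra.
have -> : rectint (fun z => g z * (z - T)^-1) (t1 - s) (t1 + s) (t2 - s) (t2 + s) =
    rectint (fun z => P z + Q z) (t1 - s) (t1 + s) (t2 - s) (t2 + s).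
  by apply: (eq_rectint s1 s2) => x y _ _; rewrite /P /Q -mulrDl [g T + _]addrC subrK.
rewrite (rectintD csP csQ) (rectintZ _ csV).
have -> : rectint (fun z => (z - T)^-1) (t1 - s) (t1 + s) (t2 - s) (t2 + s) = kappa.
  move: csV; rewrite (addrC t1 (- s)) (addrC t1 s) (addrC t2 (- s)) (addrC t2 s) => csV.
  have ss : - s <= s by lra.
  rewrite (rectint_shift ss ss csV) -(rectint_inv_square s0).
  by apply: (eq_rectint ss ss) => x y _ _; rewrite addrK.
rewrite mulrC addrAC subrr add0r.
have Qb x y : (x = t1 - s \/ x = t1 + s) \/ (y = t2 - s \/ y = t2 + s) ->
    t1 - s <= x <= t1 + s -> t2 - s <= y <= t2 + s ->
    nrm (Q (x +i* y)) <= e / 16 / s.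
  move=> side xP yP; rewrite /Q nrmM nrmV.
  have ge_s : s <= nrm ((x +i* y) - T).
    case: side => side; [rewrite (le_trans _ (Re_le_nrm _))//|
      rewrite (le_trans _ (Im_le_nrm _))//] => /=; rewrite ler_normr;
    by apply/orP; case: side => ->; first [by left; lra|by right; lra].
  have lt_r : nrm ((x +i* y) - T) < r.
    rewrite (le_lt_trans (nrm_le_ReIm _))//= (@le_lt_trans _ _ (s + s))//; last by lra.
    by rewrite lerD// ler_norml; lra.
  rewrite ler_pM ?invr_ge0 ?nrm_ge0//; first exact/ltW/rP.
  by rewrite lef_pV2// posrE (lt_le_trans s0).
apply: (le_trans (nrm_rectint_le s1 s2 csQ (M := e / 16 / s) _ _)).
- by move=> x xP; split; apply: Qb => //; try lra; by [right; left|right; right].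
- by move=> y yP; split; apply: Qb => //; try lra; by [left; left|left; right].
- by rewrite le_eqVlt; apply/orP; left; apply/eqP; field; rewrite gt_eqF.
Qed.

End CauchyFormula.

Section Taylor.
Context (R : realType).
Implicit Types (a b c d x y r s M : R) (F G g : R[i] -> R[i]) (T z u : R[i]).

(** The norm of [R^2] whose balls are squares, comparable with [nrm] within a factor 2; the
    one-variable estimates are stated for it because contours are rectangles. *)
Definition supn z : R := Num.max `|complex.Re z| `|complex.Im z|.

Lemma supn_le z s : (supn z <= s) = (`|complex.Re z| <= s) && (`|complex.Im z| <= s).
Proof. by rewrite /supn ge_max. Qed.

Lemma supn_ge0 z : 0 <= supn z.
Proof. by rewrite /supn le_max normr_ge0. Qed.

Lemma supn_le_nrm z : supn z <= nrm z.
Proof. by rewrite supn_le Re_le_nrm Im_le_nrm. Qed.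

Lemma nrm_le_supn z : nrm z <= 2 * supn z.
Proof.
rewrite (le_trans (nrm_le_ReIm z))//.
have : `|complex.Re z| <= supn z /\ `|complex.Im z| <= supn z.
  by apply/andP; rewrite -supn_le.
lra.
Qed.

Lemma supnD z u : supn (z + u) <= supn z + supn u.
Proof.
rewrite supn_le ReD ImD !(le_trans (ler_normD _ _))// lerD//;
by rewrite /supn le_max lexx ?orbT.
Qed.

Lemma supnN z : supn (- z) = supn z.
Proof. by rewrite /supn ReN ImN !normrN. Qed.

Lemma supn0 : supn 0 = 0. Proof. by rewrite /supn/= normr0 maxxx. Qed.

Lemma lerB_supn z u : supn z - supn u <= supn (z - u).
Proof. by rewrite lerBlDr (le_trans _ (supnD _ _))// subrK. Qed.

Lemma on_square (P : R[i] -> Prop) r : on_rect P (- r) r (- r) r <->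
  forall z, supn z <= r -> P z.
Proof.
split=> [h [x y]|h x y xP yP].
  by rewrite supn_le/= !ler_norml => /andP[]; exact: h.
by apply: h; rewrite supn_le/= !ler_norml xP yP.
Qed.

Definition on_sides (P : R[i] -> Prop) a b c d :=
  (forall x, a <= x <= b -> P (x +i* c) /\ P (x +i* d)) /\
  (forall y, c <= y <= d -> P (a +i* y) /\ P (b +i* y)).

Lemma on_square_sides (P : R[i] -> Prop) r : 0 <= r ->
  (forall z, supn z = r -> P z) -> on_sides P (- r) r (- r) r.
Proof.
move=> r0 h; have mr (x : R) : - r <= x <= r -> `|x| <= r by rewrite ler_norml.
split=> t /mr tr; split; apply: h; rewrite /supn/= ?normrN (ger0_norm r0);
first [exact/max_idPr|exact/max_idPl].
Qed.

Lemma cont_sidesP F a b c d :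
  on_sides (fun z => {for z, continuous F}) a b c d -> cont_sides F a b c d.
Proof. by move=> [h v]; split=> t tP; first [by have [] := h t tP|by have [] := v t tP]. Qed.

Lemma eq_rectint_sides F G a b c d :
  on_sides (fun z => F z = G z) a b c d -> rectint F a b c d = rectint G a b c d.
Proof.
move=> [h v]; rewrite /rectint; congr (_ + _ * _); apply: eq_cint => t tab.
  by have [-> ->] := h t tab.
by have [-> ->] := v t tab.
Qed.

Lemma nrm_rectint_square F r M : 0 <= r ->
  (forall z, supn z = r -> {for z, continuous F}) ->
  (forall z, supn z = r -> nrm (F z) <= M) ->
  nrm (rectint F (- r) r (- r) r) <= 16 * M * r.
Proof.
move=> r0 cF FM; have rr : - r <= r by lra.
have cs : cont_sides F (- r) r (- r) r by apply: cont_sidesP; exact: on_square_sides.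
have [h v] := on_square_sides r0 FM.
by rewrite (le_trans (nrm_rectint_le rr rr cs h v))//; lra.
Qed.

Definition taylor_coef g r j : R[i] :=
  (kappa R)^-1 * rectint (fun z => g z * z^-1 ^+ j.+1) (- r) r (- r) r.

Lemma supn_neq0 z r : 0 < r -> supn z = r -> z != 0.
Proof.
by move=> r0 zr; apply: contraPneq zr => ->; rewrite supn0 => E; move: r0; rewrite -E ltxx.
Qed.

Lemma nrm_mulkV (A : R[i]) (B : R) : nrm A <= 4 * B -> nrm ((kappa R)^-1 * A) <= B.
Proof.
move=> AB; rewrite nrmM nrmV mulrC ler_pdivrMr ?nrm_gt0 ?kappa_neq0//.
rewrite (le_trans AB)// mulrC ler_wpM2l ?nrm_kappa_ge//.
by have := nrm_ge0 A; lra.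
Qed.

Lemma taylor_coef_radius g r s j : 0 < r -> r <= s ->
  (forall z, supn z <= s -> differentiable g z) ->
  taylor_coef g s j = taylor_coef g r j.
Proof.
move=> r0; rewrite le_eqVlt => /predU1P[-> _|rs dg]; first reflexivity.
pose F z := g z * z^-1 ^+ j.+1.
have dF : on_rect (fun z => z != 0 +i* 0 -> differentiable F z) (- s) s (- s) s.
  by apply/on_square => z zs z0; apply: differentiable_divX => //; exact: dg.
have E : rectint F (- s) s (- s) s = rectint F (- r) r (- r) r.
  by apply: (rectint_frame _ _ _ _ _ _ _ _ dF); lra.
by rewrite /taylor_coef -/F E.
Qed.

Lemma ler_XnV (x r : R) m : 0 < r -> r <= x -> (x ^+ m)^-1 <= (r ^+ m)^-1.
Proof.
move=> r0 rx; have x0 := lt_le_trans r0 rx.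
rewrite lef_pV2 ?posrE; [|exact: exprn_gt0..].
by rewrite lerXn2r// nnegrE ltW.
Qed.

(** The Cauchy integral is moved to the square of half-side [r], where the bound [M] is known and
    [nrm z] is at least [r] on the boundary. *)
Lemma nrm_taylor_coef g r s j M : 0 < r -> r <= s ->
  (forall z, supn z <= s -> differentiable g z) ->
  (forall z, supn z <= r -> nrm (g z) <= M) ->
  nrm (taylor_coef g s j) <= 4 * M / r ^+ j.
Proof.
move=> r0 rs dg gM; rewrite (taylor_coef_radius j r0 rs dg).
apply: nrm_mulkV; rewrite (le_trans (nrm_rectint_square (M := M / r ^+ j.+1) (ltW r0) _ _))//.
- move=> z zr; apply: differentiable_continuous; apply: differentiable_divX.
    by apply: dg; rewrite zr.
  exact: supn_neq0 zr.
- move=> z zr; rewrite nrmM nrmX nrmV exprVn ler_pM ?invr_ge0 ?nrm_ge0 ?exprn_ge0 ?nrm_ge0//.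
    by apply: gM; rewrite zr.
  have zr' : r <= nrm z by rewrite -zr supn_le_nrm.
  exact: ler_XnV.
- by rewrite exprS le_eqVlt; apply/orP; left; apply/eqP; field; rewrite expf_neq0 gt_eqF.
Qed.

(** The identity [(u - z)^-1 = u^-1 + z * u^-1 * (u - z)^-1] splits one Taylor term off [I j] and
    leaves [z * I j.+1]. After [k] steps the remainder is [z ^+ k * I k] over [kappa]. Since
    [supn z <= r / 2], the kernel is at most [2 / r] on the contour, and [16 * 2 / 4] is the
    constant 8. *)
Lemma taylor_remainder g r M z k : 0 < r ->
  (forall z, supn z <= r -> differentiable g z) ->
  (forall z, supn z <= r -> nrm (g z) <= M) ->
  supn z <= r / 2 ->
  nrm (g z - \sum_(j < k) taylor_coef g r j * z ^+ j) <= 8 * M * (nrm z / r) ^+ k.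
Proof.
move=> r0 dg gM zr.
pose I j := rectint (fun u => g u * u^-1 ^+ j * (u - z)^-1) (- r) r (- r) r.
have side_z u : supn u = r -> u != z.
  by move=> ur; apply: contraPneq ur => -> E; move: zr; rewrite E; lra.
have dI j u : supn u = r -> differentiable (fun u => g u * u^-1 ^+ j * (u - z)^-1) u.
  move=> ur; apply: (@differentiableM _ _ (fun u => g u * u^-1 ^+ j) (fun u => (u - z)^-1)).
    by apply: differentiable_divX; [apply: dg; rewrite ur|exact: supn_neq0 ur].
  by apply: differentiable_subV; exact: side_z.
have I0 : I 0%N = kappa R * g z.
  have zE : (complex.Re z) +i* (complex.Im z) = z by case: (z).
  have := zr; rewrite supn_le !ler_norml => /andP[/andP[h1 h2] /andP[h3 h4]].
  rewrite -{1}zE -(@cauchy_rect _ g _ _ (- r) r (- r) r); [|lra..|exact/on_square].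
  apply: eq_rectint_sides; apply: on_square_sides; first exact: ltW.
  by move=> u ur; rewrite expr0 mulr1 zE.
have IS j : I j = kappa R * taylor_coef g r j + z * I j.+1.
  rewrite /taylor_coef mulVKf ?kappa_neq0//.
  have csA : cont_sides (fun u => g u * u^-1 ^+ j.+1) (- r) r (- r) r.
    apply: cont_sidesP; apply: on_square_sides; first exact: ltW.
    move=> u ur; apply: differentiable_continuous; apply: differentiable_divX.
      by apply: dg; rewrite ur.
    exact: supn_neq0 ur.
  have csB : cont_sides (fun u => g u * u^-1 ^+ j.+1 * (u - z)^-1) (- r) r (- r) r.
    apply: cont_sidesP; apply: on_square_sides; first exact: ltW.
    by move=> u ur; apply: differentiable_continuous; exact: dI.
  have csC : cont_sides (fun u => z * (g u * u^-1 ^+ j.+1 * (u - z)^-1)) (- r) r (- r) r.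
    apply: cont_sidesP; apply: on_square_sides; first exact: ltW.
    move=> u ur; apply: differentiable_continuous.
    apply: (@differentiableM _ _ (fun=> z) (fun u => g u * u^-1 ^+ j.+1 * (u - z)^-1)).
      exact: differentiable_cst.
    exact: dI.
  rewrite -(rectintZ z csB) -(rectintD csA csC).
  apply: eq_rectint_sides; apply: on_square_sides; first exact: ltW.
  move=> u ur; have u0 := supn_neq0 r0 ur.
  have uz : u - z != 0 by rewrite subr_eq0 side_z.
  by rewrite exprS; move: (u^-1 ^+ j) => v; field; rewrite uz u0.
have sumI j : kappa R * g z =
    \sum_(i < j) kappa R * (taylor_coef g r i * z ^+ i) + z ^+ j * I j.
  elim: j => [|j IH]; first by rewrite big_ord0 add0r expr0 mul1r I0.
  rewrite IH big_ord_recr/= IS exprS; ring.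
have -> : g z - \sum_(j < k) taylor_coef g r j * z ^+ j = (kappa R)^-1 * (z ^+ k * I k).
  apply: (mulfI (kappa_neq0 R)).
  by rewrite mulrBr mulVKf ?kappa_neq0// mulr_sumr (sumI k) addrC addrA addNr add0r.
apply: nrm_mulkV; rewrite nrmM nrmX.
have : nrm (I k) <= 16 * (M / r ^+ k * (r / 2)^-1) * r.
  apply: nrm_rectint_square; first exact: ltW.
    by move=> u ur; apply: differentiable_continuous; exact: dI.
  move=> u ur; rewrite !nrmM nrmX !nrmV exprVn.
  have ur' : r <= nrm u by rewrite -ur supn_le_nrm.
  rewrite ler_pM ?mulr_ge0 ?invr_ge0 ?nrm_ge0 ?exprn_ge0 ?nrm_ge0//.
    rewrite ler_pM ?invr_ge0 ?nrm_ge0 ?exprn_ge0 ?nrm_ge0//; first by apply: gM; rewrite ur.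
    exact: ler_XnV.
  have uz2 : r / 2 <= nrm (u - z).
    by have := lerB_supn u z; have := supn_le_nrm (u - z); rewrite ur; move: zr; lra.
  by have := @ler_XnV _ _ 1 _ uz2; rewrite !expr1; apply; rewrite divr_gt0.
move=> Ik; rewrite (le_trans (ler_wpM2l _ Ik)) ?exprn_ge0 ?nrm_ge0//.
rewrite expr_div_n le_eqVlt; apply/orP; left; apply/eqP; field.
by rewrite expf_neq0 gt_eqF.
Qed.

End Taylor.

(** * Products with a polynomial-like factor *)

Section OneVariable.
Context (R : realType).
Implicit Types (f g : R[i] -> R[i]) (T z u : R[i]).

(** For each [x] in turn the interval is cut down to its last or first third, on the side of the
    midpoint away from [x]; that third has distance at least [(b - a) / 6] from [x]. *)
Lemma far_from_seq (l : seq R) (a b : R) : a < b ->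
  exists2 s, a <= s <= b & forall x, x \in l -> (b - a) / 6 ^+ size l <= `|s - x|.
Proof.
elim: l a b => [|x l IH] a b ab; first by exists a => //; rewrite lexx ltW.
have sixth : exists a' b', [/\ a <= a', b' <= b, b' - a' = (b - a) / 3 &
    forall s, a' <= s <= b' -> (b - a) / 6 <= `|s - x|].
  have [xm|xm] := lerP x ((a + b) / 2).
    exists (b - (b - a) / 3), b; split; try lra.
    by move=> s sP; rewrite ler_normr; apply/orP; left; lra.
  exists a, (a + (b - a) / 3); split; try lra.
  by move=> s sP; rewrite ler_normr; apply/orP; right; lra.
have [a' [b' [aa' bb' ba' far]]] := sixth.
have [|s sP sl] := IH a' b'; first by lra.
exists s => [|y]; first by lra.
have six1 (u : R) k : 0 <= u -> u / 6 ^+ k <= u.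
  by move=> u0; rewrite ler_pdivrMr ?exprn_gt0// ler_peMr// exprn_ege1// ler1n.
rewrite inE => /orP[/eqP->|/sl].
  apply: le_trans (far _ sP); rewrite /= exprS invfM mulrA six1//; lra.
apply: le_trans; rewrite ba' /= exprS invfM mulrA ler_wpM2r ?invr_ge0 ?exprn_ge0//.
lra.
Qed.

(** One factor per root: [2^-1 / 6 ^+ m] is the gap, relative to [r], that [far_from_seq] leaves on
    [[r / 2, r]] when there are at most [m] roots, and the last 6 accounts for
    [nrm (T0 - a) <= 6 * r] when [supn a <= 2 * r]. *)
Definition poly_const (m : nat) : R := (2^-1 / 6 ^+ m / 6) ^+ m.

Lemma poly_const_gt0 m : 0 < poly_const m.
Proof. by rewrite exprn_gt0// !divr_gt0// exprn_gt0. Qed.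

Lemma poly_const_le1 m : poly_const m <= 1.
Proof.
rewrite exprn_ile1// ?divr_ge0 ?invr_ge0 ?exprn_ge0//.
rewrite !ler_pdivrMr ?exprn_gt0// mul1r.
have : 1 <= 6 ^+ m :> R by rewrite exprn_ege1// ler1n.
lra.
Qed.

(* All roots are kept away from the boundary of a well-chosen square. *)
Lemma poly_lower_bound m (p : {poly R[i]}) (r : R) T0 : (size p <= m.+1)%N ->
  0 < r -> supn T0 <= r ->
  exists2 s, r / 2 <= s <= r & forall T, supn T = s ->
    poly_const m * nrm p.[T0] <= nrm p.[T].
Proof.
move=> pm r0 T0r.
have [->|p0] := eqVneq p 0.
  by exists r => [|T _]; [lra|rewrite !horner0 nrm0 mulr0].
have [rs pE] := closed_field_poly_normal p.
have rsm : (size rs <= m)%N.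
  by move: pm; rewrite pE size_scale ?lead_coef_eq0// size_prod_XsubC ltnS.
have [|s sP far] := @far_from_seq [seq supn a | a <- rs] (r / 2) r; first by lra.
exists s => // T Ts.
pose th : R := 2^-1 / 6 ^+ m / 6.
have pow6 k : 1 <= 6 ^+ k :> R by rewrite exprn_ege1// ler1n.
have th0 : 0 < th by rewrite !divr_gt0// exprn_gt0.
have th1 : th <= 1.
  by rewrite !ler_pdivrMr ?exprn_gt0// mul1r; have := pow6 m; lra.
have root a : a \in rs -> th * nrm (T0 - a) <= nrm (T - a).
  move=> ars; have /far fa : supn a \in [seq supn a | a <- rs] by exact: map_f.
  have farm : th * 6 * r <= `|s - supn a|.
    apply: le_trans fa; rewrite size_map (_ : r - r / 2 = r * 2^-1); last by field.
    rewrite [th * _](_ : _ = 2^-1 / 6 ^+ m); last by rewrite /th; field; rewrite expf_neq0.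
    rewrite mulrC mulrA ler_wpM2l ?mulr_ge0 ?invr_ge0 ?(ltW r0)//.
    rewrite lef_pV2 ?posrE ?exprn_gt0//; apply: ler_weXn2l => //.
    by rewrite ler1n.
  have up : nrm (T0 - a) <= 2 * (r + supn a).
    rewrite (le_trans (nrm_le_supn _))// ler_wpM2l// (le_trans (supnD _ _))// supnN.
    by rewrite lerD.
  have low : `|s - supn a| <= nrm (T - a).
    apply: le_trans (supn_le_nrm _); rewrite ler_norml -Ts lerB_supn andbT.
    by rewrite lerNl opprB (le_trans (lerB_supn _ _))// -supnN opprB.
  have a0 := supn_ge0 a.
  (* Roots with [supn a <= 2 * r] are handled by the gap; a more distant root is seen from [T] and
     from [T0] at comparable distances. *)
  have [a2r|ra2] := lerP (supn a) (2 * r).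
    apply: le_trans low; apply: le_trans farm; rewrite -mulrA ler_wpM2l ?(ltW th0)//; lra.
  apply: le_trans low; rewrite ler_normr; apply/orP; right.
  apply: (@le_trans _ _ (1 / 6 * nrm (T0 - a))); last by move: up; lra.
  rewrite ler_wpM2r ?nrm_ge0// /th ler_wpM2r ?invr_ge0//.
  by rewrite ler_pdivrMr ?exprn_gt0//; have := pow6 m; lra.
have prodE z : p.[z] = lead_coef p * \prod_(a <- rs) (z - a).
  rewrite {1}pE hornerZ horner_prod; congr (_ * _).
  by apply: eq_bigr => a _; rewrite hornerXsubC.
have key (l : seq R[i]) : {subset l <= rs} ->
    th ^+ size l * nrm (\prod_(a <- l) (T0 - a)) <= nrm (\prod_(a <- l) (T - a)).
  elim: l => [|a l IH] lrs; first by rewrite !big_nil expr0 mul1r.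
  rewrite !big_cons !nrmM exprS mulrACA ler_pM ?mulr_ge0 ?exprn_ge0 ?nrm_ge0 ?(ltW th0)//.
    by apply: root; apply: lrs; rewrite mem_head.
  by apply: IH => b bl; apply: lrs; rewrite inE bl orbT.
rewrite !prodE !nrmM mulrCA ler_wpM2l ?nrm_ge0//.
apply: le_trans (key rs _) => //; rewrite ler_wpM2r ?nrm_ge0//.
by apply: ler_wiXn2l => //; exact: ltW.
Qed.

(** A maximum principle read off Cauchy's formula: were [f] below [nrm (f 0) / 5] on the sides, the
    contour integral would be at most [16 / 5 * nrm (f 0)], less than [nrm (kappa R * f 0)]. *)
Lemma sides_lower_bound f (s : R) : 0 < s ->
  (forall z, supn z <= s -> differentiable f z) ->
  exists2 T, supn T = s & nrm (f 0) / 5 <= nrm (f T).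
Proof.
move=> s0 df; apply: contrapT => no.
have lt5 T : supn T = s -> nrm (f T) < nrm (f 0) / 5.
  by move=> Ts; rewrite ltNge; apply/negP => h; apply: no; exists T.
have supn_s : supn s%:C = s by rewrite /supn/= normr0 (ger0_norm (ltW s0)); apply/max_idPl/ltW.
have f0 : 0 < nrm (f 0) by have := lt5 _ supn_s; have := nrm_ge0 (f s%:C); lra.
have on : on_rect (fun z => differentiable f z) (- s) s (- s) s by exact/on_square.
have := @cauchy_rect _ f 0 0 (- s) s (- s) s.
move=> /(_ _ _ _ _ on) => C.
have {}C : rectint (fun z => f z * z^-1) (- s) s (- s) s = kappa R * f 0.
  have <- : rectint (fun z => f z * (z - (0 +i* 0))^-1) (- s) s (- s) s = kappa R * f 0.
    by apply: C; lra.
  apply: eq_rectint_sides; apply: on_square_sides; first exact: ltW.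
  by move=> z _; rewrite [0 +i* 0](_ : _ = 0)// subr0.
have : nrm (rectint (fun z => f z * z^-1) (- s) s (- s) s) <= 16 * (nrm (f 0) / 5 * s^-1) * s.
  apply: nrm_rectint_square; first exact: ltW.
    move=> z zs; apply: differentiable_continuous.
    apply: (@differentiableM _ _ f (fun z => z^-1)); first by apply: df; rewrite zs.
    by apply: (@differentiableV _ _ (fun u => u)) => //; exact: supn_neq0 zs.
  move=> z zs; rewrite nrmM nrmV ler_pM ?invr_ge0 ?nrm_ge0//; first exact/ltW/lt5.
  by have := @ler_XnV _ (nrm z) s 1 s0; rewrite !expr1; apply; rewrite -zs supn_le_nrm.
rewrite C nrmM -mulrA divfK ?gt_eqF//.
have := nrm_kappa_ge R; nra.
Qed.

(** The Taylor polynomial of degree [m] of [g] stays away from zero on all sides of some square,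
    whatever [f] is; [f] then selects the point on these sides. The growth hypothesis makes the
    remainder small compared with [M] once [Th] is large. *)
Lemma product_lower_bound (m : nat) (K : R) : 0 <= K -> exists Th c : R,
  [/\ 2 <= Th, 0 < c & forall (r M : R) g f T0, 0 < r ->
    (forall z, supn z <= Th * r -> differentiable g z) ->
    (forall z, supn z <= r -> differentiable f z) ->
    supn T0 <= r -> M <= 2 * nrm (g T0) ->
    (forall z, supn z <= Th * r -> nrm (g z) <= K * Th ^+ m * M) ->
    exists2 T, supn T <= r & c * M * nrm (f 0) <= nrm (g T * f T)].
Proof.
move=> K0; pose cm := poly_const m; have cm0 : 0 < cm := poly_const_gt0 m.
have cm1 : cm <= 1 := poly_const_le1 m.
pose A := 8 * K * 2 ^+ m.+1.
have A0 : 0 <= A by rewrite !mulr_ge0// exprn_ge0.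
(* On [supn T <= r] the remainder is at most [8 * (K * Th ^+ m * M) * (2 / Th) ^+ m.+1 = A / Th *
   M]; this [Th] makes it at most [cm / 8 * M]. *)
pose Th := 2 + 8 * A / cm.
have Th2 : 2 <= Th by rewrite lerDl divr_ge0 ?mulr_ge0 ?(ltW cm0).
have Th0 : 0 < Th by lra.
exists Th, (cm / 40); split => //; first by rewrite divr_gt0.
move=> r M g f T0 r0 dg df T0r MT0 gM.
have [M0|M0] := lerP M 0.
  exists 0; first by rewrite supn0 ltW.
  rewrite (@le_trans _ _ 0) ?nrm_ge0// mulr_le0_ge0 ?nrm_ge0//.
  by rewrite mulr_ge0_le0 ?divr_ge0 ?(ltW cm0).
pose p := \poly_(j < m.+1) taylor_coef g (Th * r) j.
have Thr : 0 < Th * r by rewrite mulr_gt0.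
have gp T : supn T <= r -> nrm (g T - p.[T]) <= cm / 8 * M.
  move=> Tr; rewrite horner_poly.
  have Thr2 : supn T <= Th * r / 2 by rewrite (le_trans Tr)//; nra.
  rewrite (le_trans (taylor_remainder m.+1 Thr dg gM Thr2))//.
  have T2 : nrm T / (Th * r) <= 2 / Th.
    rewrite ler_pdivrMr// (le_trans (nrm_le_supn T))// mulrA divfK ?gt_eqF//.
    by rewrite ler_wpM2l.
  have T2X : (nrm T / (Th * r)) ^+ m.+1 <= (2 / Th) ^+ m.+1.
    by apply: lerXn2r => //; rewrite nnegrE divr_ge0 ?nrm_ge0 ?(ltW Thr) ?(ltW Th0).
  apply: (@le_trans _ _ (8 * (K * Th ^+ m * M) * (2 / Th) ^+ m.+1)).
    by rewrite ler_wpM2l// !mulr_ge0 ?exprn_ge0 ?(ltW M0) ?(ltW Th0).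
  rewrite (_ : 8 * _ * _ = A / Th * M); last first.
    by rewrite expr_div_n /A !exprS; field; rewrite ?expf_neq0 gt_eqF.
  rewrite ler_wpM2r ?(ltW M0)// ler_pdivrMr// /Th.
  rewrite mulrDr (_ : cm / 8 * (8 * A / cm) = A); last by field; rewrite gt_eqF.
  by rewrite lerDr mulr_ge0// divr_ge0 ?(ltW cm0).
have [|s sP low] := @poly_lower_bound m p r T0 _ r0 T0r; first exact: size_poly.
have s0 : 0 < s by lra.
have [|T Ts fT] := @sides_lower_bound f s s0.
  by move=> z zs; apply: df; lra.
exists T; first by rewrite Ts; lra.
have cmM : cm * M <= M by rewrite ler_piMl// ltW.
(* [M / 2 - cm / 8 * M] exceeds [M / 4]. Hence [p] is at least [cm * M / 4] on the sides and [g] at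
   least [cm * M / 8]; the factor [1 / 5] for [f] then makes [cm / 40]. *)
have pT0 : M / 4 <= nrm p.[T0].
  have := gp _ T0r; have := lerB_nrm (g T0) (g T0 - p.[T0]).
  rewrite subKr; lra.
have gT : cm / 8 * M <= nrm (g T).
  have := gp T; rewrite Ts => /(_ (proj2 (andP sP))).
  have := lerB_nrm p.[T] (p.[T] - g T); rewrite subKr nrmBC.
  have := low _ Ts; rewrite -/cm; have := ler_wpM2l (ltW cm0) pT0; lra.
rewrite nrmM (_ : cm / 40 * M * nrm (f 0) = (cm / 8 * M) * (nrm (f 0) / 5)); last by field.
by rewrite ler_pM// ?divr_ge0 ?mulr_ge0 ?divr_ge0 ?nrm_ge0 ?(ltW cm0) ?(ltW M0).
Qed.

End OneVariable.

(** * Mean value inequalities on sheared polydiscs *)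

Section NonnegIntegral.
Context d (T : measurableType d) (R : realType) (mu : {measure set T -> \bar R}).
Local Open Scope ereal_scope.

(* The integral of a nonnegative function is the supremum of the integrals of the
   simple functions below it, measurable or not: this serves for the Kobayashi
   metric and for the Kobayashi ball. *)
Lemma ge0_le_integral_patch (D E : set T) (f g : T -> \bar R) :
  (forall x, D x -> 0 <= f x) -> (forall x, E x -> 0 <= g x) ->
  (forall x, D x -> E x /\ f x <= g x) ->
  \int[mu]_(x in D) f x <= \int[mu]_(x in E) g x.
Proof.
move=> f0 g0 fg; rewrite !ge0_integralE//.
apply: le_ereal_sup => _ [h hf <-]; exists h => // x.
apply: (le_trans (hf x)); rewrite /patch; case: ifPn => [|_].
  by rewrite inE => /fg[Ex fgx]; rewrite mem_set.
by case: ifPn => //; rewrite inE; exact: g0.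
Qed.

End NonnegIntegral.

Section AreaMeanValue.
Context (R : realType).
Notation mu := (@lebesgue_measure R).
Implicit Types (g : R[i] -> R[i]).
Local Open Scope ereal_scope.

(** Otherwise the constant [(I + e) / L] on an interval of length [L] would lie below [t] and
    integrate to [I + e]. The slack [e] makes the contradiction strict. *)
Lemma exists_le_mean (t : R -> \bar R) (u L I e : R) : (0 < L)%R -> (0 < e)%R ->
  (forall x, 0 <= t x) -> \int[mu]_x t x <= I%:E ->
  exists2 c, (u <= c <= u + L)%R & t c <= ((I + e) / L)%:E.
Proof.
move=> L0 e0 t0 tI; apply: contrapT => no.
have big c : (u <= c <= u + L)%R -> ((I + e) / L)%:E <= t c.
  by move=> cP; apply/ltW; rewrite ltNge; apply/negP => h; apply: no; exists c.
have I0 : (0 <= I)%R.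
  by rewrite -lee_fin (le_trans _ tI)// integral_ge0.
have : \int[mu]_(x in `[u, (u + L)%R]) (cst ((I + e) / L)%:E) x <= \int[mu]_x t x.
  apply: ge0_le_integral_patch => //.
    by move=> x _; rewrite lee_fin divr_ge0 ?(ltW L0)// addr_ge0// ltW.
  by move=> x; rewrite /= in_itv/= => xP; split => //; exact: big.
move=> /le_trans/(_ tI); rewrite integral_cst//= lebesgue_measure_itv/= lte_fin ltrDl L0.
rewrite -EFinB -EFinM lee_fin addrAC subrr add0r divfK ?gt_eqF//.
by rewrite gerDl leNgt e0.
Qed.

(** Four good sides are selected: in each of the four bands at distance between [s / 2] and [s] from
    the centre, some line carries at most the mean of the integral of [Phi]. Cauchy's formula on the
    resulting rectangle, whose kernel is at most [2 / s] on the sides, gives the value at the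
    centre. *)
Lemma area_mean_value g (p1 p2 s : R) (Phi : R * R -> \bar R) : (0 < s)%R ->
  on_rect (fun z => differentiable g z) (p1 - s) (p1 + s) (p2 - s) (p2 + s) ->
  measurable_fun [set: R * R] Phi -> (forall q, 0 <= Phi q) ->
  on_rect (fun z => (nrm (g z))%:E <= Phi (complex.Re z, complex.Im z))
    (p1 - s) (p1 + s) (p2 - s) (p2 + s) ->
  (nrm (g (p1 +i* p2)) * s ^+ 2)%:E <= 8%:E * \int[mu \x mu]_q Phi q.
Proof.
move=> s0 dg mPhi Phi0 gPhi; set p := (p1 +i* p2)%C.
have : 0 <= \int[mu \x mu]_q Phi q by apply: integral_ge0.
case IE : (\int[mu \x mu]_q Phi q) => [I| |]; last by [].
  2: by rewrite gt0_muley ?leey ?lte_fin.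
rewrite lee_fin => I0; rewrite -EFinM lee_fin.
pose t y := \int[mu]_x Phi (x, y); pose r x := \int[mu]_y Phi (x, y).
have tI : \int[mu]_y t y <= I%:E.
  by rewrite le_eqVlt (etrans (esym (@fubini_tonelli2 _ _ _ _ R mu mu Phi mPhi Phi0)) IE) eqxx.
have rI : \int[mu]_x r x <= I%:E.
  by rewrite le_eqVlt (etrans (esym (@fubini_tonelli1 _ _ _ _ R mu mu Phi mPhi Phi0)) IE) eqxx.
have t0 y : 0 <= t y by apply: integral_ge0.
have r0 x : 0 <= r x by apply: integral_ge0.
apply/ler_addgt0Pl => e e0; have e80 : (0 < e / 8)%R by rewrite divr_gt0.
have s20 : (0 < s / 2)%R by rewrite divr_gt0.
have [c cP tc] := exists_le_mean (p2 - s) s20 e80 t0 tI.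
have [d dP td] := exists_le_mean (p2 + s / 2) s20 e80 t0 tI.
have [a aP ra] := exists_le_mean (p1 - s) s20 e80 r0 rI.
have [b bP rb] := exists_le_mean (p1 + s / 2) s20 e80 r0 rI.
set B := ((I + e / 8) / (s / 2))%R in tc td ra rb.
pose F z := (g z * (z - p)^-1)%R.
have on : on_rect (fun z => differentiable g z) a b c d.
  by move=> x y xP yP; apply: dg; lra.
have := @cauchy_rect _ g p1 p2 a b c d; rewrite -/p => C.
have {C}FE : rectint F a b c d = (kappa R * g p)%R by apply: C => //; lra.
have far x y : ((x = a \/ x = b) \/ (y = c \/ y = d))%R -> (s / 2 <= nrm ((x +i* y)%C - p))%R.
  move=> side; case: side => side; [rewrite (le_trans _ (Re_le_nrm _))//|
      rewrite (le_trans _ (Im_le_nrm _))//] => /=; rewrite ler_normr;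
    by apply/orP; case: side => ->; first [by left; lra|by right; lra].
have cF x y : (a <= x <= b)%R -> (c <= y <= d)%R -> ((x = a \/ x = b) \/ (y = c \/ y = d))%R ->
    {for (x +i* y)%C, continuous F}.
  move=> xP yP side; apply: differentiable_continuous.
  apply: (@differentiableM _ _ g (fun z => (z - p)^-1)%R); first exact: on.
  apply: differentiable_subV; rewrite -subr_eq0 -nrm_gt0.
  exact: lt_le_trans (far _ _ side).
have FPhi x y : (a <= x <= b)%R -> (c <= y <= d)%R -> ((x = a \/ x = b) \/ (y = c \/ y = d))%R ->
    (nrm (F (x +i* y)%C))%:E <= (2 / s)%:E * Phi (x, y).
  move=> xP yP side; rewrite /F nrmM nrmV mulrC EFinM.
  apply: lee_pmul; rewrite ?lee_fin ?invr_ge0 ?nrm_ge0//.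
    rewrite (_ : 2 / s = (s / 2)^-1)%R; last by rewrite invf_div.
    by have := @ler_XnV _ _ _ 1 s20 (far _ _ side); rewrite !expr1.
  by apply: gPhi; lra.
have cs : cont_sides F a b c d.
  split=> u uP; apply: cF; try lra; first [by left; left|by left; right|by right; left|
    by right; right].
have [h1 h2] := cont_sides_h cs; have [v1 v2] := cont_sides_v cs.
have side_int (a' b' : R) (G : R -> R[i]) (Psi : R -> \bar R) : cont_on a' b' G ->
    measurable_fun setT Psi -> (forall x, 0 <= Psi x) ->
    (forall x, (a' <= x <= b')%R -> (nrm (G x))%:E <= (2 / s)%:E * Psi x) ->
    \int[mu]_x Psi x <= B%:E -> (nrm (cint a' b' G) <= 4 * B / s)%R.
  move=> cG mPsi Psi0 GPsi PsiB; rewrite -lee_fin.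
  rewrite (le_trans (nrm_cint_le_integral cG))//.
  apply: (@le_trans _ _ (2%:E * \int[mu]_x ((2 / s)%:E * Psi x))).
    rewrite lee_pmul2l//; apply: ge0_le_integral_patch => //.
    - by move=> x _; rewrite lee_fin nrm_ge0.
    - by move=> x _; rewrite mule_ge0// lee_fin divr_ge0// ltW.
    - by move=> x; rewrite /= in_itv/= => /GPsi.
  rewrite ge0_integralZl//; last by rewrite lee_fin divr_ge0// ltW.
  rewrite muleA -EFinM (@le_trans _ _ ((2 * (2 / s))%:E * B%:E))//.
    by rewrite lee_pmul2l// lte_fin mulr_gt0// divr_gt0.
  by rewrite -EFinM lee_fin le_eqVlt; apply/orP; left; apply/eqP; field; rewrite gt_eqF.
have mx y : measurable_fun setT (fun x => Phi (x, y)) by apply: measurableT_comp.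
have my x : measurable_fun setT (fun y => Phi (x, y)) by apply: measurableT_comp.
have B1 : (nrm (cint a b (fun x => F (x +i* c)%C)) <= 4 * B / s)%R.
  apply: (side_int _ _ _ _ h1 (mx c) _ _ tc) => x; first exact: Phi0.
  by move=> xP; apply: FPhi; [lra|lra|right; left].
have B2 : (nrm (cint a b (fun x => F (x +i* d)%C)) <= 4 * B / s)%R.
  apply: (side_int _ _ _ _ h2 (mx d) _ _ td) => x; first exact: Phi0.
  by move=> xP; apply: FPhi; [lra|lra|right; right].
have B3 : (nrm (cint c d (fun y => F (b +i* y)%C)) <= 4 * B / s)%R.
  apply: (side_int _ _ _ _ v1 (my b) _ _ rb) => x; first exact: Phi0.
  by move=> xP; apply: FPhi; [lra|lra|left; right].
have B4 : (nrm (cint c d (fun y => F (a +i* y)%C)) <= 4 * B / s)%R.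
  apply: (side_int _ _ _ _ v2 (my a) _ _ ra) => x; first exact: Phi0.
  by move=> xP; apply: FPhi; [lra|lra|left; left].
(* Four sides contribute [4 * B / s] each; dividing by [nrm kappa >= 4] and inserting [B] gives
   [8 * I + e]. *)
have total : (nrm (kappa R * g p) <= 16 * B / s)%R.
  rewrite -FE /rectint (cintB h1 h2) (cintB v1 v2) (le_trans (nrmD _ _))//.
  rewrite nrmM nrm_i mul1r.
  have N1 := nrmB (cint a b (fun x => F (x +i* c)%C)) (cint a b (fun x => F (x +i* d)%C)).
  have N2 := nrmB (cint c d (fun y => F (b +i* y)%C)) (cint c d (fun y => F (a +i* y)%C)).
  lra.
have gB : (nrm (g p) <= 4 * B / s)%R.
  move: total; rewrite nrmM; have := nrm_kappa_ge R; have := nrm_ge0 (g p).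
  move: (nrm (g p)) (nrm (kappa R)) (B / s)%R => u v w u0 v4.
  have : (4 * u <= v * u)%R by rewrite ler_wpM2r.
  rewrite -!mulrA; lra.
have : (nrm (g p) * s ^+ 2 <= 4 * B / s * s ^+ 2)%R by rewrite ler_wpM2r// sqr_ge0.
move=> /le_trans; apply; rewrite le_eqVlt; apply/orP; left; apply/eqP.
by rewrite /B; field; rewrite gt_eqF.
Qed.

End AreaMeanValue.

Section ProductSigmaFinite.
Context d1 d2 (T1 : measurableType d1) (T2 : measurableType d2) (R : realType).
Context (m1 : {sigma_finite_measure set T1 -> \bar R}).
Context (m2 : {sigma_finite_measure set T2 -> \bar R}).
Local Open Scope ereal_scope.

(* The canonical instance inferred for [m1 \x m2] assumes finite measures. *)
Lemma sigma_finite_product : sigma_finite setT (m1 \x m2).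
Proof.
have /sigma_finiteP[F [TF ndF Foo]] := sigma_finiteT m1.
have /sigma_finiteP[G [TG ndG Goo]] := sigma_finiteT m2.
exists (fun n => F n `*` G n).
  apply/esym; rewrite -subTset => -[x y] _.
  have [n _ Fn] : (\bigcup_n F n) x by rewrite -TF.
  have [k _ Gk] : (\bigcup_n G n) y by rewrite -TG.
  exists (maxn n k) => //; split.
    by move: x Fn; exact/subsetPset/ndF/leq_maxl.
  by move: y Gk; exact/subsetPset/ndG/leq_maxr.
move=> k; have [mF Fk] := Foo k; have [mG Gk] := Goo k.
split; first exact: measurableX.
by rewrite product_measure1E// lte_mul_pinfty// ge0_fin_numE.
Qed.

Definition sfprod : {sigma_finite_measure set (T1 * T2)%type -> \bar R} :=
  HB.pack (m1 \x m2) (Measure_isSigmaFinite.Build _ _ _ (m1 \x m2) sigma_finite_product).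

End ProductSigmaFinite.


(** * Lebesgue measure on [C^n]: sigma-finiteness and Tonelli *)

Section LebesgueCnTonelli.
Context (R : realType).
Notation mu := (@lebesgue_measure R).
Local Notation mR := (measurableTypeR R).
Local Open Scope ereal_scope.

Lemma open_measurable_Cn n (A : set 'rV[R[i]]_n) : open A -> measurable A.
Proof. exact: sub_sigma_algebra. Qed.

Lemma continuous_measurable_Cn n (f : 'rV[R[i]]_n -> R) :
  continuous f -> measurable_fun setT f.
Proof.
move=> /continuousP cf; apply: (measurability _ (RGenOpens.measurableE R)).
move=> _ [_ [a [b ->] <-]]; rewrite setTI; apply: open_measurable_Cn.
exact/cf/interval_open.
Qed.

Lemma continuous_coord n (j : 'I_n) (z : 'rV[R[i]]_n) :
  {for z, continuous (fun z : 'rV[R[i]]_n => z ord0 j)}.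
Proof. by apply: differentiable_continuous; exact: differentiable_coord. Qed.

Definition polysquare n (p : 'rV[R[i]]_n) (r : R) : set 'rV[R[i]]_n :=
  [set z | forall j, (supn (z ord0 j - p ord0 j) <= r)%R].

Lemma measurable_polysquare n (p : 'rV[R[i]]_n) r : measurable (polysquare p r).
Proof.
have -> : polysquare p r = \bigcap_(j in [set: 'I_n])
    ((fun z : 'rV[R[i]]_n => supn (z ord0 j - p ord0 j)%R) @^-1` [set x | (x <= r)%R]).
  by apply/seteqP; split => z zP j //; [move=> _; exact: zP|exact: (zP j)].
apply: fin_bigcap_measurable => // j _; rewrite -[X in measurable X]setTI.
apply: (continuous_measurable_Cn _) => //; last first.
  rewrite (_ : [set x | _] = `]-oo, r]%classic); first exact: measurable_itv.
  by apply/seteqP; split => x; rewrite /= in_itv.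
move=> z.
have cj : {for z, continuous (fun z : 'rV[R[i]]_n => (z ord0 j - p ord0 j)%R)}.
  apply: (@continuousB _ _ _ (fun z : 'rV[R[i]]_n => z ord0 j) (fun=> p ord0 j)).
    exact: continuous_coord.
  exact: cst_continuous.
apply: (@continuous_max _ _ (fun z : 'rV[R[i]]_n => `|complex.Re (z ord0 j - p ord0 j)|%R)%R
  (fun z : 'rV[R[i]]_n => `|complex.Im (z ord0 j - p ord0 j)|)%R).
  exact: (cvg_norm (continuous_Re cj)).
exact: (cvg_norm (continuous_Im cj)).
Qed.

Lemma ge0_integral_row_cons n (Psi : 'rV[R[i]]_n.+1 -> \bar R) :
  measurable_fun setT Psi -> (forall z, 0 <= Psi z) ->
  \int[lebesgue_Cn]_z Psi z =
  \int[lebesgue_Cn \x mu \x mu]_p Psi (row_cons p).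
Proof.
move=> mPsi Psi0.
pose T := ('rV[R[i]]_n * measurableTypeR R * measurableTypeR R)%type.
exact: (@ge0_integral_pushforward _ _ T 'rV[R[i]]_n.+1 R row_cons
  (@measurable_row_cons R n) (@lebesgue_Cn R n \x mu \x mu) setT Psi
  measurableT mPsi (fun z _ => Psi0 z)).
Qed.

Lemma lebesgue_Cn_row_cons n (A : set 'rV[R[i]]_n.+1) :
  @lebesgue_Cn R n.+1 A = (@lebesgue_Cn R n \x mu \x mu) (row_cons @^-1` A).
Proof. by []. Qed.

Lemma lebesgue_Cn_polysquare_lt n r : @lebesgue_Cn R n (polysquare 0 r) < +oo.
Proof.
elim: n => [|n IH]; first by rewrite /= diracE ltry.
rewrite lebesgue_Cn_row_cons.
have -> : row_cons @^-1` polysquare 0 r =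
    (@polysquare n 0%R r `*` `[(- r)%R, r]%classic) `*` `[(- r)%R, r]%classic.
  apply/seteqP; split => [[[v x] y] H|[[v x] y] [[/= Hv Hx] Hy] j].
    have := H ord0; rewrite row_cons0 mxE subr0 supn_le /= !ler_norml => /andP[h1 h2].
    split; last by rewrite /= in_itv.
    split; last by rewrite /= in_itv.
    by move=> j /=; have := H (lift ord0 j); rewrite row_consS !mxE.
  have [->|[l ->]] : j = ord0 \/ exists l, j = lift ord0 l.
    by case: (unliftP ord0 j) => [l ->|->]; [right; exists l|left].
  - move: Hx Hy; rewrite /= !in_itv/= => Hx Hy.
    by rewrite row_cons0 mxE subr0 supn_le/= !ler_norml Hx Hy.
  - by have := Hv l; rewrite row_consS !mxE.
have mI : measurable (`[(- r)%R, r]%classic : set (measurableTypeR R)) by exact: measurable_itv.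
pose T := ('rV[R[i]]_n * measurableTypeR R)%type.
have mP : measurable (@polysquare n 0%R r) by exact: measurable_polysquare.
have mPI : measurable (@polysquare n 0%R r `*` `[(- r)%R, r]%classic : set T).
  exact: measurableX.
have mIoo : mu `[(- r)%R, r] < +oo.
  by rewrite lebesgue_measure_itv/=; case: ifP => // _; rewrite -EFinB ltry.
refine (eq_ind_r (fun x => x < +oo) _ (@product_measure1E _ _ T (measurableTypeR R) R
  (@lebesgue_Cn R n \x mu) mu _ _ mPI mI)).
rewrite lte_mul_pinfty ?ge0_fin_numE ?measure_ge0//.
refine (eq_ind_r (fun x => x < +oo) _ (@product_measure1E _ _ 'rV[R[i]]_n (measurableTypeR R) R
  (@lebesgue_Cn R n) mu _ _ mP mI)).
by rewrite lte_mul_pinfty ?ge0_fin_numE ?measure_ge0.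
Qed.

Lemma sigma_finite_lebesgue_Cn n : sigma_finite setT (@lebesgue_Cn R n).
Proof.
exists (fun k => polysquare 0 k%:R); last first.
  by move=> k; split; [exact: measurable_polysquare|exact: lebesgue_Cn_polysquare_lt].
apply/esym; rewrite -subTset => z _.
exists (Num.truncn (\sum_(j < n) nrm (z ord0 j))%R).+1 => // j.
rewrite mxE subr0 (le_trans (supn_le_nrm _))// ltW//.
apply: le_lt_trans (truncnS_gt _); rewrite (bigD1 j)//= lerDl sumr_ge0// => k _.
exact: nrm_ge0.
Qed.

HB.instance Definition _ n := Measure_isSigmaFinite.Build _ _ _ (@lebesgue_Cn R n)
  (sigma_finite_lebesgue_Cn n).

Lemma measurable_row_consE n (Psi : 'rV[R[i]]_n.+1 -> \bar R) :
  measurable_fun setT Psi ->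
  measurable_fun [set: 'rV[R[i]]_n * (R * R)]
    (fun p => Psi (row_cons (p.1, p.2.1, p.2.2))).
Proof.
move=> mPsi.
apply: (@measurableT_comp _ _ _ _ _ _ Psi) => //.
apply: (@measurableT_comp _ _ _ _ _ _ (@row_cons R n)); first exact: measurable_row_cons.
apply: measurable_fun_pair; last exact: measurableT_comp.
by apply: measurable_fun_pair => //; exact: measurableT_comp.
Qed.

Lemma tonelli_row_cons1 n (Psi : 'rV[R[i]]_n.+1 -> \bar R) :
  measurable_fun setT Psi -> (forall z, 0 <= Psi z) ->
  \int[lebesgue_Cn]_z Psi z =
  \int[lebesgue_Cn]_v \int[mu \x mu]_q Psi (row_cons (v, q.1, q.2)).
Proof.
move=> mPsi Psi0; rewrite ge0_integral_row_cons//.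
have mP : measurable_fun setT (Psi \o @row_cons R n).
  by apply: measurableT_comp => //; exact: measurable_row_cons.
refine (etrans (@fubini_tonelli1 _ _ ('rV[R[i]]_n * mR)%type mR R (sfprod (@lebesgue_Cn R n) mu) mu
  (Psi \o @row_cons R n) mP (fun x => Psi0 _)) _).
refine (etrans (@fubini_tonelli1 _ _ 'rV[R[i]]_n mR R (@lebesgue_Cn R n) mu _ _ _) _).
- exact: (@measurable_fun_fubini_tonelli_F _ _ ('rV[R[i]]_n * mR)%type mR R mu _ mP (fun x => Psi0 _)).
- by move=> x; apply: integral_ge0 => ? _; exact: Psi0.
apply: eq_integral => v _; rewrite /fubini_F.
have mv : measurable_fun setT (fun q : mR * mR => Psi (row_cons (v, q.1, q.2))).
  exact: (measurableT_comp (measurable_row_consE mPsi) (pair1_measurable v)).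
exact: (esym (@fubini_tonelli1 _ _ mR mR R mu mu _ mv (fun q => Psi0 _))).
Qed.

(** The first coordinate is integrated last here; this order serves the induction of
    [mean_value_sheared], where the remaining coordinates carry the shear. *)
Lemma tonelli_row_cons2 n (Psi : 'rV[R[i]]_n.+1 -> \bar R) :
  measurable_fun setT Psi -> (forall z, 0 <= Psi z) ->
  \int[lebesgue_Cn]_z Psi z =
  \int[mu \x mu]_q \int[lebesgue_Cn]_v Psi (row_cons (v, q.1, q.2)).
Proof.
move=> mPsi Psi0; rewrite tonelli_row_cons1//.
pose P (p : 'rV[R[i]]_n * (mR * mR)) := Psi (row_cons (p.1, p.2.1, p.2.2)).
have mP : measurable_fun setT P by exact: measurable_row_consE.
refine (etrans (esym (@fubini_tonelli1 _ _ 'rV[R[i]]_n (mR * mR)%type R (@lebesgue_Cn R n)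
  (sfprod mu mu) P mP (fun x => Psi0 _))) _).
exact: (@fubini_tonelli2 _ _ 'rV[R[i]]_n (mR * mR)%type R (@lebesgue_Cn R n)
  (sfprod mu mu) P mP (fun x => Psi0 _)).
Qed.

End LebesgueCnTonelli.

Section ShearedMeanValue.
Context (R : realType).
Notation mu := (@lebesgue_measure R).
Local Notation mR := (measurableTypeR R).
Implicit Types (n : nat) (r s : R).

Lemma differentiable_affine_row n m (c : 'rV[R[i]]_m) (B : 'I_n -> 'rV[R[i]]_m)
    (v : 'rV[R[i]]_n) :
  differentiable (fun v : 'rV[R[i]]_n => c + \sum_(j < n) v ord0 j *: B j) v.
Proof.
apply: (@differentiableD _ _ _ (fun=> c) (fun v : 'rV[R[i]]_n => \sum_(j < n) v ord0 j *: B j)).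
  exact: differentiable_cst.
rewrite (_ : (fun v : 'rV[R[i]]_n => _) = \sum_(j < n) (fun v : 'rV[R[i]]_n => v ord0 j *: B j)).
  by apply: differentiable_sum => j; apply: differentiableZl; exact: differentiable_coord.
by apply/funext => u; rewrite fct_sumE.
Qed.

Lemma differentiable_line n (c B : 'rV[R[i]]_n) (t : R[i]) :
  differentiable (fun t : R[i] => c + t *: B) t.
Proof.
apply: (@differentiableD _ _ _ (fun=> c) (fun t : R[i] => t *: B)).
  exact: differentiable_cst.
by apply: (@differentiableZl _ _ _ id).
Qed.

Lemma differentiable_comp_row n m (G : 'rV[R[i]]_m -> R[i]) (F : 'rV[R[i]]_n -> 'rV[R[i]]_m)
    (c : 'rV[R[i]]_m) (B : 'I_n -> 'rV[R[i]]_m) (v : 'rV[R[i]]_n) :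
  (forall u : 'rV[R[i]]_n, F u = c + \sum_(j < n) u ord0 j *: B j) ->
  differentiable G (F v) -> differentiable (fun u => G (F u)) v.
Proof.
move=> FE dG; apply: (@differentiable_comp _ _ _ _ F G) => //.
rewrite (_ : F = (fun u => c + \sum_(j < n) u ord0 j *: B j)); last exact/funext.
exact: differentiable_affine_row.
Qed.

Lemma differentiable_comp_line m (G : 'rV[R[i]]_m -> R[i]) (F : R[i] -> 'rV[R[i]]_m)
    (c B : 'rV[R[i]]_m) (t : R[i]) : (forall u, F u = c + u *: B) ->
  differentiable G (F t) -> differentiable (fun u => G (F u)) t.
Proof.
move=> FE dG; apply: (@differentiable_comp _ _ _ _ F G) => //.
rewrite (_ : F = (fun u => c + u *: B)); last exact/funext.
exact: differentiable_line.
Qed.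

Definition crow n (t : R[i]) (v : 'rV[R[i]]_n) : 'rV[R[i]]_n.+1 :=
  row_cons (v, complex.Re t, complex.Im t).

Lemma crow0 n t (v : 'rV[R[i]]_n) : crow t v ord0 ord0 = t.
Proof. by rewrite /crow row_cons0/=; case: t. Qed.

Lemma crowS n t (v : 'rV[R[i]]_n) j : crow t v ord0 (lift ord0 j) = v ord0 j.
Proof. by rewrite /crow row_consS. Qed.

Lemma crow_eta n (z : 'rV[R[i]]_n.+1) :
  crow (z ord0 ord0) (\row_j z ord0 (lift ord0 j)) = z.
Proof.
apply/rowP => j; have [->|[l ->]] : j = ord0 \/ exists l, j = lift ord0 l.
    by case: (unliftP ord0 j) => [l ->|->]; [right; exists l|left].
  by rewrite crow0.
by rewrite crowS mxE.
Qed.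

Lemma eq_crowP n (z z' : 'rV[R[i]]_n.+1) : z ord0 ord0 = z' ord0 ord0 ->
  (forall j, z ord0 (lift ord0 j) = z' ord0 (lift ord0 j)) -> z = z'.
Proof.
move=> h0 hS; apply/rowP => j.
have [->//|[l ->]] : j = ord0 \/ exists l, j = lift ord0 l.
  by case: (unliftP ord0 j) => [l ->|->]; [right; exists l|left].
exact: hS.
Qed.

Lemma crow_affine_fst n (v : 'rV[R[i]]_n) t :
  crow t v = crow 0 v + t *: delta_mx ord0 ord0.
Proof.
apply: eq_crowP => [|j]; rewrite [RHS]mxE ?crow0 ?crowS !mxE ?eqxx/=.
  by rewrite mulr1 add0r.
by rewrite mulr0 addr0.
Qed.

Lemma sum_scale_delta n (v : 'rV[R[i]]_n) : \sum_(j < n) v ord0 j *: delta_mx ord0 j = v.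
Proof.
apply/rowP => k; rewrite summxE (bigD1 k)//= big1 ?addr0 => [|j jk].
  by rewrite !mxE !eqxx mulr1.
by rewrite !mxE eqxx eq_sym (negbTE jk) mulr0.
Qed.

Lemma crow_affine_snd n t (v : 'rV[R[i]]_n) :
  crow t v = crow t 0 + \sum_(j < n) v ord0 j *: delta_mx ord0 (lift ord0 j).
Proof.
apply: eq_crowP => [|j]; rewrite [RHS]mxE ?crow0 ?crowS summxE.
  by rewrite big1 ?addr0// => k _; rewrite !mxE mulr0.
rewrite mxE add0r -{1}(sum_scale_delta v) summxE; apply: eq_bigr => k _.
by rewrite !mxE !eqxx (inj_eq (@lift_inj _ ord0)).
Qed.

Lemma area_mean_value_slice n (G : 'rV[R[i]]_n.+1 -> R[i]) (v : 'rV[R[i]]_n)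
    (c : R[i]) s (Psi : 'rV[R[i]]_n.+1 -> \bar R) : 0 < s ->
  (forall t, supn (t - c) <= s -> differentiable G (crow t v)) ->
  measurable_fun setT Psi -> (forall z, (0 <= Psi z)%E) ->
  (forall t, supn (t - c) <= s -> ((nrm (G (crow t v)))%:E <= Psi (crow t v))%E) ->
  ((nrm (G (crow c v)) * s ^+ 2)%:E <=
     8%:E * \int[mu \x mu]_q Psi (row_cons (v, q.1, q.2)))%E.
Proof.
move=> s0 dG mPsi Psi0 GPsi; case: c dG GPsi => c1 c2 dG GPsi.
have near x y : c1 - s <= x <= c1 + s -> c2 - s <= y <= c2 + s ->
    supn ((x +i* y) - (c1 +i* c2)) <= s.
  by move=> xP yP; rewrite supn_le /= !ler_norml; apply/andP; split; lra.
apply: (@area_mean_value R (fun t => G (crow t v)) c1 c2 s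
    (fun q : mR * mR => Psi (row_cons (v, q.1, q.2)))) => //.
- move=> x y xP yP.
  apply: (differentiable_comp_line (crow_affine_fst v)).
  by apply: dG; exact: near.
- exact: (measurableT_comp (measurable_row_consE mPsi) (pair1_measurable v)).
- by move=> x y xP yP; exact: GPsi (near x y xP yP).
Qed.

(** Induction on the dimension by slices in the first coordinate: the majorant for the remaining
    coordinates is 8 times the integral of [Psi] over the slice. A majorant measurable on the whole
    space replaces the modulus of [G], so that partial integrals satisfy the same hypotheses. *)
Lemma mean_value_polysquare n (p : 'rV[R[i]]_n) r (G : 'rV[R[i]]_n -> R[i])
    (Psi : 'rV[R[i]]_n -> \bar R) : 0 < r ->
  (forall z, polysquare p r z -> differentiable G z) ->
  measurable_fun setT Psi -> (forall z, (0 <= Psi z)%E) ->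
  (forall z, polysquare p r z -> ((nrm (G z))%:E <= Psi z)%E) ->
  ((nrm (G p) * (r ^+ 2) ^+ n)%:E <= (8 ^+ n)%:E * \int[lebesgue_Cn]_z Psi z)%E.
Proof.
move=> r0; elim: n p G Psi => [|n IH] p G Psi dG mPsi Psi0 GPsi.
  rewrite !expr0 mulr1 mul1e /= integral_dirac//= diracT mul1e.
  have -> : 0 = p by apply/rowP => -[].
  by apply: GPsi => -[].
set p0 := p ord0 ord0; pose pv : 'rV_n := \row_j p ord0 (lift ord0 j).
have psq t v : supn (t - p0) <= r -> polysquare pv r v -> polysquare p r (crow t v).
  move=> tr vr j; have [->|[l ->]] : j = ord0 \/ exists l, j = lift ord0 l.
      by case: (unliftP ord0 j) => [l ->|->]; [right; exists l|left].
    by rewrite crow0.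
  by rewrite crowS; have := vr l; rewrite mxE.
pose Phi v := (8%:E * \int[mu \x mu]_q Psi (row_cons (v, q.1, q.2)))%E.
have int0 v : (0 <= \int[mu \x mu]_q Psi (row_cons (v, q.1, q.2)))%E.
  by apply: integral_ge0 => q _; exact: Psi0.
have mint : measurable_fun setT
    (fun v => (\int[mu \x mu]_q Psi (row_cons (v, q.1, q.2)))%E).
  exact: (@measurable_fun_fubini_tonelli_F _ _ 'rV[R[i]]_n (mR * mR)%type R
     (sfprod mu mu) _ (measurable_row_consE mPsi) (fun q => Psi0 _)).
pose G' v := G (crow p0 v) * (r ^+ 2)%:C.
have := IH pv G' Phi; move=> /(_ _ _ _ _).
have -> : G' pv = G p * (r ^+ 2)%:C by rewrite /G' /pv crow_eta.
rewrite nrmM nrm_real ger0_norm ?sqr_ge0// -mulrA -exprS.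
move=> IHE; apply: le_trans (IHE _ _ _ _) _.
- move=> v vP; apply: (@differentiableM _ _ (fun v => G (crow p0 v)) (fun=> (r ^+ 2)%:C)).
    apply: (differentiable_comp_row (crow_affine_snd p0)).
    by apply: dG; apply: psq => //; rewrite subrr supn0 ltW.
  exact: differentiable_cst.
- by apply: emeasurable_funM => //; exact: measurable_cst.
- by move=> v; apply: mule_ge0.
- move=> v vP; rewrite /G' nrmM nrm_real ger0_norm ?sqr_ge0//.
  apply: area_mean_value_slice => //.
    by move=> t tp; apply: dG; exact: psq.
  by move=> t tp; apply: GPsi; exact: psq.
- rewrite tonelli_row_cons1// /Phi ge0_integralZl//.
  by rewrite muleA -EFinM -exprSr.
Qed.

End ShearedMeanValue.

Section Sheared.
Context (R : realType).
Notation mu := (@lebesgue_measure R).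
Local Notation mR := (measurableTypeR R).
Implicit Types (n : nat) (r s : R).

(* The [j]-th coordinate is replaced by the linear form with coefficients [a]. *)
Definition shear n (p : 'rV[R[i]]_n) r s (a : 'I_n -> R[i]) (j : 'I_n) : set 'rV[R[i]]_n :=
  [set z | (forall k, k != j -> supn (z ord0 k - p ord0 k) <= r) /\
           supn (\sum_k a k * (z ord0 k - p ord0 k)) <= s].

(** For fixed remaining coordinates [v] the sheared condition puts the first coordinate in a square
    of half-side [s] centred at [c v], which is affine in [v]. The slice estimate is taken at that
    moving centre, and the unsheared inequality applies to [G (crow (c v) v)] as a function of
    [v]. *)
Lemma mean_value_sheared0 n (a : 'I_n.+1 -> R[i]) (p : 'rV[R[i]]_n.+1) r s
    (G : 'rV[R[i]]_n.+1 -> R[i]) (Psi : 'rV[R[i]]_n.+1 -> \bar R) :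
  0 < r -> 0 < s -> a ord0 = 1 ->
  (forall z, shear p r s a ord0 z -> differentiable G z) ->
  measurable_fun setT Psi -> (forall z, (0 <= Psi z)%E) ->
  (forall z, shear p r s a ord0 z -> ((nrm (G z))%:E <= Psi z)%E) ->
  ((nrm (G p) * ((r ^+ 2) ^+ n * s ^+ 2))%:E <=
     (8 ^+ n.+1)%:E * \int[lebesgue_Cn]_z Psi z)%E.
Proof.
move=> r0 s0 a0 dG mPsi Psi0 GPsi.
set p0 := p ord0 ord0; pose pv : 'rV_n := \row_j p ord0 (lift ord0 j).
have pE : crow p0 pv = p by exact: crow_eta.
pose c (v : 'rV[R[i]]_n) := p0 - \sum_(k < n) a (lift ord0 k) * (v ord0 k - pv ord0 k).
have aff v : crow (c v) v = crow (c 0) 0 + \sum_(k < n) v ord0 k *: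
    (delta_mx ord0 (lift ord0 k) - a (lift ord0 k) *: delta_mx ord0 ord0).
  have cv : c v = c 0 - \sum_(k < n) v ord0 k * a (lift ord0 k).
    rewrite /c -addrA -opprD -big_split/=; congr (_ - _); apply: eq_bigr => k _.
    by rewrite !mxE; ring.
  apply: eq_crowP => [|k]; rewrite [RHS]mxE ?crow0 ?crowS summxE.
    rewrite cv; congr (_ + _); rewrite -sumrN; apply: eq_bigr => k _.
    by rewrite !mxE eqxx/=; ring.
  rewrite mxE add0r -{1}(sum_scale_delta v) summxE; apply: eq_bigr => l _.
  by rewrite !mxE !eqxx (inj_eq (@lift_inj _ ord0))/= mulr0 subr0.
pose Phi v := (8%:E * \int[mu \x mu]_q Psi (row_cons (v, q.1, q.2)))%E.
have int0 v : (0 <= \int[mu \x mu]_q Psi (row_cons (v, q.1, q.2)))%E.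
  by apply: integral_ge0 => q _; exact: Psi0.
have mint : measurable_fun setT
    (fun v => (\int[mu \x mu]_q Psi (row_cons (v, q.1, q.2)))%E).
  exact: (@measurable_fun_fubini_tonelli_F _ _ 'rV[R[i]]_n (mR * mR)%type R
     (sfprod mu mu) _ (measurable_row_consE mPsi) (fun q => Psi0 _)).
pose G' v := G (crow (c v) v) * (s ^+ 2)%:C.
have sh t v : supn (t - c v) <= s -> polysquare pv r v -> shear p r s a ord0 (crow t v).
  move=> tc vr; split.
    move=> k; have [->|[l ->]] : k = ord0 \/ exists l, k = lift ord0 l.
        by case: (unliftP ord0 k) => [l ->|->]; [right; exists l|left].
      by rewrite eqxx.
    by rewrite crowS => _; have := vr l; rewrite mxE.
  rewrite big_ord_recl crow0 -/p0 a0 mul1r.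
  have -> : \sum_(k < n) a (lift ord0 k) * (crow t v ord0 (lift ord0 k) -
      p ord0 (lift ord0 k)) = p0 - c v.
    by rewrite /c subKr; apply: eq_bigr => k _; rewrite crowS !mxE.
  by rewrite addrA subrK.
have IHE := @mean_value_polysquare R n pv r G' Phi r0.
have cpv : c pv = p0 by rewrite /c big1 ?subr0// => k _; rewrite subrr mulr0.
move: IHE; have -> : G' pv = G p * (s ^+ 2)%:C by rewrite /G' cpv pE.
rewrite nrmM nrm_real ger0_norm ?sqr_ge0// -mulrA [s ^+ 2 * _]mulrC.
move=> IHE; apply: le_trans (IHE _ _ _ _) _.
- move=> v vP; apply: (@differentiableM _ _ (fun v => G (crow (c v) v)) (fun=> (s ^+ 2)%:C)).
    apply: (differentiable_comp_row aff).
    by apply: dG; apply: sh => //; rewrite subrr supn0 ltW.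
  exact: differentiable_cst.
- by apply: emeasurable_funM => //; exact: measurable_cst.
- by move=> v; apply: mule_ge0.
- move=> v vP; rewrite /G' nrmM nrm_real ger0_norm ?sqr_ge0//.
  apply: area_mean_value_slice => //.
    by move=> t tp; apply: dG; exact: sh.
  by move=> t tp; apply: GPsi; exact: sh.
- rewrite tonelli_row_cons1// /Phi ge0_integralZl//.
  by rewrite muleA -EFinM -exprSr.
Qed.

(** Induction until the distinguished coordinate comes first. Slicing by the first coordinate [t]
    leaves a sheared polydisc of lower dimension whose centre is displaced along coordinate [j'] by
    [- a ord0 * (t - p0)]: since [a j = 1], this absorbs the contribution of [t] to the linear
    form. *)
Lemma mean_value_sheared n (a : 'I_n.+1 -> R[i]) (j : 'I_n.+1) (p : 'rV[R[i]]_n.+1) r s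
    (G : 'rV[R[i]]_n.+1 -> R[i]) (Psi : 'rV[R[i]]_n.+1 -> \bar R) :
  0 < r -> 0 < s -> a j = 1 ->
  (forall z, shear p r s a j z -> differentiable G z) ->
  measurable_fun setT Psi -> (forall z, (0 <= Psi z)%E) ->
  (forall z, shear p r s a j z -> ((nrm (G z))%:E <= Psi z)%E) ->
  ((nrm (G p) * ((r ^+ 2) ^+ n * s ^+ 2))%:E <=
     (8 ^+ n.+1)%:E * \int[lebesgue_Cn]_z Psi z)%E.
Proof.
move=> r0 s0; elim: n a j p G Psi => [|n IH] a j p G Psi.
  by rewrite (ord1 j); exact: mean_value_sheared0.
have [->|[j' jE]] : j = ord0 \/ exists j', j = lift ord0 j'.
  by case: (unliftP ord0 j) => [l ->|->]; [right; exists l|left].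
  exact: mean_value_sheared0.
move=> aj dG mPsi Psi0 GPsi.
set p0 := p ord0 ord0; pose pv : 'rV_n.+1 := \row_j p ord0 (lift ord0 j).
have pE : crow p0 pv = p by exact: crow_eta.
have aff t : crow t (pv - (a ord0 * (t - p0)) *: delta_mx ord0 j') =
    crow 0 (pv + (a ord0 * p0) *: delta_mx ord0 j') +
    t *: (delta_mx ord0 ord0 - a ord0 *: delta_mx ord0 j).
  apply: eq_crowP => [|k]; rewrite [RHS]mxE ?crow0 ?crowS jE !mxE ?eqxx/=.
    by rewrite !mulr0 subr0 mulr1 add0r.
  by rewrite (inj_eq (@lift_inj _ ord0)); ring.
pose c := (r ^+ 2) ^+ n * s ^+ 2.
have c0 : 0 < c by rewrite mulr_gt0 ?exprn_gt0.
pose g t := G (crow t (pv - (a ord0 * (t - p0)) *: delta_mx ord0 j')) * c%:C.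
pose Phi (q : mR * mR) :=
  ((8 ^+ n.+1)%:E * \int[lebesgue_Cn]_v Psi (row_cons (v, q.1, q.2)))%E.
have int0 (q : mR * mR) : (0 <= \int[lebesgue_Cn]_v Psi (row_cons (v, q.1, q.2)))%E.
  by apply: integral_ge0 => v _; exact: Psi0.
have mint : measurable_fun setT
    (fun q : mR * mR => (\int[lebesgue_Cn]_v Psi (row_cons (v, q.1, q.2)))%E).
  exact: (@measurable_fun_fubini_tonelli_G _ _ 'rV[R[i]]_n.+1 (mR * mR)%type R
     (@lebesgue_Cn R n.+1) _ (measurable_row_consE mPsi) (fun q => Psi0 _)).
pose a' k := a (lift ord0 k).
have sh t : supn (t - p0) <= r -> forall v,
    shear (pv - (a ord0 * (t - p0)) *: delta_mx ord0 j') r s a' j' v ->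
    shear p r s a j (crow t v).
  move=> tr v [h1 h2]; split.
    move=> k; have [->|[l ->]] : k = ord0 \/ exists l, k = lift ord0 l.
        by case: (unliftP ord0 k) => [l ->|->]; [right; exists l|left].
      by rewrite crow0.
    rewrite jE (inj_eq (@lift_inj _ ord0)) crowS => lj.
    by have := h1 l lj; rewrite !mxE eqxx (negbTE lj) mulr0 subr0.
  rewrite big_ord_recl crow0 -/p0 (_ : a ord0 * (t - p0) + _ =
    \sum_(k < n.+1) a' k * (v ord0 k -
       (pv - (a ord0 * (t - p0)) *: delta_mx ord0 j') ord0 k))//.
  rewrite (bigD1 j')//= [RHS](bigD1 j')//= addrA; congr (_ + _).
    by rewrite crowS /a' !mxE !eqxx/= -!jE aj; ring.
  apply: eq_bigr => k kj.
  by rewrite crowS !mxE eqxx (negbTE kj) mulr0 subr0.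
have := @area_mean_value R g (complex.Re p0) (complex.Im p0) r Phi r0.
have -> : (complex.Re p0 +i* complex.Im p0) = p0 by case: (p0).
have -> : g p0 = G p * c%:C by rewrite /g subrr mulr0 scale0r subr0 pE.
rewrite nrmM nrm_real (ger0_norm (ltW c0)).
have -> : nrm (G p) * c * r ^+ 2 = nrm (G p) * ((r ^+ 2) ^+ n.+1 * s ^+ 2).
  by rewrite /c [_ ^+ n.+1]exprS; ring.
have near x y : complex.Re p0 - r <= x <= complex.Re p0 + r ->
    complex.Im p0 - r <= y <= complex.Im p0 + r -> supn ((x +i* y) - p0) <= r.
  move=> xP yP; rewrite supn_le ReD ImD ReN ImN /= !ler_norml.
  by apply/andP; split; lra.
have jn : j' != j' -> False by rewrite eqxx.
have shc t : supn (t - p0) <= r ->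
    shear p r s a j (crow t (pv - (a ord0 * (t - p0)) *: delta_mx ord0 j')).
  move=> tr; apply: sh => //; split=> [k kj|]; first by rewrite subrr supn0 ltW.
  by rewrite big1 ?supn0 ?ltW// => k _; rewrite subrr mulr0.
move=> AMV; apply: le_trans (AMV _ _ _ _) _.
- move=> x y xP yP; rewrite /g.
  apply: (@differentiableM _ _ (fun t => G (crow t (pv - (a ord0 * (t - p0)) *:
    delta_mx ord0 j'))) (fun=> c%:C)); last exact: differentiable_cst.
  apply: (differentiable_comp_line aff); apply: dG; apply: shc; exact: near.
- by apply: emeasurable_funM => //; exact: measurable_cst.
- by move=> q; apply: mule_ge0; rewrite ?lee_fin ?exprn_ge0.
- move=> x y xP yP; rewrite /g /Phi nrmM nrm_real (ger0_norm (ltW c0)).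
  have tr := near x y xP yP; set t := x +i* y.
  apply: (IH a' j' _ (fun v => G (crow t v)) (fun v => Psi (row_cons (v, x, y)))).
  + by rewrite /a' -jE.
  + move=> v vP; apply: (differentiable_comp_row (crow_affine_snd t)).
    by apply: dG; exact: (sh t tr).
  + exact: (measurableT_comp (measurable_row_consE mPsi)
      (@pair2_measurable _ _ 'rV[R[i]]_n.+1 (mR * mR)%type (x, y))).
  + by move=> v; exact: Psi0.
  + by move=> v vP; exact: GPsi (sh t tr v vP).
- have k0 : (0 <= (8 ^+ n.+1)%:E :> \bar R)%E by rewrite lee_fin exprn_ge0.
  rewrite tonelli_row_cons2// /Phi (ge0_integralZl _ measurableT mint (fun q _ => int0 q) k0)//.
  by rewrite muleA -EFinM -exprS.
Qed.

End Sheared.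

Section ShearedMeanValueOnSet.
Context (R : realType).
Implicit Types (n : nat) (r s : R).

Lemma continuous_supn (T : topologicalType) (F : T -> R[i]) x :
  {for x, continuous F} -> {for x, continuous (fun y => supn (F y))}.
Proof.
move=> cF.
apply: (@continuous_max _ _ (fun y => `|complex.Re (F y)|) (fun y => `|complex.Im (F y)|)).
  exact: (cvg_norm (continuous_Re cF)).
exact: (cvg_norm (continuous_Im cF)).
Qed.

Definition open_shear n (p : 'rV[R[i]]_n) r s (a : 'I_n -> R[i]) (j : 'I_n) : set 'rV[R[i]]_n :=
  [set z | (forall k, k != j -> supn (z ord0 k - p ord0 k) < r) /\
           supn (\sum_k a k * (z ord0 k - p ord0 k)) < s].

Lemma open_open_shear n (p : 'rV[R[i]]_n) r s a j : open (open_shear p r s a j).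
Proof.
have co k (z : 'rV[R[i]]_n) : {for z, continuous (fun z : 'rV[R[i]]_n => z ord0 k - p ord0 k)}.
  apply: (@continuousB _ _ _ (fun z : 'rV[R[i]]_n => z ord0 k) (fun=> p ord0 k)).
    exact: continuous_coord.
  exact: cst_continuous.
have cS (z : 'rV[R[i]]_n) :
    {for z, continuous (fun z : 'rV[R[i]]_n => \sum_k a k * (z ord0 k - p ord0 k))}.
  apply: (@differentiable_continuous _ _ _ z); rewrite (_ : (fun _ => _) =
    (fun z : 'rV[R[i]]_n => \sum_k (- (a k * p ord0 k)) + \sum_k z ord0 k *: a k)).
    rewrite (_ : (fun _ => _) = (fun=> \sum_k - (a k * p ord0 k)) +
        \sum_k (fun z : 'rV[R[i]]_n => z ord0 k *: a k)).
      apply: differentiableD; first exact: differentiable_cst.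
      apply: differentiable_sum => k; apply: differentiableZl; exact: differentiable_coord.
    by apply/funext => u; rewrite fctE fct_sumE.
  apply/funext => u; rewrite -big_split/=; apply: eq_bigr => k _.
  by rewrite mulrBr addrC [_ *: _]mulrC.
have lt_near (F : 'rV[R[i]]_n -> R[i]) z b : {for z, continuous F} -> supn (F z) < b ->
    \forall y \near z, supn (F y) < b.
  by move=> /continuous_supn cF Fb; apply: (cvgr_lt _ cF).
rewrite openE => z [h1 h2]; rewrite /interior.
have hA : \forall y \near z, forall k, k != j -> supn ((y : 'rV[R[i]]_n) ord0 k - p ord0 k) < r.
  have : \forall y \near z, forall k : 'I_n, k \in enum 'I_n -> k != j ->
      supn ((y : 'rV[R[i]]_n) ord0 k - p ord0 k) < r.
    elim: (enum 'I_n) => [|k0 l IH]; first exact: filterE.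
    have hk0 : \forall y \near z, k0 != j -> supn ((y : 'rV[R[i]]_n) ord0 k0 - p ord0 k0) < r.
      have [->|k0j] := eqVneq k0 j; first exact: filterE.
      by apply: filterS (lt_near _ _ _ (co k0 z) (h1 _ k0j)) => y.
    apply: filterS2 hk0 IH => y hk0 hl k; rewrite inE => /orP[/eqP->//|kl]; exact: hl.
  by apply: filterS => y hy k; apply: hy; rewrite mem_enum.
have hB := lt_near _ _ _ (cS z) h2.
by apply: filterS2 hA hB => y.
Qed.

(** All superlevel sets are open: the whole space for a negative level, an open part of [P]
    otherwise. *)
Lemma measurable_patch_nrm n (P : set 'rV[R[i]]_n) (G : 'rV[R[i]]_n -> R[i]) :
  open P -> (forall z, P z -> {for z, continuous G}) ->
  measurable_fun setT ((fun z => (nrm (G z))%:E) \_ P : _ -> \bar R).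
Proof.
move=> oP cG; apply: (measurability _ (ErealGenOInfty.measurableE R)).
move=> /= _ [_ [x ->]] <-; rewrite setTI; apply: open_measurable_Cn.
have [x0|x0] := ltP x 0.
  rewrite (_ : _ @^-1` _ = setT); first exact: openT.
  rewrite -subTset => z _; rewrite /= in_itv/= andbT /patch; case: ifP => _.
    by rewrite lte_fin (lt_le_trans x0)// nrm_ge0.
  by rewrite lte_fin.
rewrite openE => z; rewrite /= in_itv/= andbT /patch; case: ifPn => [|_]; last first.
  by rewrite lte_fin ltNge x0.
rewrite inE lte_fin => Pz xz; rewrite /interior.
have nP : \forall y \near z, P y by exact: open_nbhs_nbhs.
have nG : \forall y \near z, x < nrm (G y).
  by apply: (cvgr_gt _ (continuous_nrm (cG z Pz))).
by apply: filterS2 nP nG => y Py xy; rewrite /= in_itv/= andbT mem_set// lte_fin.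
Qed.

(** The open sheared polydisc of radii [2 * r] and [2 * s] contains the closed one of radii [r] and
    [s] and lies in [E]. Cutting the modulus of [G] off outside it gives a measurable majorant whose
    integral is at most the one over [E]. *)
Lemma mean_value_sheared_set n (a : 'I_n.+1 -> R[i]) (j : 'I_n.+1) (p : 'rV[R[i]]_n.+1) r s
    (G : 'rV[R[i]]_n.+1 -> R[i]) (E : set 'rV[R[i]]_n.+1) :
  0 < r -> 0 < s -> a j = 1 ->
  (forall z, shear p (2 * r) (2 * s) a j z -> differentiable G z /\ E z) ->
  ((nrm (G p) * ((r ^+ 2) ^+ n * s ^+ 2))%:E <=
     (8 ^+ n.+1)%:E * \int[lebesgue_Cn]_(z in E) (nrm (G z))%:E)%E.
Proof.
move=> r0 s0 aj dGE; pose P := open_shear p (2 * r) (2 * s) a j.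
have oP : open P by exact: open_open_shear.
have Psh z : P z -> shear p (2 * r) (2 * s) a j z.
  by move=> [h1 h2]; split=> [k kj|]; apply/ltW => //; exact: h1.
have shP z : shear p r s a j z -> P z.
  by move=> [h1 h2]; split=> [k /h1|]; [|move: h2]; lra.
have cG z : P z -> {for z, continuous G}.
  by move=> /Psh/dGE[dG _]; exact: differentiable_continuous.
have G0 z : (0 <= ((fun z => (nrm (G z))%:E) \_ P : _ -> \bar R) z)%E.
  by rewrite /patch; case: ifP => // _; rewrite lee_fin nrm_ge0.
apply: le_trans (mean_value_sheared r0 s0 aj _ (measurable_patch_nrm oP cG) G0 _) _.
- by move=> z /shP/Psh/dGE[].
- by move=> z /shP Pz; rewrite /patch mem_set.
rewrite lee_pmul2l ?lte_fin ?exprn_gt0//.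
rewrite -integral_mkcond; apply: ge0_le_integral_patch.
- by move=> z _; rewrite lee_fin nrm_ge0.
- by move=> z _; rewrite lee_fin nrm_ge0.
- by move=> z /Psh/dGE[].
Qed.

End ShearedMeanValueOnSet.

(** * Geometry of strongly pseudoconvex domains *)

Section SmoothTaylor.
Context (R : realType) (n : nat).
Local Notation Cn := 'rV[R[i]]_n.
Local Notation dir := (bool * 'I_n)%type.
Implicit Types (z : Cn) (d : dir) (u t : dir -> R).

(** Real coordinates are indexed by directions, so that [upd] can change them one at a time. *)
Definition displace z u : Cn := \row_j (z ord0 j + (u (false, j) +i* u (true, j))).

Lemma displace0 z : displace z (fun=> 0) = z.
Proof. by apply/rowP => j; rewrite mxE [0 +i* 0](_ : _ = 0)// addr0. Qed.

Definition upd u d (x : R) : dir -> R := fun d' => if d' == d then x else u d'.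

Lemma displace_upd z u d x y :
  displace z (upd u d (x + y)) = displace z (upd u d x) + y%:C *: real_dir R d.
Proof.
case: d => b k; apply/rowP => j; rewrite /real_dir/= !mxE -addrA; congr (_ + _).
rewrite /upd/= !xpair_eqE/=.
by case: b; have [jk|jk] := eqVneq j k; apply: eqC;
  rewrite /= ?(ReD, ImD, ReM, ImM)/=; ring.
Qed.

Lemma polysquare_displace z u (s : R) : (forall d, `|u d| <= s) ->
  polysquare z s (displace z u).
Proof. by move=> us j; rewrite mxE addrC addKr supn_le/= !us. Qed.

Lemma mean_value_pderiv (g : Cn -> R) d z x :
  (forall z, derivable (along g d z) 0 1) ->
  exists2 y, `|y| <= `|x| &
    g (z + x%:C *: real_dir R d) - g z = x * pderiv g d (z + y%:C *: real_dir R d).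
Proof.
move=> dg.
have along_shift y h : along g d (z + y%:C *: real_dir R d) h = along g d z (h + y).
  by rewrite /along -addrA -scalerDl -rmorphD [h + y]addrC.
have isd (y : R) : is_derive y 1 (along g d z) (pderiv g d (z + y%:C *: real_dir R d)).
  pose G := along g d (z + y%:C *: real_dir R d).
  rewrite (_ : along g d z = G \o (fun h => h - y)); last first.
    by apply/funext => h; rewrite /G /= along_shift subrK.
  have G0 : is_derive (y - y) 1 G (pderiv g d (z + y%:C *: real_dir R d)).
    by rewrite subrr /pderiv derive1E; apply/derivableP; exact: dg.
  have Gs : is_derive y 1 (fun h : R => h - y) 1.
    by apply: is_derive_eq; rewrite subr0.
  by have := @is_derive1_comp R G (fun h => h - y) y _ _ G0 Gs; rewrite mulr1.
have E0 : g z = along g d z 0 by rewrite /along scale0r addr0.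
have Ex : g (z + x%:C *: real_dir R d) = along g d z x by [].
have cont a b : {within `[a, b], continuous (along g d z)}.
  apply: continuous_subspaceT => y; apply: differentiable_continuous.
  by apply/derivable1_diffP; have [] := isd y.
have [x0|x0|->] := ltgtP x 0.
- have [y yP] := MVT x0 (fun y _ => isd y) (cont x 0).
  rewrite sub0r mulrN => E; exists y.
    by move: yP; rewrite in_itv/= => /andP[xy y0]; rewrite !ltr0_norm// lerN2 ltW.
  by rewrite Ex E0 -[LHS]opprB E opprK mulrC.
- have [y yP] := MVT x0 (fun y _ => isd y) (cont 0 x).
  rewrite subr0 => E; exists y.
    by move: yP; rewrite in_itv/= => /andP[xy y0]; rewrite !gtr0_norm// ltW.
  by rewrite Ex E0 E mulrC.
- by exists 0; rewrite ?normr0// scale0r addr0 subrr mul0r.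
Qed.

(** [smooth] speaks of partial derivatives, so the displaced point is reached by changing one real
    coordinate at a time, with the mean value theorem on each edge. With [c = 0] this is a Lipschitz
    bound, with [c] the partial derivatives at [z] a second-order one. *)
Lemma taylor_displace (g : Cn -> R) z t (c : dir -> R) (s E : R) :
  (forall d z, derivable (along g d z) 0 1) ->
  (forall d, `|t d| <= s) ->
  (forall d v, polysquare z s v -> `|pderiv g d v - c d| <= E) ->
  `|g (displace z t) - g z - \sum_d t d * c d| <= (n * 2)%:R * (s * E).
Proof.
move=> dg ts gE.
pose ut (l : seq dir) d := if d \in l then t d else 0.
suff key (l : seq dir) : uniq l ->
    `|g (displace z (ut l)) - g z - \sum_(d <- l) t d * c d| <= (size l)%:R * (s * E).
  have := key (index_enum dir) (index_enum_uniq _).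
  have -> : ut (index_enum dir) = t by apply/funext => d; rewrite /ut mem_index_enum.
  have -> : size (index_enum dir) = (n * 2)%N.
    by rewrite [index_enum _]unlock -enumT -cardT card_prod card_bool card_ord mulnC.
  by apply.
elim: l => [_|d l IH /= /andP[dl ul]].
  rewrite big_nil subr0 mul0r (_ : ut [::] = (fun=> 0))//.
  by rewrite displace0 subrr normr0.
have uE : ut (d :: l) = upd (ut l) d (0 + t d).
  apply/funext => d'; rewrite /ut /upd inE add0r.
  by have [->|] := eqVneq d' d.
have uE0 : ut l = upd (ut l) d 0.
  apply/funext => d'; rewrite /ut /upd.
  by have [->|//] := eqVneq d' d; rewrite (negbTE dl).
have [y yt Ey] := mean_value_pderiv (displace z (ut l)) (t d) (dg d).
have near : polysquare z s (displace z (ut l) + y%:C *: real_dir R d).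
  rewrite {1}uE0 -displace_upd add0r; apply: polysquare_displace => d'.
  rewrite /upd /ut; case: eqP => [_|_]; first exact: le_trans yt _.
  by case: ifP => // _; rewrite normr0 (le_trans _ (ts d)).
rewrite uE displace_upd -uE0 big_cons.
rewrite (_ : _ - _ - _ = (g (displace z (ut l)) - g z - \sum_(d <- l) t d * c d) +
   t d * (pderiv g d (displace z (ut l) + y%:C *: real_dir R d) - c d)); last first.
  by rewrite mulrBr -Ey; ring.
rewrite (le_trans (ler_normD _ _))// -[(size l).+1]addn1 natrD mulrDl mul1r lerD ?IH//.
by rewrite normrM ler_pM// gE.
Qed.

End SmoothTaylor.

Section Compactness.
Context (R : realType).

Lemma nbhs_polysquareP n (z : 'rV[R[i]]_n) (P : set 'rV[R[i]]_n) :
  nbhs z P <-> exists2 e : R, 0 < e & polysquare z e `<=` P.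
Proof.
split.
  move=> /nbhs_ballP[d /= d0 dP]; have [dE Rd0] := posC_real d0.
  exists (complex.Re d / 3) => [|v vP]; first by rewrite divr_gt0.
  apply: dP; split => // i j; rewrite (ord1 i) -ball_normE/= normCE dE ltcR nrmBC.
  by rewrite (le_lt_trans (nrm_le_supn _))//; have := vP j; lra.
move=> [e e0 eP]; apply/nbhs_ballP; exists e%:C; first by rewrite /= ltcR.
move=> v [_ vb]; apply: eP => j.
have := vb ord0 j; rewrite -ball_normE/= normCE ltcR nrmBC => h.
by rewrite (le_trans (supn_le_nrm _))// ltW.
Qed.

Lemma compact_square (c : R[i]) (r : R) : compact [set t | supn (t - c) <= r].
Proof.
have -> : [set t | supn (t - c) <= r] =
    (fun q : R * R => c + (q.1 +i* q.2)) @` (`[- r, r]%classic `*` `[- r, r]%classic).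
  apply/seteqP; split => [t tr|_ [[x y] [/= xr yr] <-]]; last first.
    move: xr yr; rewrite !in_itv/= => xr yr.
    by rewrite /= addrC addKr supn_le/= !ler_norml xr yr.
  exists (complex.Re (t - c), complex.Im (t - c)).
    by move: tr; rewrite /= supn_le !ler_norml !in_itv => /andP[].
  by rewrite /= -[RHS](subrK c) addrC; congr (_ + _); case: (t - c).
apply: continuous_compact; last by apply: compact_setX; exact: segment_compact.
apply: continuous_subspaceT => q; apply/continuous_nrmP => e e0.
have e20 : 0 < e / 2 by rewrite divr_gt0.
have q1 : \forall q' \near q, `|q.1 - (q' : R * R).1| < e / 2.
  by apply: (@cvgr_dist_lt _ R^o _ (nbhs q) _ fst q.1) => //; exact: cvg_fst.
have q2 : \forall q' \near q, `|q.2 - (q' : R * R).2| < e / 2.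
  by apply: (@cvgr_dist_lt _ R^o _ (nbhs q) _ snd q.2) => //; exact: cvg_snd.
apply: filterS2 q1 q2 => q' h1 h2.
rewrite opprD addrACA subrr add0r (le_lt_trans (nrm_le_ReIm _))//=.
by rewrite distrC [X in _ + X]distrC; lra.
Qed.

Lemma compact_polysquare n (p : 'rV[R[i]]_n) (r : R) : compact (polysquare p r).
Proof.
exact: (@rV_compact _ n (fun j => [set t | supn (t - p ord0 j) <= r])
  (fun j => @compact_square (p ord0 j) r)).
Qed.

Lemma closed_polysquare n (p : 'rV[R[i]]_n) (r : R) : closed (polysquare p r).
Proof.
apply: compact_closed; last exact: compact_polysquare.
exact: norm_hausdorff.
Qed.

Lemma compact_fun_le (T : topologicalType) (A : set T) (f : T -> R) : compact A ->
  (forall x, A x -> {for x, continuous f}) -> exists2 M, 0 < M & forall x, A x -> f x <= M.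
Proof.
move=> cA cf; have [A0|/set0P/negP] := pselect (A !=set0); last first.
  by rewrite negbK => /eqP->; exists 1.
have cw : {within A, continuous f}.
  by apply: continuous_in_subspaceT => x; rewrite inE; exact: cf.
have [c _ cM] := compact_EVT_max A0 cA cw.
exists (`|f c| + 1) => [|x Ax]; first by rewrite ltr_pwDr.
by rewrite (le_trans (cM _ (mem_set Ax)))// (le_trans (ler_norm _))// lerDl.
Qed.

Lemma compact_fun_ge (T : topologicalType) (A : set T) (f : T -> R) : compact A ->
  (forall x, A x -> {for x, continuous f}) -> (forall x, A x -> 0 < f x) ->
  exists2 c, 0 < c & forall x, A x -> c <= f x.
Proof.
move=> cA cf f0; have [A0|/set0P/negP] := pselect (A !=set0); last first.
  by rewrite negbK => /eqP->; exists 1.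
have cw : {within A, continuous f}.
  by apply: continuous_in_subspaceT => x; rewrite inE; exact: cf.
have [c cA' cM] := compact_EVT_min A0 cA cw.
exists (f c) => [|x Ax]; first by apply: f0; rewrite -inE.
exact: cM (mem_set Ax).
Qed.

Lemma bounded_polysquare n (A : set 'rV[R[i]]_n) : bounded_set A ->
  exists2 B : R, 0 < B & A `<=` polysquare 0 B.
Proof.
move=> /ex_strict_bound_gt0[M M0 MA]; have [ME M0'] := posC_real M0.
exists (complex.Re M) => // z /MA zM j.
have [_ /(_ ord0 j)] : ball (0 : 'rV[R[i]]_n) M z by rewrite -ball_normE/= sub0r normrN.
rewrite -ball_normE/= mxE sub0r normrN ME normCE ltcR subr0 => /ltW.
exact: (le_trans (supn_le_nrm _)).
Qed.

End Compactness.

Section Wirtinger.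
Context (R : realType) (n : nat).
Local Notation Cn := 'rV[R[i]]_n.
Implicit Types (z w : Cn) (rho g : Cn -> R).

Definition cgrad rho z (j : 'I_n) : R[i] :=
  2^-1 * (pderiv rho (false, j) z +i* - pderiv rho (true, j) z).

Lemma pderiv0 d z : pderiv (fun=> 0 : R) d z = 0.
Proof. exact: derive1_cst. Qed.

Lemma cpderiv_real rho d z : cpderiv (fun u => (rho u)%:C) d z = (pderiv rho d z)%:C.
Proof. by rewrite /cpderiv (pderiv0 d). Qed.

Lemma dz_real_valued rho j z : dz j (fun u => (rho u)%:C) z = cgrad rho z j.
Proof.
rewrite /dz /cgrad !cpderiv_real; congr (_ * _).
move: (pderiv rho (false, j) z) (pderiv rho (true, j) z) => a b.
by apply: eqC; rewrite ?(ReD, ImD, ReN, ImN, ReM, ImM)/=; ring.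
Qed.

Lemma pderivZ g d z (c : R) : derivable (along g d z) 0 1 ->
  pderiv (fun u => c * g u) d z = c * pderiv g d z.
Proof.
move=> dg; rewrite /pderiv -[along (fun u => c * g u) d z]/(c *: along g d z).
by rewrite !derive1E; exact: (deriveZ c dg).
Qed.

Lemma nrm_dz_dz_le rho (M : R) j k z : smooth rho ->
  (forall d d', `|pderiv (pderiv rho d) d' z| <= M) ->
  nrm (dz j (dz k (fun u => (rho u)%:C)) z) <= 2 * M.
Proof.
move=> sm rM.
have M0 : 0 <= M by rewrite (le_trans _ (rM (false, j) (false, j))).
have d1 d : forall d' z, derivable (along (pderiv rho d) d' z) 0 1.
  by have [_] := sm [:: d].
have -> : dz k (fun u => (rho u)%:C) = (fun u => cgrad rho u k).
  by apply/funext => u; exact: dz_real_valued.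
have half : 2^-1 = (2^-1 : R)%:C by rewrite fmorphV/= rmorph_nat.
have reE : (fun u => complex.Re (cgrad rho u k)) = (fun u => 2^-1 * pderiv rho (false, k) u).
  apply/funext => u; rewrite /cgrad half.
  by rewrite ReM/= mulrN mul0r oppr0 subr0.
have imE : (fun u => complex.Im (cgrad rho u k)) = (fun u => (- 2^-1) * pderiv rho (true, k) u).
  apply/funext => u; rewrite /cgrad half.
  by rewrite ImM/= mul0r addr0 mulrN mulNr.
have aux (a b : R) : `|a| <= M -> `|b| <= M -> nrm (2^-1 * a +i* (- 2^-1 * b)) <= M.
  move=> aM bM; rewrite (le_trans (nrm_le_ReIm _))//= !normrM normrN ger0_norm//; lra.
have pivot_re d : pderiv (fun u => 2^-1 * pderiv rho (false, k) u) d z =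
    2^-1 * pderiv (pderiv rho (false, k)) d z by apply: pderivZ; exact: d1.
have pivot_im d : pderiv (fun u => (- 2^-1) * pderiv rho (true, k) u) d z =
    (- 2^-1) * pderiv (pderiv rho (true, k)) d z by apply: pderivZ; exact: d1.
have cp d : nrm (cpderiv (fun u => cgrad rho u k) d z) <= M.
  have -> : cpderiv (fun u => cgrad rho u k) d z =
      (2^-1 * pderiv (pderiv rho (false, k)) d z) +i*
      (- 2^-1 * pderiv (pderiv rho (true, k)) d z).
    exact: (congr2 (@Complex R)
      (etrans (congr1 (fun g => pderiv g d z) reE) (pivot_re d))
      (etrans (congr1 (fun g => pderiv g d z) imE) (pivot_im d))).
  exact: aux (rM (false, k) d) (rM (true, k) d).
have auxC (A B : R[i]) : nrm A <= M -> nrm B <= M -> nrm (2^-1 * (A - 'i%C * B)) <= 2 * M.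
  move=> AM BM; rewrite nrmM half nrm_real ger0_norm//.
  by have := nrmB A ('i%C * B); rewrite nrmM nrm_i mul1r; lra.
exact: auxC (cp (false, j)) (cp (true, j)).
Qed.

Definition lform (l : 'I_n -> R[i]) z : R[i] := \sum_k l k * z ord0 k.

Lemma lformD l z w : lform l (z + w) = lform l z + lform l w.
Proof. by rewrite /lform -big_split; apply: eq_bigr => k _; rewrite mxE mulrDr. Qed.

Lemma lformZ l (c : R[i]) z : lform l (c *: z) = c * lform l z.
Proof. by rewrite /lform mulr_sumr; apply: eq_bigr => k _; rewrite mxE mulrCA. Qed.

Lemma lformN l z : lform l (- z) = - lform l z.
Proof. by rewrite -scaleN1r lformZ mulN1r. Qed.

Definition real_coord z (d : bool * 'I_n) : R :=
  if d.1 then complex.Im (z ord0 d.2) else complex.Re (z ord0 d.2).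

Lemma displace_real_coord z w : displace z (real_coord w) = z + w.
Proof. by apply/rowP => j; rewrite !mxE /real_coord/=; case: (w ord0 j). Qed.

(** The real differential is twice the real part of the complex one; this turns real Taylor
    expansions into expansions in a complex linear form. *)
Lemma sum_pderiv_lform rho z w :
  \sum_d real_coord w d * pderiv rho d z = 2 * complex.Re (lform (cgrad rho z) w).
Proof.
have half : 2^-1 = (2^-1 : R)%:C by rewrite fmorphV/= rmorph_nat.
have -> : complex.Re (lform (cgrad rho z) w) = \sum_k complex.Re (cgrad rho z k * w ord0 k).
  by apply: (big_morph (@complex.Re R) (@ReD R)).
rewrite -(pair_bigA _ (fun b k => real_coord w (b, k) * pderiv rho (b, k) z))/=.
rewrite big_bool -big_split/= mulr_sumr; apply: eq_bigr => k _.
have aux (a b : R) (c : R[i]) : complex.Im c * b + complex.Re c * a =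
    2 * complex.Re (2^-1 * (a +i* - b) * c).
  by rewrite half !(ReM, ImM)/=; field.
exact: aux.
Qed.

Lemma sqnorm_ge0 z : 0 <= sqnorm z.
Proof. by apply: sumr_ge0 => j _; rewrite sqr_ge0. Qed.

Lemma nrm_coord_le_sqrt z j : nrm (z ord0 j) <= Num.sqrt (sqnorm z).
Proof.
rewrite -[leLHS]ger0_norm ?nrm_ge0// -sqrtr_sqr ler_wsqrtr// /sqnorm (bigD1 j)//=.
by rewrite lerDl sumr_ge0// => k _; rewrite sqr_ge0.
Qed.

Lemma real_coord_le z d (s : R) : (forall k, supn (z ord0 k) <= s) -> `|real_coord z d| <= s.
Proof.
move=> /(_ d.2); rewrite supn_le /real_coord; case: d => b k /= /andP[h1 h2].
by case: b.
Qed.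

End Wirtinger.

Section Geometry.
Context (R : realType) (n : nat).
Local Notation Cn := 'rV[R[i]]_n.
Implicit Types (z w v : Cn) (rho g : Cn -> R).

Lemma nrm2 : nrm (2 : R[i]) = 2.
Proof. by rewrite -(rmorph_nat (real_complex R)) nrm_real ger0_norm. Qed.

Lemma pderiv_bounds rho (r : R) : smooth rho -> exists2 M : R, 0 < M &
  forall v, polysquare 0 r v -> (forall d, `|pderiv rho d v| <= M) /\
    forall d d', `|pderiv (pderiv rho d) d' v| <= M.
Proof.
move=> sm; have cK := @compact_polysquare R n 0 r.
have bnd (f : Cn -> R) : continuous f ->
    exists M : R, 0 <= M /\ forall v, polysquare 0 r v -> `|f v| <= M.
  move=> cf; have [|M M0 MP] := @compact_fun_le R _ _ (fun v => `|f v|) cK.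
    by move=> v _; exact: (cvg_norm (cf v)).
  by exists M; rewrite ltW.
have /choice[M1 M1P] (d : bool * 'I_n) := bnd _ (sm [:: d]).1.
have /choice[M2 M2P] (d : (bool * 'I_n) * (bool * 'I_n)) := bnd _ (sm [:: d.1; d.2]).1.
exists (1 + (\sum_d M1 d + \sum_d M2 d)).
  by rewrite ltr_pwDl// addr_ge0// sumr_ge0// => d _; [have [] := M1P d|have [] := M2P d].
have s1 : 0 <= \sum_d M1 d by apply: sumr_ge0 => d _; have [] := M1P d.
have s2 : 0 <= \sum_d M2 d by apply: sumr_ge0 => d _; have [] := M2P d.
have le1 d : M1 d <= \sum_d M1 d.
  by rewrite (bigD1 d)//= lerDl sumr_ge0// => k _; have [] := M1P k.
have le2 d : M2 d <= \sum_d M2 d.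
  by rewrite (bigD1 d)//= lerDl sumr_ge0// => k _; have [] := M2P k.
move=> v vP; split => [d|d d'].
  by apply: le_trans ((M1P d).2 v vP) _; have := le1 d; lra.
by apply: le_trans ((M2P (d, d')).2 v vP) _; have := le2 (d, d'); lra.
Qed.

Lemma smooth_derivable rho d : smooth rho ->
  (forall d' z, derivable (along rho d' z) 0 1) /\
  (forall d' z, derivable (along (pderiv rho d) d' z) 0 1).
Proof. by move=> sm; split; [have [] := sm [::]|have [] := sm [:: d]]. Qed.

Lemma increment_le g z w (s M : R) :
  (forall d z, derivable (along g d z) 0 1) ->
  (forall k, supn (w ord0 k) <= s) ->
  (forall d v, polysquare z s v -> `|pderiv g d v| <= M) ->
  `|g (z + w) - g z| <= (n * 2)%:R * (s * M).
Proof.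
move=> dg ws gM; have := @taylor_displace R n g z (real_coord w) (fun=> 0) s M dg.
rewrite displace_real_coord big1 ?subr0 => [|d _]; last by rewrite mulr0.
apply; first by move=> d; exact: real_coord_le.
by move=> d v /gM; rewrite subr0.
Qed.

Lemma second_order_le rho z w (s M : R) : smooth rho ->
  (forall k, supn (w ord0 k) <= s) ->
  (forall d d' v, polysquare z s v -> `|pderiv (pderiv rho d) d' v| <= M) ->
  `|rho (z + w) - rho z - 2 * complex.Re (lform (cgrad rho z) w)| <=
    (n * 2)%:R * (s * ((n * 2)%:R * (s * M))).
Proof.
move=> sm ws rM; rewrite -sum_pderiv_lform -displace_real_coord.
apply: taylor_displace.
- by have [] := sm [::].
- by move=> d; exact: real_coord_le.
- move=> d v vP; have vE : v = z + (v - z) by rewrite addrC subrK.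
  rewrite {1}vE; apply: increment_le.
  + by have [] := sm [:: d].
  + by move=> k; rewrite !mxE; exact: vP.
  + by move=> d' u; exact: rM.
Qed.

Lemma nrm_cgradB rho z w k (e : R) :
  (forall d, `|pderiv rho d w - pderiv rho d z| <= e) ->
  nrm (cgrad rho w k - cgrad rho z k) <= e.
Proof.
move=> h; have aux (a b a' b' : R) : `|a - a'| <= e -> `|b - b'| <= e ->
    nrm (2^-1 * (a +i* - b) - 2^-1 * (a' +i* - b')) <= e.
  move=> ha hb; rewrite -mulrBr nrmM nrmV nrm2.
  have := nrm_le_ReIm ((a +i* - b) - (a' +i* - b')).
  rewrite /= opprK -[`|- b + b'|]normrN opprD opprK; lra.
exact: aux (h (false, k)) (h (true, k)).
Qed.

Lemma nrm_cgrad_le rho z k (e : R) : (forall d, `|pderiv rho d z| <= e) ->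
  nrm (cgrad rho z k) <= e.
Proof.
move=> h; have aux (a b : R) : `|a| <= e -> `|b| <= e -> nrm (2^-1 * (a +i* - b)) <= e.
  move=> ha hb; rewrite nrmM nrmV nrm2.
  have := nrm_le_ReIm (a +i* - b); rewrite /= normrN; lra.
exact: aux (h (false, k)) (h (true, k)).
Qed.

Lemma pderiv_le_cgrad rho z b k : `|pderiv rho (b, k) z| <= 2 * nrm (cgrad rho z k).
Proof.
have aux (x y : R) : `|x| <= 2 * nrm (2^-1 * (x +i* - y)) /\ `|y| <= 2 * nrm (2^-1 * (x +i* - y)).
  rewrite nrmM nrmV nrm2.
  have := Re_le_nrm (x +i* - y); have := Im_le_nrm (x +i* - y).
  by rewrite [complex.Re _]/= [complex.Im _]/= normrN mulVKf//; split.
have [h1 h2] := aux (pderiv rho (false, k) z) (pderiv rho (true, k) z).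
by case: b; [exact: h2|exact: h1].
Qed.

Lemma nrm_lform_le (l : 'I_n -> R[i]) w (A s : R) : (forall k, nrm (l k) <= A) ->
  (forall k, nrm (w ord0 k) <= s) -> nrm (lform l w) <= n%:R * (A * s).
Proof.
move=> lA ws; rewrite (le_trans (nrm_sum _ _ _))//.
rewrite (@le_trans _ _ (\sum_(k < n) A * s))//; last by rewrite sumr_const card_ord mulr_natl.
by apply: ler_sum => k _; rewrite nrmM ler_pM ?nrm_ge0.
Qed.

Lemma nrm_quadratic_le (q : 'I_n -> 'I_n -> R[i]) w (A s : R) : 0 <= s ->
  (forall j k, nrm (q j k) <= A) -> (forall k, nrm (w ord0 k) <= s) ->
  nrm (\sum_(j < n) \sum_(k < n) q j k * w ord0 j * w ord0 k) <= (n * n)%:R * (A * s ^+ 2).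
Proof.
move=> s0 qA ws; rewrite (le_trans (nrm_sum _ _ _))//.
rewrite (@le_trans _ _ (\sum_(j < n) \sum_(k < n) A * s ^+ 2))//; last first.
  by rewrite !sumr_const !card_ord -mulrnA mulr_natl.
apply: ler_sum => j _; rewrite (le_trans (nrm_sum _ _ _))//; apply: ler_sum => k _.
by rewrite !nrmM expr2 mulrA !ler_pM ?mulr_ge0 ?nrm_ge0.
Qed.

Lemma F_fun_ge rho z w : `|rho z| + `|rho w| + sqnorm (z - w) <= F_fun rho z w.
Proof. by rewrite /F_fun [leRHS]addrAC lerDl. Qed.

(* Real part of the Taylor expansion at [z] and imaginary part of [X_fun]. *)
Lemma lform_cgrad_le_F rho z w (M s : R) : smooth rho -> 0 <= M -> 0 <= s ->
  s ^+ 2 <= sqnorm (z - w) -> (forall k, nrm ((w - z) ord0 k) <= s) ->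
  (forall v, polysquare z s v -> forall d d', `|pderiv (pderiv rho d) d' v| <= M) ->
  nrm (lform (cgrad rho w) (z - w)) <=
    (2 + (n * 2)%:R ^+ 2 * M + (n * n)%:R * (2 * M) + n%:R * ((n * 2)%:R * M)) * F_fun rho z w.
Proof.
move=> sm M0 s0 ss ws rM.
have wsup k : supn ((w - z) ord0 k) <= s by rewrite (le_trans (supn_le_nrm _)).
have := @second_order_le rho z (w - z) s M sm wsup (fun d d' v vP => rM v vP d d').
rewrite [z + _]addrC subrK => T2.
have zz : polysquare z s z by move=> k; rewrite subrr supn0.
have dB d : `|pderiv rho d w - pderiv rho d z| <= (n * 2)%:R * (s * M).
  have wE : w = z + (w - z) by rewrite addrC subrK.
  rewrite {1}wE; apply: increment_le => //.
    by have [] := sm [:: d].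
  by move=> d' v /rM.
(* [F_fun] sees the gradient at [z], the conclusion the gradient at [w]; the exchange costs
   [O(s ^+ 2)], again bounded by [F_fun]. *)
have LB : nrm (lform (cgrad rho w) (w - z) - lform (cgrad rho z) (w - z)) <=
    n%:R * ((n * 2)%:R * (s * M) * s).
  rewrite (_ : _ - _ = lform (fun k => cgrad rho w k - cgrad rho z k) (w - z)).
    by apply: nrm_lform_le => // k; exact: nrm_cgradB.
  by rewrite /lform -sumrB; apply: eq_bigr => k _; rewrite mulrBl.
have Q := @nrm_quadratic_le (fun j k => dz j (dz k (fun u => (rho u)%:C)) z) (w - z)
  (2 * M) s s0 (fun j k => nrm_dz_dz_le j k sm (rM z zz)) ws.
pose q := \sum_(j < n) \sum_(k < n) dz j (dz k (fun u => (rho u)%:C)) z *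
  (w - z) ord0 j * (w - z) ord0 k.
have XE : X_fun rho z w = - (rho z)%:C - lform (cgrad rho z) (w - z) - 2^-1 * q.
  rewrite /X_fun /q /lform; congr (_ - _ - _ * _).
    by apply: eq_bigr => k _; rewrite dz_real_valued !mxE.
  by apply: eq_bigr => j _; apply: eq_bigr => k _; rewrite !mxE.
have half : 2^-1 = (2^-1 : R)%:C by rewrite fmorphV/= rmorph_nat.
have ImX : complex.Im (X_fun rho z w) =
    - complex.Im (lform (cgrad rho z) (w - z)) - 2^-1 * complex.Im q.
  by rewrite XE half !(ImD, ImN, ImM)/=; ring.
have Fge := F_fun_ge rho z w.
have FX : `|complex.Im (X_fun rho z w)| <= F_fun rho z w.
  by rewrite /F_fun -addrA addrC -addrA lerDl addr_ge0 ?addr_ge0 ?sqnorm_ge0.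
have qIm := Im_le_nrm q; rewrite -/q in Q.
rewrite -nrmN -lformN opprB.
have N1 := nrmD (lform (cgrad rho w) (w - z) - lform (cgrad rho z) (w - z))
  (lform (cgrad rho z) (w - z)).
have N2 := nrm_le_ReIm (lform (cgrad rho z) (w - z)); rewrite subrK in N1.
rewrite ImX in FX.
have S0 := sqnorm_ge0 (z - w).
have F0 : 0 <= F_fun rho z w by rewrite (le_trans _ Fge)// !addr_ge0.
have ReL : 2 * `|complex.Re (lform (cgrad rho z) (w - z))| <=
    F_fun rho z w + (n * 2)%:R ^+ 2 * M * F_fun rho z w.
  have E : (n * 2)%:R * (s * ((n * 2)%:R * (s * M))) = (n * 2)%:R ^+ 2 * M * s ^+ 2.
    by ring.
  have sF : (n * 2)%:R ^+ 2 * M * s ^+ 2 <= (n * 2)%:R ^+ 2 * M * F_fun rho z w.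
    rewrite ler_wpM2l ?mulr_ge0 ?sqr_ge0// (le_trans ss)// (le_trans _ Fge)//.
    by rewrite lerDr addr_ge0.
  have E2 : 2 * `|complex.Re (lform (cgrad rho z) (w - z))| =
      `|2 * complex.Re (lform (cgrad rho z) (w - z))| by rewrite normrM ger0_norm.
  rewrite E in T2; move: T2 sF Fge S0.
  have := ler_norm (rho z); have := ler_norm (rho w).
  have := ler_norm (- rho z); have := ler_norm (- rho w); rewrite !normrN.
  rewrite E2; move: (2 * complex.Re _) => L.
  move: (F_fun rho z w) (_ * M * s ^+ 2) => F A.
  rewrite ler_norml => h1 h2 h3 h4 /andP[h5 h6] AF h7 h8.
  by rewrite ler_norml; apply/andP; split; lra.
have sF : s ^+ 2 <= F_fun rho z w.
  by rewrite (le_trans ss)// (le_trans _ Fge)// lerDr addr_ge0.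
have QF : nrm q <= (n * n)%:R * (2 * M) * F_fun rho z w.
  by rewrite (le_trans Q)// mulrA ler_wpM2l// !mulr_ge0.
have LF : nrm (lform (cgrad rho w) (w - z) - lform (cgrad rho z) (w - z)) <=
    n%:R * ((n * 2)%:R * M) * F_fun rho z w.
  rewrite (le_trans LB)// (_ : n%:R * _ = n%:R * ((n * 2)%:R * M) * s ^+ 2); last by ring.
  by rewrite ler_wpM2l// !mulr_ge0.
have ImL : `|complex.Im (lform (cgrad rho z) (w - z))| <= F_fun rho z w + nrm q.
  have : `|- complex.Im (lform (cgrad rho z) (w - z))| <=
      `|- complex.Im (lform (cgrad rho z) (w - z)) - 2^-1 * complex.Im q| +
      `|2^-1 * complex.Im q|.
    by rewrite -[in leLHS](subrK (2^-1 * complex.Im q)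
      (- complex.Im (lform (cgrad rho z) (w - z)))) ler_normD.
  rewrite normrN normrM (ger0_norm (_ : 0 <= 2^-1))//; move: FX qIm.
  have := nrm_ge0 q; lra.
have K0 : 0 <= (n * 2)%:R ^+ 2 * M * F_fun rho z w by rewrite !mulr_ge0 ?sqr_ge0.
rewrite !mulrDl; move: ReL ImL QF LF N1 N2 F0 K0.
move: (F_fun rho z w) (nrm q) => F Nq; lra.
Qed.

End Geometry.

Section DomainGeometry.
Context (R : realType) (n : nat).
Local Notation Cn := 'rV[R[i]]_n.
Implicit Types (z w v : Cn) (rho g : Cn -> R) (Omega : set Cn).

Lemma polysquare_trans z w v (r s : R) : polysquare z r w -> polysquare w s v ->
  polysquare z (r + s) v.
Proof.
move=> zw wv k; have := supnD (v ord0 k - w ord0 k) (w ord0 k - z ord0 k).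
by rewrite subrKA; have := zw k; have := wv k; lra.
Qed.

Lemma closure_polysquare Omega (B : R) : Omega `<=` polysquare 0 B ->
  closure Omega `<=` polysquare 0 B.
Proof.
move=> OB; rewrite [X in _ `<=` X](closure_id _).1; first exact: closure_subset.
exact: closed_polysquare.
Qed.

Lemma compact_closure_bounded Omega : bounded_set Omega -> compact (closure Omega).
Proof.
move=> /bounded_polysquare[B B0 OB].
apply: subclosed_compact (closure_polysquare OB).
  exact: closed_closure.
exact: compact_polysquare.
Qed.

(** On the compact closure this continuous function has no zero: a zero of [rho] in the closure lies
    outside [Omega], hence on the boundary, where the gradient is nonzero. *)
Lemma gradient_lower_bound Omega rho : bounded_domain Omega ->
  strongly_pseudoconvex Omega rho -> exists2 c, 0 < c &
  forall w, closure Omega w -> c <= `|rho w| + \sum_d `|pderiv rho d w|.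
Proof.
move=> [oO _ _ bO] [sm OE grad _].
have cf (l : seq (bool * 'I_n)) w :
    {for w, continuous (fun w : Cn => \sum_(d <- l) `|pderiv rho d w|)}.
  elim: l => [|d l IH].
    rewrite (_ : (fun _ => _) = cst 0); first exact: cst_continuous.
    by apply/funext => u; rewrite big_nil.
  rewrite (_ : (fun _ => _) = (fun w : Cn => `|pderiv rho d w| +
    \sum_(d <- l) `|pderiv rho d w|)); last by apply/funext => u; rewrite big_cons.
  by apply: cvgD IH; exact: (cvg_norm ((sm [:: d]).1 w)).
apply: compact_fun_ge; first exact: compact_closure_bounded.
  move=> w _; apply: cvgD (cf _ w); exact: (cvg_norm ((sm [::]).1 w)).
move=> w cOw.
have s0 : 0 <= \sum_d `|pderiv rho d w| by apply: sumr_ge0.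
rewrite lt_neqAle addr_ge0// andbT eq_sym paddr_eq0// normr_eq0.
apply/negP => /andP[/eqP rw0].
rewrite psumr_eq0// => /allP all0.
have z0 d : pderiv rho d w = 0.
  by apply/eqP; rewrite -normr_eq0; exact: (implyP (all0 d (mem_index_enum d))).
have bd : boundary Omega w.
  by split => // /interior_subset; rewrite OE/= rw0 ltxx.
move: (grad w bd) => /eqP; apply; apply/rowP => k; rewrite !mxE.
by case: splitP => j _; rewrite mxE; exact: z0.
Qed.

Lemma sqnorm_le_polysquare z (s : R) : 0 <= s -> (forall k, supn (z ord0 k) <= s) ->
  sqnorm z <= n%:R * (2 * s) ^+ 2.
Proof.
move=> s0 zs; rewrite (@le_trans _ _ (\sum_(k < n) (2 * s) ^+ 2))//.
  apply: ler_sum => k _; rewrite lerXn2r ?nnegrE ?nrm_ge0 ?mulr_ge0//.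
  by rewrite (le_trans (nrm_le_supn _))// ler_wpM2l.
by rewrite sumr_const card_ord [leRHS]mulr_natl.
Qed.

Lemma exists_max_index (f : 'I_n -> R) : (0 < n)%N -> exists j, forall k, f k <= f j.
Proof.
case: n f => [//|m] f _; exists [arg max_(j > ord0) f j]%O.
by move=> k; case: arg_maxP => // j _ h; exact: h.
Qed.

(* The anisotropic polydisc of radii comparable to [sqrt |rho w|] in the
   directions annihilated by [l] and to [|rho w|] transversally lies in [Omega]
   around [w], and [F_fun z w] controls the position of [z] in the same scale. *)
Lemma anisotropic_scale Omega rho : (0 < n)%N -> bounded_domain Omega ->
  strongly_pseudoconvex Omega rho ->
  exists c C : R, [/\ 0 < c, 0 < C & forall w, Omega w -> exists (l : 'I_n -> R[i]) j,
    [/\ c <= nrm (l j), nrm (l j) <= C, forall k, nrm (l k) <= nrm (l j),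
      forall v, (forall k, nrm (v ord0 k) <= c * Num.sqrt `|rho w|) ->
        nrm (lform l v) <= c * `|rho w| -> Omega (w + v) &
      forall z, Omega z -> (forall k, nrm ((z - w) ord0 k) <= C * Num.sqrt (F_fun rho z w)) /\
        nrm (lform l (z - w)) <= C * F_fun rho z w]].
Proof.
move=> n0 dO spc; have [c1 c10 c1P] := gradient_lower_bound dO spc.
have [oO _ _ bO] := dO; have [sm OE _ _] := spc.
have [B B0 OB] := bounded_polysquare bO.
have cO := compact_closure_bounded bO.
have [D D0 DP] : exists2 D, 0 < D & forall w, Omega w -> `|rho w| <= D.
  have [|D D0 DP] := @compact_fun_le R _ _ (fun w => `|rho w|) cO.
    by move=> w _; exact: (cvg_norm ((sm [::]).1 w)).
  by exists D => // w Ow; apply: DP; exact: subset_closure.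
(* Large enough for every auxiliary polysquare: those around [w] have radius at most 1, those around
   [z] at most [n%:R * (4 * B)], which bounds the Euclidean distance between points of [Omega]. *)
pose RB := B + (1 + n%:R * (4 * B)).
have [M M0 MP] := pderiv_bounds RB sm.
pose K : R := (n * 2)%:R; have K0 : 0 <= K by [].
have n1 : 1 <= n%:R :> R by rewrite ler1n.
pose m1 := Num.min 1 (c1 / 2).
have m10 : 0 < m1 by rewrite lt_min ltr01 divr_gt0.
have [m11 m1c] : m1 <= 1 /\ m1 <= c1 / 2 by rewrite /m1 !ge_min !lexx orbT.
have K2M : 0 <= K ^+ 2 * M by rewrite mulr_ge0 ?sqr_ge0// ltW.
have KM : 0 <= K * M by rewrite mulr_ge0// ltW.
(* In this order: the largest component of the gradient is at least [c]; [c * Num.sqrt del] is at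
   most 1; near the boundary the second-order error stays below [del]; far from it the first-order
   error does. *)
pose c := Num.min (Num.min (c1 / (8 * n%:R)) (1 + D)^-1)
  (Num.min (4 * (1 + K ^+ 2 * M))^-1 (m1 / (2 * (K * M + 1)))).
have D10 : 0 < 1 + D by lra.
have c0 : 0 < c by rewrite !lt_min !divr_gt0 ?invr_gt0 ?mulr_gt0//; lra.
have m1' (x y : R) : Num.min x y <= x by rewrite ge_min lexx.
have m2' (x y : R) : Num.min x y <= y by rewrite ge_min lexx orbT.
have cA : c <= c1 / (8 * n%:R) by rewrite /c (le_trans (m1' _ _)).
have cB : c <= (1 + D)^-1 by rewrite /c (le_trans (m1' _ _))// m2'.
have cC : c <= (4 * (1 + K ^+ 2 * M))^-1 by rewrite /c (le_trans (m2' _ _))// m1'.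
have cD : c <= m1 / (2 * (K * M + 1)) by rewrite /c (le_trans (m2' _ _))// m2'.
have c1le : c <= 1 by rewrite (le_trans cB)// invf_le1//; lra.
have {}cC : c * (4 * (1 + K ^+ 2 * M)) <= 1.
  by rewrite -ler_pdivlMr ?div1r// mulr_gt0//; lra.
have {}cB : c * (1 + D) <= 1 by rewrite -ler_pdivlMr ?div1r.
have {}cD : c * (2 * (K * M + 1)) <= m1 by rewrite -ler_pdivlMr// mulr_gt0//; lra.
pose C0 := 2 + K ^+ 2 * M + (n * n)%:R * (2 * M) + n%:R * (K * M).
pose C := C0 + M + 4 * B / m1 + 1.
have nn0 : 0 <= (n * n)%:R * (2 * M) by rewrite !mulr_ge0// ltW.
have nK0 : 0 <= n%:R * (K * M) by rewrite mulr_ge0.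
have C00 : 2 <= C0 by rewrite /C0; lra.
have Bm0 : 0 <= 4 * B / m1 by rewrite divr_ge0 ?mulr_ge0 ?ltW.
have C1 : 1 <= C by rewrite /C; lra.
have CC0 : C0 <= C by rewrite /C; lra.
have CM : M <= C by rewrite /C; lra.
have CB : 4 * B / m1 <= C by rewrite /C; lra.
exists c, C; split => // [|w Ow]; first by lra.
have sqrt_le (x : R) : 0 <= x -> Num.sqrt x <= 1 + x.
  move=> x0; rewrite -(@ler_pXn2r _ 2) ?nnegrE ?sqrtr_ge0 ?addr_ge0// sqr_sqrtr//; nra.
set del := `|rho w|; have del0 : 0 < del.
  by rewrite normr_gt0; move: Ow; rewrite OE/= => h; rewrite lt_eqF.
have rwE : rho w = - del.
  by rewrite /del ltr0_norm ?opprK//; move: Ow; rewrite OE.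
have delD : del <= D by exact: DP.
have ds0 : 0 <= Num.sqrt del by [].
have ds2 : Num.sqrt del ^+ 2 = del by rewrite sqr_sqrtr// ltW.
have cds1 : c * Num.sqrt del <= 1.
  rewrite (le_trans _ cB)// ler_wpM2l ?(ltW c0)// (le_trans (sqrt_le _ (ltW del0)))//; lra.
have nB0 : 0 <= n%:R * (4 * B) by rewrite !mulr_ge0// ltW.
have near_w v : polysquare w (c * Num.sqrt del) v -> polysquare 0 RB v.
  move=> wv; have := polysquare_trans (OB _ Ow) wv => h k; apply: le_trans (h k) _.
  by rewrite /RB lerD2l; lra.
have near_z z v s : Omega z -> s <= n%:R * (4 * B) -> polysquare z s v -> polysquare 0 RB v.
  move=> Oz sB zv; have := polysquare_trans (OB _ Oz) zv => h k; apply: le_trans (h k) _.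
  by rewrite /RB lerD2l; lra.
have zwB z : Omega z -> forall k, supn ((z - w) ord0 k) <= 2 * B.
  move=> Oz k; rewrite !mxE (le_trans (supnD _ _))// supnN.
  by have := OB _ Oz k; have := OB _ Ow k; rewrite !mxE !subr0; lra.
have F_ge_del z : del <= F_fun rho z w.
  by rewrite (le_trans _ (F_fun_ge _ _ _))// -addrA addrCA lerDl addr_ge0// sqnorm_ge0.
have supn_v v (s : R) : (forall k, nrm (v ord0 k) <= s) -> forall k, supn (v ord0 k) <= s.
  by move=> h k; rewrite (le_trans (supn_le_nrm _)).
(* At depth at least [c1 / 2] both scales are comparable to 1, and a coordinate serves as the linear
   form. Closer to the boundary the gradient carries at least half of [c1] and becomes the form. *)
have [far|near] := lerP (c1 / 2) del.
  have [j0 _] : exists j0 : 'I_n, True by exists (Ordinal n0).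
  exists (fun k => (k == j0)%:R), j0.
  have lE v : lform (fun k => (k == j0)%:R) v = v ord0 j0.
    rewrite /lform (bigD1 j0)//= eqxx mul1r big1 ?addr0// => k kj.
    by rewrite (negbTE kj) mul0r.
  have m1s : m1 <= Num.sqrt del.
    rewrite -(@ler_pXn2r _ 2) ?nnegrE ?(ltW m10)// ds2 expr2.
    by rewrite (le_trans _ far)// (le_trans _ m1c)// ler_piMl// ltW.
  split; rewrite ?eqxx ?nrm1//.
  - by move=> k; case: eqP => _; rewrite ?nrm1 ?nrm0.
  - move=> v vs _; rewrite OE/=.
    have := @increment_le R n rho w v (c * Num.sqrt del) M (proj1 (smooth_derivable (false, j0) sm))
      (supn_v _ _ vs) (fun d u uP => proj1 (MP u (near_w u uP)) d).
    rewrite ler_norml => /andP[_]; rewrite -/K rwE lerBlDr => h.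
    apply: le_lt_trans h _; rewrite subr_lt0 -[ltRHS]ds2 expr2.
    rewrite (_ : K * _ = (c * (K * M)) * Num.sqrt del); last by ring.
    rewrite ltr_pM2r ?sqrtr_gt0// (lt_le_trans _ m1s)// (lt_le_trans _ cD)//.
    by rewrite ltr_pM2l//; lra.
  - move=> z Oz; have Fd := F_ge_del z.
    have zw4 k : nrm ((z - w) ord0 k) <= 4 * B.
      by rewrite (le_trans (nrm_le_supn _))//; have := zwB z Oz k; lra.
    have four (x : R) : m1 <= x -> 4 * B <= C * x.
      move=> mx; rewrite (@le_trans _ _ (4 * B / m1 * x))//.
        by rewrite mulrAC ler_pdivlMr// ler_wpM2l// mulr_ge0// ltW.
      by rewrite ler_wpM2r// (le_trans (ltW m10)).
    split=> [k|]; last by rewrite lE (le_trans (zw4 _))// four// (le_trans m1c)// (le_trans far).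
    rewrite (le_trans (zw4 _))// four// (le_trans m1s)//.
    by rewrite ler_wsqrtr.
have n80 : 0 < 8 * n%:R :> R by lra.
have four (a b u x : R) : a <= 2 * u -> b <= 2 * u -> u <= x -> a + b <= 4 * x by lra.
have last_step (S u : R) : c1 <= del + S -> S <= n%:R * (4 * u) -> c1 <= u * (8 * n%:R).
  by lra.
have neg_step (x L X : R) : x - - del - 2 * L <= X -> L <= c * del ->
  2 * (c * del) + X < del -> x < 0 by lra.
have [j jmax] := exists_max_index (fun k => nrm (cgrad rho w k)) n0.
have wRB : polysquare 0 RB w by apply: near_w => k; rewrite subrr supn0 mulr_ge0// ltW.
exists (cgrad rho w), j; split => //.
- have := c1P w (subset_closure Ow); rewrite -/del => h.
  have sumle : \sum_d `|pderiv rho d w| <= n%:R * (4 * nrm (cgrad rho w j)).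
    rewrite -(pair_bigA _ (fun b k => `|pderiv rho (b, k) w|))/= big_bool -big_split/=.
    rewrite (@le_trans _ _ (\sum_(k < n) 4 * nrm (cgrad rho w j)))//; last first.
      by rewrite sumr_const card_ord [leRHS]mulr_natl.
    apply: ler_sum => k _.
    exact: four (pderiv_le_cgrad rho w true k) (pderiv_le_cgrad rho w false k) (jmax k).
  apply: le_trans cA _; rewrite ler_pdivrMr//.
  exact: last_step h sumle.
- by apply: le_trans CM; apply: nrm_cgrad_le; have [] := MP w wRB.
(* By the second-order expansion [rho (w + v)] is at most [- del + 2 * (c * del)] plus
   [K ^+ 2 * M * c ^+ 2 * del], which is negative by the choice of [c]. *)
- move=> v vs Lv; rewrite OE/=.
  have := @second_order_le R n rho w v (c * Num.sqrt del) M sm (supn_v _ _ vs)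
    (fun d d' u uP => proj2 (MP u (near_w u uP)) d d').
  rewrite ler_norml => /andP[_]; rewrite -/K rwE => h.
  have Re_L : complex.Re (lform (cgrad rho w) v) <= c * del.
    by rewrite (le_trans (ler_norm _))// (le_trans (Re_le_nrm _)).
  have E : K * (c * Num.sqrt del * (K * (c * Num.sqrt del * M))) =
      K ^+ 2 * M * c ^+ 2 * del by rewrite -[in RHS]ds2; move: (Num.sqrt del) => q; ring.
  have c2 : K ^+ 2 * M * c ^+ 2 <= K ^+ 2 * M * c by rewrite ler_wpM2l// expr2 ler_piMl// ltW.
  have c3 : 2 * c + K ^+ 2 * M * c ^+ 2 < 1.
    by move: c2 cC c0 K2M; move: (c ^+ 2) => cc; rewrite !mulrDr; nra.
  have {}c3 : 2 * (c * del) + K ^+ 2 * M * c ^+ 2 * del < del.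
    by rewrite mulrA -mulrDl gtr_pMl.
  by rewrite E in h; exact: neg_step h Re_L c3.
- move=> z Oz; pose s := Num.sqrt (sqnorm (z - w)).
  have s0 : 0 <= s by exact: sqrtr_ge0.
  have s2 : s ^+ 2 = sqnorm (z - w) by rewrite sqr_sqrtr// sqnorm_ge0.
  have sF : sqnorm (z - w) <= F_fun rho z w.
    by rewrite (le_trans _ (F_fun_ge _ _ _))// lerDr addr_ge0.
  have sB : s <= n%:R * (4 * B).
    rewrite -(@ler_pXn2r _ 2) ?nnegrE// s2.
    have B20 : 0 <= 2 * B by rewrite mulr_ge0// ltW.
    apply: le_trans (sqnorm_le_polysquare B20 (zwB z Oz)) _.
    rewrite (_ : (_ * (4 * B)) ^+ 2 = n%:R * (n%:R * (2 * (2 * B)) ^+ 2)); last by ring.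
    by rewrite ler_wpM2l// ler_peMl// sqr_ge0.
  split=> [k|].
    rewrite (le_trans (nrm_coord_le_sqrt _ _))// (@le_trans _ _ (Num.sqrt (F_fun rho z w)))//.
      by rewrite ler_wsqrtr.
    by rewrite ler_peMl.
  rewrite (le_trans (@lform_cgrad_le_F R n rho z w M s sm (ltW M0) s0 _ _ _))//.
  - by rewrite s2.
  - by move=> k; rewrite -opprB mxE nrmN; exact: nrm_coord_le_sqrt.
  - by move=> v zv; have [] := MP v (near_z z v s Oz sB zv).
  - by rewrite ler_wpM2r// (le_trans _ sF)// sqnorm_ge0.
Qed.

End DomainGeometry.

(** * Families of functions of one variable *)

Section FamilyDoubling.
Context (R : realType).
Implicit Types (g f : R[i] -> R[i]) (T z : R[i]).

(** A two-scale estimate: the coefficients of degree below [k] are bounded by Cauchy's estimates on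
    the small square, the remainder of order [k] by the bound [B] on the large one. As
    [2 * d / r >= 1], its [k]-th power dominates the lower ones. *)
Lemma taylor_growth g (r d R0 Mr B : R) k T : 0 < r -> r <= d -> d <= R0 / 2 ->
  (forall z, supn z <= R0 -> differentiable g z) ->
  (forall z, supn z <= R0 -> nrm (g z) <= B) ->
  (forall z, supn z <= r -> nrm (g z) <= Mr) ->
  supn T <= d ->
  nrm (g T) <= 4 * k%:R * (2 * d / r) ^+ k * Mr + 8 * B * (2 * d / R0) ^+ k.
Proof.
move=> r0 rd dR dg gB gM Td.
have R00 : 0 < R0 by lra.
have rR : r <= R0 by lra.
have Mr0 : 0 <= Mr by rewrite (le_trans (nrm_ge0 (g 0)))// gM// supn0 ltW.
have B0 : 0 <= B by rewrite (le_trans (nrm_ge0 (g 0)))// gB// supn0 ltW.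
have T2 : nrm T <= 2 * d by rewrite (le_trans (nrm_le_supn T))// ler_wpM2l.
have dr1 : 1 <= 2 * d / r by rewrite ler_pdivlMr//; lra.
have rem := taylor_remainder k R00 dg gB (le_trans Td dR).
have -> : g T = \sum_(j < k) taylor_coef g R0 j * T ^+ j +
    (g T - \sum_(j < k) taylor_coef g R0 j * T ^+ j) by rewrite addrC subrK.
rewrite (le_trans (nrmD _ _))// lerD//.
  rewrite (le_trans (nrm_sum _ _ _))//.
  rewrite (@le_trans _ _ (\sum_(j < k) 4 * Mr * (2 * d / r) ^+ k))//; last first.
    by rewrite sumr_const card_ord -[leLHS]mulr_natl le_eqVlt; apply/orP; left; apply/eqP; ring.
  apply: ler_sum => j _; rewrite nrmM nrmX.
  have cj := nrm_taylor_coef j r0 rR dg gM.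
  rewrite (@le_trans _ _ (4 * Mr / r ^+ j * (2 * d) ^+ j))//.
    by rewrite ler_pM ?nrm_ge0 ?exprn_ge0 ?nrm_ge0// lerXn2r ?nnegrE ?nrm_ge0//; lra.
  rewrite -mulrA [_^-1 * _]mulrC -expr_div_n ler_wpM2l ?mulr_ge0//.
  by apply: ler_weXn2l => //; exact: ltnW (ltn_ord j).
rewrite (le_trans rem)// ler_wpM2l ?mulr_ge0// lerXn2r ?nnegrE//.
- by rewrite divr_ge0 ?nrm_ge0// ltW.
- by rewrite divr_ge0 ?(ltW R00)//; lra.
- by rewrite ler_wpM2r// invr_ge0 ltW.
Qed.

Lemma exists_expr4_lt (e : R) : 0 < e -> exists k0, forall k, (k0 <= k)%N -> 4^-1 ^+ k < e.
Proof.
move=> e0; have : (fun n => (4^-1 : R) ^+ n) @ \oo --> 0.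
  by apply: cvg_expr; rewrite ger0_norm// invf_lt1// ltr1n.
move=> /cvgrPdist_lt/(_ _ e0)[k0 _ H]; exists k0 => k kk0.
by have := H k kk0; rewrite /= sub0r normrN ger0_norm// exprn_ge0.
Qed.

(* Two applications of [taylor_growth]: between the scales [r] and [R0 / 8] it
   bounds the family from below by a power of [r]; this lower bound absorbs the
   remainder term in the second application, between the scales [r] and [d]. *)
Lemma family_doubling (R0 B c0 : R) : 0 < R0 -> 0 < c0 ->
  exists K m, 0 < K /\ forall (I : Type) (g : I -> R[i] -> R[i]) (r d Mr : R),
    (forall i z, supn z <= R0 -> differentiable (g i) z) ->
    (forall i z, supn z <= R0 -> nrm (g i z) <= B) ->
    (exists i, exists2 z, supn z <= R0 / 8 & c0 <= nrm (g i z)) ->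
    0 < r -> r <= d -> d <= R0 / 8 ->
    (forall i z, supn z <= r -> nrm (g i z) <= Mr) ->
    forall i z, supn z <= d -> nrm (g i z) <= K * (d / r) ^+ m * Mr.
Proof.
move=> R00 c00; pose R1 := R0 / 8; have R10 : 0 < R1 by rewrite divr_gt0.
pose B' := `|B| + 1; have B'0 : 0 < B' by rewrite ltr_wpDl.
(* At [d = R1 = R0 / 8] the ratio [2 * d / R0] is [4^-1]; the order [k] makes the remainder
   [8 * B' * 4^-1 ^+ k] smaller than half of [c0]. *)
have [k1 k1P] := exists_expr4_lt (divr_gt0 c00 (mulr_gt0 (ltr0n R 16) B'0)).
pose k := k1.+1; have k0 : 0 < k%:R :> R by rewrite ltr0n.
pose c1 := c0 / (8 * k%:R * 2 ^+ k).
have c10 : 0 < c1 by rewrite divr_gt0 ?mulr_gt0 ?exprn_gt0.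
(* From this order on, the remainder on the square of half-side [d] is at most half of the lower
   bound [c1 * (d / R1) ^+ k] of the supremum there. *)
have [k2 k2P] := exists_expr4_lt (divr_gt0 c10 (mulr_gt0 (ltr0n R 16) B'0)).
pose m := (k + k2)%N; have m0 : 0 < m%:R :> R by rewrite ltr0n.
exists (8 * m%:R * 2 ^+ m), m; split; first by rewrite !mulr_gt0 ?exprn_gt0.
move=> I g r d Mr dg gB [i0 [z0 z0R gz0]] r0 rd dR1 gM i z zd.
have gB' j u : supn u <= R0 -> nrm (g j u) <= B'.
  by move=> /(gB j)/le_trans; apply; rewrite (le_trans (ler_norm B))// lerDl.
have d0 : 0 < d := lt_le_trans r0 rd.
have low (s M : R) : 0 < s -> s <= R1 -> (forall j u, supn u <= s -> nrm (g j u) <= M) ->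
    c1 * (s / R1) ^+ k <= M.
  move=> s0 sR1 gs.
  have R12 : R1 <= R0 / 2 by rewrite /R1; lra.
  have := taylor_growth k s0 sR1 R12 (dg i0) (gB' i0) (gs i0) z0R.
  rewrite (_ : 2 * R1 / R0 = 4^-1); last by rewrite /R1; field; rewrite gt_eqF.
  have := k1P k (leqnSn k1); rewrite ltr_pdivlMr ?mulr_gt0// => k4 h.
  have {h} : c0 / 2 <= 4 * k%:R * (2 * R1 / s) ^+ k * M.
    by move: h gz0 k4; move: (nrm _) (_ * M) (4^-1 ^+ k) => a b e; lra.
  rewrite -[2 * R1 / s]mulrA exprMn => h.
  have sX : 0 < (s / R1) ^+ k by rewrite exprn_gt0// divr_gt0.
  have q0 : 0 <= (s / R1) ^+ k / (4 * k%:R * 2 ^+ k).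
    by apply: divr_ge0; [exact: ltW|apply: mulr_ge0; [exact: mulr_ge0|exact: exprn_ge0]].
  have -> : M = 4 * k%:R * (2 ^+ k * (R1 / s) ^+ k) * M * ((s / R1) ^+ k / (4 * k%:R * 2 ^+ k)).
    have -> : (R1 / s) ^+ k = ((s / R1) ^+ k)^-1 by rewrite -exprVn invf_div.
    have p0 : (2 : R) ^+ k != 0 by rewrite expf_neq0.
    have kn := lt0r_neq0 k0; have sn := lt0r_neq0 sX.
    move: kn sn p0; move: ((s / R1) ^+ k) (k%:R : R) ((2 : R) ^+ k) => a b e ha hb he.
    by field; rewrite ha hb he.
  rewrite (_ : c1 * _ = c0 / 2 * ((s / R1) ^+ k / (4 * k%:R * 2 ^+ k))); last first.
    have p0 : (2 : R) ^+ k != 0 by rewrite expf_neq0.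
    have kn := lt0r_neq0 k0; rewrite /c1.
    move: kn p0; move: ((s / R1) ^+ k) (k%:R : R) ((2 : R) ^+ k) => a b e ha he.
    by field; rewrite ha he.
  exact: ler_wpM2r.
pose S := [set nrm (g p.1 p.2) | p in [set p : I * R[i] | supn p.2 <= d]].
have dR0 : d <= R0 by move: dR1; rewrite -/R1 /R1; lra.
have ubS : ubound S B' by move=> _ [[j u] /= ud <-]; apply: gB'; lra.
have hS : has_sup S by split; [exists (nrm (g i z)), (i, z)|exists B'].
have Md : forall j u, supn u <= d -> nrm (g j u) <= sup S.
  by move=> j u ud; apply: ub_le_sup; [exists B'|exists (j, u)].
have lowd := low d (sup S) d0 dR1 Md.
(* The remainder is absorbed: the supremum at scale [d] reappears on the right with the factor one
   half. *)
have rhs : sup S <= 4 * m%:R * (2 * d / r) ^+ m * Mr + sup S / 2.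
  apply: ge_sup; first by have [] := hS.
  move=> _ [[j u] /= ud <-].
  have dR2 : d <= R0 / 2 by move: dR1; rewrite -/R1 /R1; lra.
  rewrite (le_trans (taylor_growth m r0 rd dR2 (dg j) (gB' j) (gM j) ud))// lerD2l.
  rewrite (_ : 2 * d / R0 = (d / R1) * 4^-1); last by rewrite /R1; field; rewrite gt_eqF.
  rewrite exprMn.
  have dR : 0 <= d / R1 <= 1.
    by rewrite divr_ge0 ?(ltW d0) ?(ltW R10)//= ler_pdivrMr// mul1r.
  have dX : (d / R1) ^+ m <= (d / R1) ^+ k.
    by move/andP: dR => [h1 h2]; apply: ler_wiXn2l => //; rewrite leq_addr.
  have := k2P m (leq_addl k k2); rewrite ltr_pdivlMr ?mulr_gt0// => k4.
  have q0 : 0 <= (d / R1) ^+ k by move/andP: dR => [h1 _]; rewrite exprn_ge0.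
  have p4 : 0 <= (4^-1 : R) ^+ m by rewrite exprn_ge0.
  move: k4 dX q0 p4 lowd; move: ((d / R1) ^+ m) ((d / R1) ^+ k) (4^-1 ^+ m) (sup S) => a b e s.
  move=> k4 ab b0 e0 cbs.
  have h1 : 8 * B' * (a * e) <= 8 * B' * (b * e).
    by rewrite ler_wpM2l ?mulr_ge0 ?(ltW B'0)// ler_wpM2r.
  have h2 : b * (e * (16 * B')) <= b * c1 by rewrite ler_wpM2l// ltW.
  lra.
have := Md i z zd; move: rhs.
rewrite -[2 * d / r]mulrA exprMn.
by move: (2 ^+ m) ((d / r) ^+ m) => a b; lra.
Qed.

(** [Mr] is the supremum of the family at scale [r]. The product bound is applied to a member that
    attains at least half of it; doubling from [r] to [Th * r], a ratio independent of [r], supplies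
    the growth it assumes. *)
Lemma family_product_lower_bound (R0 B c0 : R) : 0 < R0 -> 0 < c0 ->
  exists K m Th c, [/\ 0 < K, 2 <= Th, 0 < c &
    forall (I : Type) (g : I -> R[i] -> R[i]) (r : R),
    (forall i z, supn z <= R0 -> differentiable (g i) z) ->
    (forall i z, supn z <= R0 -> nrm (g i z) <= B) ->
    (exists i, exists2 z, supn z <= R0 / 8 & c0 <= nrm (g i z)) ->
    0 < r -> Th * r <= R0 / 8 ->
    exists Mr i, [/\ 0 <= Mr,
      forall d j z, r <= d -> d <= R0 / 8 -> supn z <= d -> nrm (g j z) <= K * (d / r) ^+ m * Mr &
      forall f, (forall z, supn z <= r -> differentiable f z) ->
        exists2 z, supn z <= r & c * Mr * nrm (f 0) <= nrm (g i z * f z)]].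
Proof.
move=> R00 c00; have [K [m [K0 KP]]] := family_doubling B R00 c00.
have [Th [c [Th2 cc0 ThP]]] := @product_lower_bound R m K (ltW K0).
exists K, m, Th, c; split => // I g r dg gB low r0 ThR.
have rTh : r <= Th * r by nra.
have rR : r <= R0 by lra.
have [i0 [z0 z0R gz0]] := low.
pose S := [set nrm (g p.1 p.2) | p in [set p : I * R[i] | supn p.2 <= r]].
have S0 : S !=set0 by exists (nrm (g i0 0)), (i0, 0) => //=; rewrite supn0 ltW.
have ubS : ubound S B by move=> _ [[j u] /= ud <-]; apply: gB; lra.
have hS : has_sup S by split => //; exists B.
have Mub j u : supn u <= r -> nrm (g j u) <= sup S.
  by move=> ud; apply: ub_le_sup; [exists B|exists (j, u)].
have M0 : 0 <= sup S by rewrite (le_trans (nrm_ge0 (g i0 0)))// Mub// supn0 ltW.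
have growth d j z : r <= d -> d <= R0 / 8 -> supn z <= d ->
    nrm (g j z) <= K * (d / r) ^+ m * sup S.
  by move=> rd dR; apply: KP => //.
have [[i T] Tr half] : exists2 p : I * R[i], supn p.2 <= r & sup S <= 2 * nrm (g p.1 p.2).
  have [->|M1] := eqVneq (sup S) 0.
    exists (i0, 0) => /=; first by rewrite supn0 ltW.
    by apply: mulr_ge0 => //; exact: nrm_ge0.
  have Mp : 0 < sup S / 2 by rewrite divr_gt0// lt_def M1.
  have [_ [[i T] /= Tr <-]] := sup_adherent Mp hS.
  by exists (i, T) => //=; lra.
exists (sup S), i; split => // f df.
apply: (ThP r (sup S) (g i) f T) => //.
- by move=> z zT; apply: dg; lra.
- move=> z zT; have := growth (Th * r) i z rTh ThR zT.
  by rewrite mulfK// lt0r_neq0.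
Qed.

End FamilyDoubling.

(** * Identity theorem *)

Section IdentityTheorem.
Context (R : realType).

(** [taylor_growth] with [Mr = 0] leaves only the remainder [8 * B * 4^-1 ^+ k], for every [k]. *)
Lemma disc_zero_extension (g : R[i] -> R[i]) (r R0 : R) z : 0 < r -> 0 < R0 ->
  (forall z, supn z <= R0 -> differentiable g z) ->
  (forall z, supn z <= r -> g z = 0) -> supn z <= R0 / 8 -> g z = 0.
Proof.
move=> r0 R00 dg g0 zR; have [rR|Rr] := leP r (R0 / 8); last by apply: g0; lra.
have [B B0 gB] : exists2 B, 0 < B & forall z, supn (z - 0) <= R0 -> nrm (g z) <= B.
  apply: (@compact_fun_le R _ _ (fun z => nrm (g z)) (@compact_square R 0 R0)) => u.
  rewrite /= subr0 => uR; apply: continuous_nrm.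
  by apply: differentiable_continuous; exact: dg.
have gB' u : supn u <= R0 -> nrm (g u) <= B by rewrite -[u in X in X -> _]subr0; exact: gB.
have gM u : supn u <= r -> nrm (g u) <= 0 by move=> /g0 ->; rewrite nrm0.
apply/eqP; rewrite -nrm_eq0 eq_le nrm_ge0 andbT.
apply/ler_addgt0Pr => e e0; rewrite add0r.
have [k kP] := exists_expr4_lt (divr_gt0 e0 (mulr_gt0 (ltr0n R 8) B0)).
have R2 : R0 / 8 <= R0 / 2 by lra.
have := taylor_growth k r0 rR R2 dg gB' gM zR.
rewrite mulr0 add0r (_ : 2 * (R0 / 8) / R0 = 4^-1); last by field; rewrite lt0r_neq0.
move=> /le_trans; apply; have := kP k (leqnn k).
by rewrite ltr_pdivlMr ?mulr_gt0// mulrC => /ltW.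
Qed.

Lemma supnM (x y : R[i]) : supn (x * y) <= 4 * supn x * supn y.
Proof.
rewrite (le_trans (supn_le_nrm _))// nrmM.
have := nrm_le_supn x; have := nrm_le_supn y; have := nrm_ge0 x; have := nrm_ge0 y.
by have := supn_ge0 x; have := supn_ge0 y; nra.
Qed.

Context (n : nat).
Local Notation Cn := 'rV[R[i]]_n.
Implicit Types (p q u z w : Cn) (Omega U : set Cn) (h : Cn -> R[i]).

(** [q] and [u] are joined by the complex line [F], which stays in the large polysquare for
    [supn T <= 8]; the one-variable lemma reaches [T = 8 / 8 = 1], where [F 1 = u]. What matters is
    that [s / 80] is independent of [e]. *)
Lemma polysquare_zero_extension h p q (s e : R) : 0 < s -> 0 < e ->
  (forall z, polysquare p s z -> differentiable h z) ->
  polysquare p (s / 80) q -> (forall z, polysquare q e z -> h z = 0) ->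
  forall u, polysquare p (s / 80) u -> h u = 0.
Proof.
move=> s0 e0 dh pq hq u pu.
have uq k : supn ((u - q) ord0 k) <= s / 40.
  rewrite mxE mxE -(subrKA (p ord0 k)) (le_trans (supnD _ _))//.
  rewrite -[supn (p ord0 k - _)]supnN opprB.
  by have := pq k; have := pu k; lra.
pose F (T : R[i]) := q + T *: (u - q).
have FT T k : supn (F T ord0 k - q ord0 k) <= supn T * (s / 10).
  rewrite mxE addrC addKr mxE (le_trans (supnM _ _))//.
  by have := uq k; have := supn_ge0 T; nra.
have -> : u = F 1 by rewrite /F scale1r addrC subrK.
pose r := Num.min 8 (10 * e / s).
apply: (@disc_zero_extension (fun T => h (F T)) r 8) => //.
- by rewrite lt_min; apply/andP; split => //; rewrite divr_gt0 ?mulr_gt0.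
- move=> T T8; apply: (@differentiable_comp_line _ _ h F q (u - q)) => //.
  apply: dh => k; rewrite -(subrKA (q ord0 k)) (le_trans (supnD _ _))//.
  by have := FT T k; have := pq k; have := ler_wpM2r (ltW s0) T8; lra.
- move=> T; rewrite le_min => /andP[_ Tr]; apply: hq => k.
  rewrite (le_trans (FT T k))//; move: Tr; rewrite ler_pdivlMr//; lra.
- rewrite (le_trans (supn_le_nrm _))// nrm1; lra.
Qed.

(** The interior of the zero set is closed in [Omega]: near a limit point [z],
    [polysquare_zero_extension] spreads the zeros from a point [q] of that interior over a
    polysquare around [z] whose size is independent of [q]. Connectedness concludes. *)
Lemma identity_theorem Omega h z0 : open Omega -> connected Omega ->
  holomorphic_on Omega h -> Omega z0 -> h z0 != 0 ->
  forall p, Omega p -> ~ nbhs p [set z | h z = 0].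
Proof.
move=> oO cO hh Oz0 hz0 p Op np.
have oI := @open_interior _ [set z | h z = 0].
suff OI : Omega `&` [set z | h z = 0]° = Omega.
  have [_ /nbhs_singleton/= /eqP] : (Omega `&` [set z | h z = 0]°) z0 by rewrite OI.
  by rewrite (negbTE hz0).
apply: cO; first by exists p.
  by exists [set z | h z = 0]°.
exists (closure [set z | h z = 0]°); first exact: closed_closure.
apply/seteqP; split => [z [Oz Iz]|z [Oz Iz]]; split; [exact: Oz|exact: subset_closure|exact: Oz|].
have /nbhs_polysquareP[s s0 sO] : nbhs z Omega by apply: open_nbhs_nbhs; split.
have zn : nbhs z (polysquare z (s / 80)).
  by apply/nbhs_polysquareP; exists (s / 80) => //; rewrite divr_gt0.
have [q [Iq zq]] := Iz _ zn.
have /nbhs_polysquareP[e e0 eq0] := Iq.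
apply/nbhs_polysquareP; exists (s / 80); first by rewrite divr_gt0.
apply: (@polysquare_zero_extension h z q s e s0 e0 _ zq eq0).
by move=> u /sO; exact: hh.
Qed.

Lemma uniform_neighborhood U h K : open U -> compact K -> K `<=` U ->
  holomorphic_on U h -> exists eta B : R, [/\ 0 < eta, eta <= 1, 0 < B &
    forall w v, K w -> polysquare w eta v -> U v /\ nrm (h v) <= B].
Proof.
move=> oU cK KU hU.
(* One parameter is both the radius and the inverse of the bound, so that a single compactness
   argument in [eta] tending to 0 is enough. *)
pose P (eta : R) w := forall v, polysquare w eta v -> U v /\ nrm (h v) <= eta^-1.
have : \forall eta \near 0^'+, K `<=` P eta.
  apply: (compact_near_coveringP _).1 => // x Kx.
  have nP : nbhs x [set v | U v /\ nrm (h v) < nrm (h x) + 1].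
    apply: filterI; first by apply: open_nbhs_nbhs; split => //; exact: KU.
    have ch : {for x, continuous (fun v => nrm (h v))}.
      by apply: continuous_nrm; apply: differentiable_continuous; exact/hU/KU.
    by apply: (cvgr_lt _ ch); rewrite ltrDl.
  have /nbhs_polysquareP[e e0 eP] := nP.
  have m0 : 0 < nrm (h x) + 1 by rewrite ltr_wpDl ?nrm_ge0.
  exists (polysquare x (e / 2), [set t | 0 < t /\ t < Num.min (e / 2) (nrm (h x) + 1)^-1]).
    split; first by apply/nbhs_polysquareP; exists (e / 2) => //; rewrite divr_gt0.
    near=> t; split; first by near: t; exact: nbhs_right_gt.
    near: t; apply: nbhs_right_lt.
    by rewrite lt_min; apply/andP; split; rewrite ?divr_gt0 ?invr_gt0.
  move=> [w t] [/= xw [t0]]; rewrite lt_min => /andP[te tm] v wv.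
  have [|Uv hv] := eP v.
    by move=> k; have := polysquare_trans xw wv k; lra.
  split => //; rewrite (le_trans (ltW hv))// -[leLHS]invrK lef_pV2 ?posrE ?invr_gt0//.
  exact: ltW.
move=> /(filterI (filterI (nbhs_right_gt 0) (nbhs_right_lt ltr01)))/filter_ex[eta [[/= e0 e1] H]].
by exists eta, eta^-1; split; rewrite ?invr_gt0// ?ltW// => w v Kw; exact: H.
Unshelve. all: by end_near. Qed.

(** As [h] may have zeros, a uniform lower bound can be asked near [w] but not at it; a witness [q]
    found close to one point of [K] serves all neighbouring ones. *)
Lemma uniform_nonvanishing h K (eta : R) : compact K -> 0 < eta ->
  (forall p e, K p -> 0 < e -> exists2 q, polysquare p e q & h q != 0) ->
  exists2 c : R, 0 < c & forall w, K w -> exists2 q, polysquare w eta q & c <= nrm (h q).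
Proof.
move=> cK eta0 nz.
pose P (c : R) w := exists2 q, polysquare w eta q & c <= nrm (h q).
have : \forall c \near 0^'+, K `<=` P c.
  apply: (compact_near_coveringP _).1 => // x Kx.
  have eta2 : 0 < eta / 2 by rewrite divr_gt0.
  have [q xq hq] := nz x _ Kx eta2.
  exists (polysquare x (eta / 2), [set t | t < nrm (h q)]).
    split; first by apply/nbhs_polysquareP; exists (eta / 2).
    by apply: nbhs_right_lt; rewrite nrm_gt0.
  move=> [w t] [/= xw tq]; exists q; last exact: ltW.
  by move=> k; have := supnD (q ord0 k - x ord0 k) (x ord0 k - w ord0 k);
    rewrite subrKA -[supn (x ord0 k - _)]supnN opprB; have := xq k; have := xw k; lra.
move=> /(filterI (nbhs_right_gt 0))/filter_ex[c [c0 H]].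
by exists c.
Qed.

(** If [h] vanished on a polysquare around a point of the closure, it would vanish on an open part
    of [Omega], which [identity_theorem] excludes. *)
Lemma nonvanishing_closure Omega h z0 : open Omega -> connected Omega ->
  holomorphic_on Omega h -> Omega z0 -> h z0 != 0 ->
  forall p (e : R), closure Omega p -> 0 < e -> exists2 q, polysquare p e q & h q != 0.
Proof.
move=> oO cO hh Oz0 hz0 p e cp e0; apply: contrapT => ne.
have e2 : 0 < e / 2 by rewrite divr_gt0.
have pn : nbhs p (polysquare p (e / 2)) by apply/nbhs_polysquareP; exists (e / 2).
have [q [Oq pq]] := cp _ pn.
apply: (identity_theorem oO cO hh Oz0 hz0 Oq).
apply/nbhs_polysquareP; exists (e / 2) => // v qv /=.
apply/eqP; rewrite -[_ == _]negbK; apply/negP => hv; apply: ne; exists v => //.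
by move=> k; have := polysquare_trans pq qv k; lra.
Qed.

End IdentityTheorem.

(** * Kobayashi balls *)

Section KobayashiBall.
Context (R : realType) (n : nat).
Local Notation Cn := 'rV[R[i]]_n.
Implicit Types (w z u v : Cn) (Omega : set Cn).

Lemma derive1_line (c v : Cn) (t : R[i]) : derive1 (fun t : R[i] => c + t *: v) t = v.
Proof.
apply: cvg_lim; first exact: norm_hausdorff.
apply: cvg_near_cst; near=> h.
rewrite /= opprD addrACA subrr add0r -scalerBl addrK scalerA mulVf ?scale1r//.
by near: h; exact: nbhs_dnbhs_neq.
Unshelve. all: by end_near. Qed.

Lemma kobayashi_metric_ge0 Omega z v : (0 <= kobayashi_metric Omega z v)%E.
Proof. by apply: le_ereal_inf_tmp => _ [a [a0 _] <-]; rewrite lee_fin ltW. Qed.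

Lemma kobayashi_metric_le Omega z v (a : R) : 0 < a ->
  (forall t : R[i], nrm t < 1 -> Omega (z + t *: ((a%:C)^-1 *: v))) ->
  (kobayashi_metric Omega z v <= a%:E)%E.
Proof.
move=> a0 H; apply: ereal_inf_lbound; exists a => //; split => //.
exists (fun t => z + t *: ((a%:C)^-1 *: v)); split.
- by move=> t _; exact: differentiable_line.
- by move=> t; rewrite /unit_disc/= normCE -[1]/((1 : R)%:C) ltcR; exact: H.
- by rewrite scale0r addr0.
- exact: derive1_line.
Qed.

(* The curve runs along the segment from [w + u] to [w], and each of its points
   is the centre of an affine disc of [Omega] in the direction [u]. *)
Lemma kobayashi_ball_line Omega w u :
  (forall c : R[i], nrm c < 3 -> Omega (w + c *: u)) -> kobayashi_ball Omega w 1 (w + u).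
Proof.
move=> H; split; first by rewrite -[u]scale1r; apply: H; rewrite nrm1 ltr1n.
pose gamma (t : R) : Cn := w + (1 - t)%:C *: u.
(* Points of the segment are [w + c *: u] with [0 <= c <= 1], and the disc of coefficient radius 2
   around each of them stays within [nrm c < 3]. Hence the metric is at most [2^-1] along the curve,
   and so is the length. *)
apply: (@le_lt_trans _ _ (2^-1)%:E); last by rewrite lte_fin invf_lt1// ltr1n.
apply: (@le_trans _ _ (\int[lebesgue_measure]_(t in `[0%R, 1%R])
    kobayashi_metric Omega (gamma t) (- u))%E).
  apply: ereal_inf_lbound; exists gamma, (fun=> - u); split => //; split.
  - move=> t; rewrite in_itv/= => /andP[t0 t1]; apply: H.
    by rewrite nrm_real ger0_norm; lra.
  - by rewrite /gamma subr0 scale1r.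
  - by rewrite /gamma subrr scale0r addr0.
  - move=> t _; apply: cvg_near_cst; rewrite near_withinE; near=> s => _.
    rewrite /gamma opprD addrACA subrr add0r -scalerBl -rmorphB/=.
    rewrite (_ : 1 - s - (1 - t) = - (s - t)); last by ring.
    rewrite rmorphN/= scaleNr scalerN scalerA mulVf ?scale1r//.
    rewrite (inj_eq (@complexI R) _ 0) subr_eq0.
    by near: s; exact: nbhs_dnbhs_neq.
  - by apply: continuous_subspaceT => t; exact: cst_continuous.
apply: (@le_trans _ _ (\int[lebesgue_measure]_(t in `[0%R, 1%R]) (2^-1)%:E)%E); last first.
  by rewrite integral_cst//= lebesgue_measure_itv/= lte_fin ltr01 oppr0 adde0 mule1.
apply: ge0_le_integral_patch.
- by move=> t _; exact: kobayashi_metric_ge0.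
- by move=> t _; rewrite lee_fin.
move=> t; rewrite /= in_itv/= => /andP[t0 t1]; split; first exact/andP.
apply: kobayashi_metric_le; first by rewrite invr_gt0.
move=> tau tau1; rewrite /gamma -addrA scalerA scalerN -scaleNr -scalerDl; apply: H.
rewrite (le_lt_trans (nrmD _ _))// nrmN nrmM nrm_real nrmV nrm_real ger0_norm; last lra.
rewrite ger0_norm ?invr_ge0// invrK; lra.
Unshelve. all: by end_near. Qed.

End KobayashiBall.

(** * Parabolas through an interior point *)

Section Curves.
Context (R : realType) (n : nat).
Local Notation Cn := 'rV[R[i]]_n.
Implicit Types (w x q b v : Cn) (a T : R[i]).

(** The vector [nu] transversal to the kernel of [l], normalised so that [l] takes the value 1 on it
    ([lform_dual_dir]). *)
Definition dual_dir (l : 'I_n -> R[i]) (j : 'I_n) : Cn := (l j)^-1 *: delta_mx ord0 j.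

Definition curve w (l : 'I_n -> R[i]) j (p : Cn * R[i]) T : Cn :=
  w + (T *: p.1 + (T * (T * p.2)) *: dual_dir l j).

Definition admissible (l : 'I_n -> R[i]) (p : Cn * R[i]) :=
  [/\ forall k, nrm (p.1 ord0 k) <= 1, lform l p.1 = 0 & nrm p.2 <= 1].

Context (w : Cn) (l : 'I_n -> R[i]) (j : 'I_n) (c : R).
Context (c_gt0 : 0 < c) (c_le : c <= nrm (l j)).

Let lj_neq0 : l j != 0.
Proof. by rewrite -nrm_gt0 (lt_le_trans c_gt0). Qed.

Lemma lform_dual_dir : lform l (dual_dir l j) = 1.
Proof.
rewrite /lform (bigD1 j)//= big1 ?addr0 => [|k kj]; rewrite !mxE eqxx/=.
  by rewrite eqxx mulr1 mulfV.
by rewrite (negbTE kj) mulr0 mulr0.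
Qed.

Lemma nrm_dual_dir k : nrm (dual_dir l j ord0 k) <= c^-1.
Proof.
rewrite !mxE eqxx/=; case: eqP => _; last by rewrite mulr0 nrm0 invr_ge0 ltW.
by rewrite mulr1 nrmV lef_pV2// posrE ?nrm_gt0.
Qed.

Lemma curve0 p : curve w l j p 0 = w.
Proof. by rewrite /curve !mul0r !scale0r !addr0. Qed.

Lemma curve_coord p T k : admissible l p ->
  nrm ((curve w l j p T - w) ord0 k) <= nrm T + nrm T ^+ 2 / c.
Proof.
case: p => b a [/= b1 _ a1]; rewrite /curve addrC addKr 3!mxE.
rewrite (le_trans (nrmD _ _))// !nrmM lerD//.
  by rewrite ler_piMr// nrm_ge0.
apply: ler_pM; rewrite ?mulr_ge0 ?nrm_ge0//; last exact: nrm_dual_dir.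
by rewrite expr2; apply: ler_wpM2l; rewrite ?ler_piMr ?nrm_ge0.
Qed.

Lemma curve_lform p T : admissible l p ->
  nrm (lform l (curve w l j p T - w)) <= nrm T ^+ 2.
Proof.
case: p => b a [/= _ lb a1]; rewrite /curve addrC addKr lformD lformZ lb lformZ lform_dual_dir.
rewrite mulr0 add0r mulr1 !nrmM expr2.
by apply: ler_wpM2l; rewrite ?ler_piMr ?nrm_ge0.
Qed.

(** The parabola is solved for at the real parameter [t]: [b] is the tangential part of [x - w]
    divided by [t], and [a] is [lform l (x - w)] divided by [t ^+ 2]. The hypotheses make both of
    size at most 1. *)
Lemma curve_reach x (t : R) : 0 < t ->
  (forall k, nrm ((x - w) ord0 k) + nrm (lform l (x - w)) / c <= t) ->
  nrm (lform l (x - w)) <= t ^+ 2 ->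
  exists2 p, admissible l p & curve w l j p t%:C = x.
Proof.
move=> t0 hk hl.
have tn : t%:C != 0 by rewrite (inj_eq (@complexI R) _ 0) lt0r_neq0.
exists (t%:C^-1 *: ((x - w) - lform l (x - w) *: dual_dir l j), lform l (x - w) / t%:C ^+ 2).
  split => [k||]/=.
  - have -> (s u : R[i]) (v v' : Cn) : (s *: (v - u *: v')) ord0 k = s * (v ord0 k - u * v' ord0 k).
      by rewrite !mxE.
    rewrite nrmM nrmV nrm_real.
    rewrite (ger0_norm (ltW t0)) mulrC ler_pdivrMr// mul1r (le_trans (nrmD _ _))//.
    rewrite nrmN nrmM (le_trans _ (hk k))// lerD2l ler_wpM2l ?nrm_ge0//.
    exact: nrm_dual_dir.
  - by rewrite lformZ lformD lformN lformZ lform_dual_dir mulr1 subrr mulr0.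
  - rewrite nrmM nrmV nrmX nrm_real (ger0_norm (ltW t0)) ler_pdivrMr ?exprn_gt0//.
    by rewrite mul1r.
rewrite /curve/= scalerA mulfV// scale1r.
rewrite (_ : t%:C * (t%:C * (lform l (x - w) / t%:C ^+ 2)) = lform l (x - w)).
  by rewrite subrK addrC subrK.
by field.
Qed.

Lemma differentiable_curve p T : differentiable (curve w l j p) T.
Proof.
apply: (@differentiableD _ _ _ (fun=> w)
  (fun T => T *: p.1 + (T * (T * p.2)) *: dual_dir l j)); first exact: differentiable_cst.
apply: (@differentiableD _ _ _ (fun T : R[i] => T *: p.1)
  (fun T : R[i] => (T * (T * p.2)) *: dual_dir l j)).
  by apply: (@differentiableZl _ _ _ id).
apply: (@differentiableZl _ _ _ (fun T : R[i] => T * (T * p.2))).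
apply: (@differentiableM _ _ id (fun T : R[i] => T * p.2)); first by [].
apply: (@differentiableM _ _ id (fun T : R[i] => p.2)); first by [].
exact: differentiable_cst.
Qed.

Context (l_le : forall k, nrm (l k) <= nrm (l j)).

Lemma shear_lform q x (r s : R) : shear q r s (fun k => l k / l j) j x ->
  nrm (lform l (x - q)) <= nrm (l j) * (2 * s).
Proof.
move=> [_ xs]; rewrite (_ : lform l (x - q) =
    l j * \sum_k l k / l j * (x ord0 k - q ord0 k)).
  by rewrite nrmM ler_wpM2l ?nrm_ge0// (le_trans (nrm_le_supn _))// ler_wpM2l.
rewrite /lform mulr_sumr; apply: eq_bigr => k _; rewrite !mxE.
by rewrite mulrA mulrCA mulfV// mulr1.
Qed.

(** The coordinate [j] is recovered from the linear form by subtracting the others, whose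
    coefficients [l k / l j] have modulus at most 1 by maximality of [l j]. *)
Lemma shear_coord q x (r s : R) k : 0 <= r -> 0 <= s ->
  shear q r s (fun k => l k / l j) j x ->
  nrm ((x - q) ord0 k) <= 2 * s + n%:R * (2 * r).
Proof.
move=> r0 s0 [xr xs].
have xr' i : i != j -> nrm (x ord0 i - q ord0 i) <= 2 * r.
  by move=> /xr ir; rewrite (le_trans (nrm_le_supn _))// ler_wpM2l.
have n1 : 1 <= n%:R :> R by rewrite ler1n (leq_ltn_trans _ (ltn_ord j)).
have [kj|kj] := eqVneq k j; last first.
  by rewrite !mxE (le_trans (xr' _ kj))//; move: (n%:R : R) n1 => N n1; nra.
rewrite {k}kj !mxE.
have -> : x ord0 j - q ord0 j = (\sum_k l k / l j * (x ord0 k - q ord0 k)) -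
    \sum_(k | k != j) l k / l j * (x ord0 k - q ord0 k).
  by rewrite [\sum_k _](bigD1 j)//= addrK mulfV// mul1r.
rewrite (le_trans (nrmD _ _))// nrmN lerD//.
  by rewrite (le_trans (nrm_le_supn _))// ler_wpM2l.
rewrite (le_trans (nrm_sum _ _ _))// (@le_trans _ _ (\sum_(k | k != j) 2 * r))//.
  apply: ler_sum => k kj; rewrite nrmM (le_trans _ (xr' _ kj))// ler_piMl ?nrm_ge0//.
  by rewrite nrmM nrmV ler_pdivrMr ?mul1r// nrm_gt0.
rewrite (@le_trans _ _ (\sum_(k < n) 2 * r))//.
  by rewrite [leRHS](bigID (fun k => k != j))/= lerDl sumr_ge0// => k _; rewrite mulr_ge0.
by rewrite sumr_const card_ord [leRHS]mulr_natl.
Qed.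

End Curves.

(** * Choice of scales and the mean value estimate at one point [w] *)

Section MainEstimate.
Context (R : realType).

Lemma exists_small (As : seq R) : exists2 e : R, 0 < e & all (fun A => e * A <= 1) As.
Proof.
elim: As => [|A As [e e0 eA]]; first by exists 1.
have d0 : 0 < 1 + `|A| by rewrite ltr_wpDr.
have m0 : 0 < Num.min e (1 + `|A|)^-1 by rewrite lt_min e0 invr_gt0.
exists (Num.min e (1 + `|A|)^-1) => //=; apply/andP; split.
  rewrite (@le_trans _ _ (Num.min e (1 + `|A|)^-1 * (1 + `|A|)))//.
    by apply: ler_wpM2l; [exact: ltW|rewrite (le_trans (ler_norm A))// lerDr].
  by rewrite -ler_pdivlMr// mul1r ge_min lexx orbT.
apply/allP => B BA; have eB := allP eA _ BA.
have [B0|B0] := leP B 0; first by rewrite (@le_trans _ _ 0)// mulr_ge0_le0// ltW.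
by rewrite (le_trans _ eB)// ler_wpM2r ?ge_min ?lexx// ltW.
Qed.

(* Since [F >= delta], the power [(F / delta) ^+ (m / 2)] is majorised by an
   integral power. *)
Lemma final_coefficient (n m : nat) (K C1 c e s sF : R) :
  0 < K -> 0 < C1 -> 0 < c -> 0 < e -> 0 < s -> s <= sF ->
  K * (C1 * sF / (e * s)) ^+ m / (c * (((e * s) ^+ 2) ^+ n * (e * s ^+ 2) ^+ 2)) <=
  K * (C1 / e) ^+ m / (c * (e ^+ 2) ^+ n.+1) *
    ((sF ^+ 2) ^+ m.+1 / (s ^+ 2) ^+ (m.+1 + n.+2)).
Proof.
move=> K0 C10 c0 e0 s0 sF0.
have y1 : 1 <= sF / s by rewrite ler_pdivlMr// mul1r.
(* An even power is needed, because [sF] and [s] are square roots; raising the exponent is allowed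
   since [sF / s >= 1]. *)
have yX : (sF / s) ^+ m <= (sF / s) ^+ (2 * m.+1).
  by apply: ler_weXn2l => //; rewrite mul2n -addnn (leq_trans (leqnSn m))// leq_addr.
have -> : C1 * sF / (e * s) = C1 / e * (sF / s) by field; rewrite !lt0r_neq0.
have -> : c * (((e * s) ^+ 2) ^+ n * (e * s ^+ 2) ^+ 2) =
    c * (e ^+ 2) ^+ n.+1 * (s ^+ 2) ^+ n.+2 by rewrite !exprMn !exprS; ring.
have -> : (sF ^+ 2) ^+ m.+1 / (s ^+ 2) ^+ (m.+1 + n.+2) =
    (sF / s) ^+ (2 * m.+1) / (s ^+ 2) ^+ n.+2.
  rewrite exprM expr_div_n (expr_div_n _ _ m.+1) exprD invfM.
  by rewrite !mulrA.
rewrite exprMn invfM; set A := (C1 / e) ^+ m; set D := (c * _)^-1; set V := (_ ^+ n.+2)^-1.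
have A0 : 0 <= A by rewrite exprn_ge0// divr_ge0// ltW.
have D0 : 0 <= D by rewrite invr_ge0 mulr_ge0 ?exprn_ge0// ltW.
have V0 : 0 <= V by rewrite invr_ge0 !exprn_ge0// ltW.
rewrite (_ : K * (A * _) * _ = K * A * D * ((sF / s) ^+ m * V)); last by rewrite /D /V; ring.
by rewrite ler_wpM2l ?ler_wpM2r// !mulr_ge0// ltW.
Qed.

Context (n : nat).
Local Notation Cn := 'rV[R[i]]_n.+1.
Implicit Types (w z u v q x : Cn) (Omega U : set Cn) (h f : Cn -> R[i]).

Section AtPoint.
Context (Omega : set Cn) (w : Cn) (l : 'I_n.+1 -> R[i]) (j : 'I_n.+1) (c C s : R).
Context (c_gt0 : 0 < c) (c_le : c <= nrm (l j)) (le_C : nrm (l j) <= C).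
Context (l_le : forall k, nrm (l k) <= nrm (l j)).
Context (s_gt0 : 0 < s).
Context (Omega_box : forall v, (forall k, nrm (v ord0 k) <= c * s) ->
  nrm (lform l v) <= c * s ^+ 2 -> Omega (w + v)).

(** A third of the box, because [kobayashi_ball_line] multiplies the displacement by coefficients of
    modulus up to 3. *)
Lemma kobayashi_ball_box x : (forall k, nrm ((x - w) ord0 k) <= c / 3 * s) ->
  nrm (lform l (x - w)) <= c / 3 * s ^+ 2 -> kobayashi_ball Omega w 1 x.
Proof.
move=> xk xl; have -> : x = w + (x - w) by rewrite addrC subrK.
apply: kobayashi_ball_line => t t3; apply: Omega_box => [k|].
  rewrite mxE nrmM (le_trans (ler_pM (nrm_ge0 t) (nrm_ge0 _) (ltW t3) (xk k)))//.
  by move: (s) => s'; lra.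
rewrite lformZ nrmM (le_trans (ler_pM (nrm_ge0 t) (nrm_ge0 _) (ltW t3) xl))//.
by move: (s ^+ 2) => s'; lra.
Qed.

Context (S e : R).
Context (s_le : s <= S) (e_gt0 : 0 < e) (e_le1 : e <= 1).
Context (e_small1 : e * (6 * (2 + 4 * S / c) / c) <= 1).
Context (e_small2 : e * (24 / c) <= 1).
Context (e_small3 : e * (6 * (4 * S + n.+1%:R * 4) / c) <= 1).
Context (e_small4 : e * (24 * C / c) <= 1).

(** [c / 6] is half of what [kobayashi_ball_box] allows; the other half is left for the sheared
    polydisc around the point of the curve. *)
Lemma curve_box p T : admissible l p -> supn T <= e * s ->
  (forall k, nrm ((curve w l j p T - w) ord0 k) <= c / 6 * s) /\
  nrm (lform l (curve w l j p T - w)) <= c / 6 * s ^+ 2.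
Proof.
move=> ap Ts; have T2 : nrm T <= 2 * (e * s).
  by rewrite (le_trans (nrm_le_supn _))// ler_wpM2l.
have es0 : 0 < e * s by rewrite mulr_gt0.
have TT : nrm T ^+ 2 <= 4 * e * (e * s ^+ 2).
  rewrite (@le_trans _ _ ((2 * (e * s)) ^+ 2))//.
    by rewrite lerXn2r ?nnegrE ?nrm_ge0 ?mulr_ge0// ltW.
  by rewrite le_eqVlt; apply/orP; left; apply/eqP; ring.
have TT' : nrm T ^+ 2 <= 4 * e * s ^+ 2.
  rewrite (le_trans TT)// ler_wpM2l ?mulr_ge0 ?(ltW e_gt0)// ler_piMl//.
  by rewrite exprn_ge0// ltW.
have e1 : e * (2 + 4 * S / c) <= c / 6.
  by move: e_small1; rewrite mulrA ler_pdivrMr// mul1r; lra.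
have e2 : 4 * e <= c / 6 by move: e_small2; rewrite mulrA ler_pdivrMr// mul1r; lra.
split => [k|].
  rewrite (le_trans (curve_coord _ c_gt0 c_le T k ap))//.
  rewrite (@le_trans _ _ (e * (2 + 4 * S / c) * s))//; last by rewrite ler_wpM2r// ltW.
  rewrite (_ : e * _ * s = 2 * (e * s) + 4 * e * (S * s) / c); last by ring.
  rewrite lerD// ler_wpM2r ?invr_ge0 ?(ltW c_gt0)// (le_trans TT')//.
  by rewrite ler_wpM2l ?mulr_ge0 ?(ltW e_gt0)// expr2 ler_wpM2r// ltW.
rewrite (le_trans (curve_lform _ c_gt0 c_le T ap))// (le_trans TT')//.
by rewrite ler_wpM2r// exprn_ge0// ltW.
Qed.

Lemma curve_Omega p T : admissible l p -> supn T <= e * s -> Omega (curve w l j p T).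
Proof.
move=> ap /(curve_box ap)[h1 h2].
have -> : curve w l j p T = w + (curve w l j p T - w) by rewrite addrC subrK.
have s2 : 0 < s ^+ 2 by rewrite exprn_gt0.
have c6 : c / 6 <= c by rewrite ler_pdivrMr// ler_peMr ?(ltW c_gt0)// ler1n.
by apply: Omega_box => [k|]; rewrite ?(le_trans (h1 k)) ?(le_trans h2)// ler_wpM2r// ltW.
Qed.

(** The radii [e * s] and [e * s ^+ 2] follow the anisotropic scale, [s] being the square root of
    [|rho w|] in the application. As the dimension is [n.+1], the volume factor is of order
    [(s ^+ 2) ^+ n.+2]. *)
Lemma mean_value_curve p T (G : Cn -> R[i]) : admissible l p -> supn T <= e * s ->
  holomorphic_on Omega G ->
  ((nrm (G (curve w l j p T)) * (((e * s) ^+ 2) ^+ n * (e * s ^+ 2) ^+ 2))%:E <=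
    (8 ^+ n.+1)%:E * \int[lebesgue_Cn]_(z in kobayashi_ball Omega w 1) (nrm (G z))%:E)%E.
Proof.
move=> ap Ts hG; have [h1 h2] := curve_box ap Ts; set q := curve w l j p T in h1 h2 *.
have s2 : 0 < s ^+ 2 by rewrite exprn_gt0.
have es0 : 0 < e * s by rewrite mulr_gt0.
have es2 : 0 < e * s ^+ 2 by rewrite mulr_gt0.
apply: (@mean_value_sheared_set R n (fun k => l k / l j) j) => //.
  by rewrite mulfV// -nrm_gt0 (lt_le_trans c_gt0).
move=> x xs.
suff xball : kobayashi_ball Omega w 1 x by split => //; apply: hG; case: xball.
have e3 : e * (4 * S + n.+1%:R * 4) <= c / 6.
  move: e_small3; rewrite mulrA ler_pdivrMr// mul1r.
  by move: (4 * S + _) => B; lra.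
have e4 : 4 * C * e <= c / 6 by move: e_small4; rewrite mulrA ler_pdivrMr// mul1r; lra.
have xq k : nrm ((x - q) ord0 k) <= c / 6 * s.
  have a0 : 0 <= 2 * (e * s) by rewrite mulr_ge0// ltW.
  have b0 : 0 <= 2 * (e * s ^+ 2) by rewrite mulr_ge0// ltW.
  apply: le_trans (shear_coord c_gt0 c_le l_le k a0 b0 xs) _.
  rewrite (@le_trans _ _ (e * (4 * S + n.+1%:R * 4) * s))//; last by rewrite ler_wpM2r// ltW.
  rewrite (_ : e * _ * s = 4 * e * (S * s) + n.+1%:R * (2 * (2 * (e * s)))); last by ring.
  rewrite lerD2r (_ : 2 * _ = 4 * e * s ^+ 2); last by ring.
  by rewrite ler_wpM2l ?mulr_ge0 ?(ltW e_gt0)// expr2 ler_wpM2r// ltW.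
have xl : nrm (lform l (x - q)) <= c / 6 * s ^+ 2.
  apply: le_trans (shear_lform c_gt0 c_le xs) _.
  rewrite (@le_trans _ _ (4 * C * e * s ^+ 2))//; last by rewrite ler_wpM2r// ltW.
  rewrite (_ : 4 * C * e * _ = C * (2 * (2 * (e * s ^+ 2)))); last by ring.
  by rewrite ler_wpM2r// !mulr_ge0// ltW.
have xw : x - w = (x - q) + (q - w) by rewrite addrA subrK.
apply: kobayashi_ball_box => [k|]; rewrite xw.
  by rewrite mxE (le_trans (nrmD _ _))//; have := xq k; have := h1 k; lra.
by rewrite lformD (le_trans (nrmD _ _))//; lra.
Qed.

End AtPoint.
End MainEstimate.

(** * Elimination of the scales and the final inequality *)

Section Conclusion.
Context (R : realType).

Lemma nrm_lform_bound n (l : 'I_n -> R[i]) (v : 'rV[R[i]]_n) (C t : R) : 0 <= C ->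
  (forall k, nrm (l k) <= C) -> (forall k, nrm (v ord0 k) <= t) ->
  nrm (lform l v) <= n%:R * C * t.
Proof.
move=> C0 lC vt; rewrite (le_trans (nrm_sum _ _ _))//.
rewrite (@le_trans _ _ (\sum_(k < n) C * t))//.
  by apply: ler_sum => k _; rewrite nrmM ler_pM ?nrm_ge0.
by rewrite sumr_const card_ord -[leLHS]mulr_natl mulrA.
Qed.

Lemma curve_near n (w : 'rV[R[i]]_n) (l : 'I_n -> R[i]) j (c eta : R) p T : 0 < c ->
  c <= nrm (l j) -> eta <= 1 -> admissible l p -> supn T <= eta / (2 + 4 / c) ->
  polysquare w eta (curve w l j p T).
Proof.
move=> c0 cl eta1 ap; have A1 : 2 <= 2 + 4 / c by rewrite lerDl divr_ge0// ltW.
have A0 : 0 < 2 + 4 / c by lra.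
rewrite ler_pdivlMr// => TA k.
have := curve_coord w c0 cl T k ap; rewrite !mxE => h.
rewrite (le_trans (supn_le_nrm _))// (le_trans h)// (le_trans _ TA)//.
have T2 := nrm_le_supn T; have T0 := supn_ge0 T.
have T1 : supn T <= 1 by nra.
rewrite mulrDr lerD//; first by rewrite mulrC.
rewrite mulrA ler_wpM2r// ?invr_ge0 ?(ltW c0)//.
rewrite (@le_trans _ _ ((2 * supn T) ^+ 2))//.
  by rewrite lerXn2r ?nnegrE ?nrm_ge0 ?mulr_ge0.
by rewrite exprMn; nra.
Qed.

(** Provides a radius around [w] within which every point is reached by a parabola at the fixed
    parameter [t]; a lower bound for [h] near [w] thus becomes one for the family. *)
Lemma exists_seed_radius (t c D : R) : 0 < t -> t <= 1 -> 0 < c -> 0 <= D ->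
  exists eta, [/\ 0 < eta, D * (2 * eta) <= t ^+ 2 & 2 * eta + D * (2 * eta) / c <= t].
Proof.
move=> t0 t1 c0 D0; have Dc : 0 <= D / c by rewrite divr_ge0// ltW.
have [e e0 /=] := exists_small [:: 2 * D / t ^+ 2; 2 * (1 + D / c) / t].
rewrite andbT !mulrA !ler_pdivrMr ?exprn_gt0// !mul1r => /andP[h1 h2].
by exists e; split => //; lra.
Qed.

(** For [d <= R1] doubling applies. Otherwise the right-hand side already exceeds [c0], and the
    crude bound [x <= Bh] suffices; the constant [Bh / c0 + 1] covers both ranges. *)
Lemma growth_two_ranges (K Bh c0 x d r R1 Mr : R) (m : nat) :
  0 < K -> 0 < Bh -> 0 < c0 -> 0 < r -> 0 < d -> 0 <= R1 -> 0 <= Mr -> x <= Bh ->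
  (d <= R1 -> x <= K * (d / r) ^+ m * Mr) -> c0 <= K * (R1 / r) ^+ m * Mr ->
  x <= (Bh / c0 + 1) * K * (d / r) ^+ m * Mr.
Proof.
move=> K0 Bh0 c00 r0 d0 R10 Mr0 xB xd low.
have dr : 0 <= (d / r) ^+ m by rewrite exprn_ge0// divr_ge0// ltW.
have Y0 : 0 <= K * (d / r) ^+ m * Mr by rewrite !mulr_ge0// ltW.
have B0 : 0 <= Bh / c0 by rewrite divr_ge0// ltW.
have -> : (Bh / c0 + 1) * K * (d / r) ^+ m * Mr =
    Bh / c0 * (K * (d / r) ^+ m * Mr) + K * (d / r) ^+ m * Mr by ring.
have [/xd {}xd|Rd] := leP d R1; first by rewrite (le_trans xd)// lerDr mulr_ge0.
have : c0 <= K * (d / r) ^+ m * Mr.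
  rewrite (le_trans low)// ler_wpM2r// ler_wpM2l ?(ltW K0)// lerXn2r ?nnegrE//.
  - by rewrite divr_ge0// ltW.
  - by rewrite divr_ge0// ltW.
  - by rewrite ler_wpM2r ?invr_ge0// ltW.
move=> cY; rewrite (le_trans xB)// (@le_trans _ _ (Bh / c0 * (K * (d / r) ^+ m * Mr)))//.
  by rewrite -[leLHS](divfK (lt0r_neq0 c00)) ler_wpM2l.
by rewrite lerDl.
Qed.

(** [d] is the parameter at which a parabola reaches [z]: this multiple of [Num.sqrt F] meets both
    conditions of [curve_reach], and [d <= R1 <= 1] ensures [F <= Num.sqrt F]. *)
Lemma sqrt_scale_bound (C c F R1 d : R) : 0 <= C -> 0 < c -> 0 <= F -> R1 <= 1 ->
  d = (1 + C + C / c) * Num.sqrt F -> d <= R1 ->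
  C * Num.sqrt F + C * F / c <= d /\ C * F <= d ^+ 2.
Proof.
move=> C0 c0 F0 R11 -> dR; have Cc : 0 <= C / c by rewrite divr_ge0// ltW.
have -> : C * F / c = C / c * F by ring.
move: (Num.sqrt F) (sqrtr_ge0 F) (sqr_sqrtr F0) dR => s s0 <-.
move: (C / c) Cc => k k0 dR; have Cks : 0 <= (C + k) * s by rewrite mulr_ge0// addr_ge0.
have s1 : s <= 1 by lra.
have ss : s ^+ 2 <= s by rewrite expr2 ler_piMr.
have kss : k * s ^+ 2 <= k * s by rewrite ler_wpM2l.
split; first lra.
rewrite exprMn ler_wpM2r ?exprn_ge0//.
by rewrite (@le_trans _ _ (1 + C + k))//; [lra|rewrite expr2 ler_peMl; lra].
Qed.

(** [Mr] links the bound of [hz] to that of [G] and is eliminated by multiplication, never by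
    division, as it may be 0. *)
Lemma final_inequality (hz fw Mr G X Q K K3 c B : R) (I : \bar R) :
  0 < X -> 0 < c -> 0 <= K -> 0 <= fw -> 0 <= B -> (0 <= I)%E ->
  hz <= K * Mr -> c * Mr * fw <= G -> ((G * X)%:E <= B%:E * I)%E ->
  K / (c * X) <= K3 * Q -> ((hz * fw)%:E <= (B * K3 * Q)%:E * I)%E.
Proof.
move=> X0 c0 K0 fw0 B0 I0 hzM MG GX KQ.
have cX : 0 < c * X by rewrite mulr_gt0.
have h1 : hz * fw <= K / (c * X) * (G * X).
  rewrite (@le_trans _ _ (K * Mr * fw))//; first by rewrite ler_wpM2r.
  rewrite (_ : K * Mr * fw = K / (c * X) * (c * Mr * fw * X)); last first.
    by field; rewrite !lt0r_neq0.
  rewrite ler_wpM2l ?divr_ge0 ?(ltW cX)// ler_wpM2r// ltW//.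
have KX : 0 <= K / (c * X) by rewrite divr_ge0// ltW.
rewrite (@le_trans _ _ ((K / (c * X) * (G * X))%:E))//.
rewrite EFinM (le_trans (lee_wpmul2l _ GX)) ?lee_fin// muleA -EFinM.
rewrite lee_wpmul2r// lee_fin -mulrA mulrC ler_wpM2l//.
Qed.

Lemma main_estimate (n : nat)
    (Omega : set 'rV[R[i]]_n.+1) (rho : 'rV[R[i]]_n.+1 -> R)
    (Omega_domain : bounded_domain Omega)
    (Omega_spc : strongly_pseudoconvex Omega rho)
    (U : set 'rV[R[i]]_n.+1) (h : 'rV[R[i]]_n.+1 -> R[i])
    (U_open : open U) (closure_Omega_U : closure Omega `<=` U)
    (h_holo : holomorphic_on U h) :
  exists N C : R, [/\ 0 < N, 0 < C &
    forall (w z : 'rV[R[i]]_n.+1) (f : 'rV[R[i]]_n.+1 -> R[i]),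
      Omega w -> Omega z -> holomorphic_on Omega f ->
      ((nrm (h z * f w))%:E <=
       (C * (F_fun rho z w `^ N / `|rho w| `^ (N + n.+1%:R + 1)))%:E *
       \int[lebesgue_Cn]_(l in kobayashi_ball Omega w 1) (nrm (h l * f l))%:E)%E].
Proof.
have int_ge0 w f : (0 <= \int[lebesgue_Cn]_(l in kobayashi_ball Omega w 1)
    (nrm (h l * f l))%:E)%E.
  by apply: integral_ge0 => x _; rewrite lee_fin nrm_ge0.
have [oO cO _ bO] := Omega_domain; have [sm OE _ _] := Omega_spc.
have cK := compact_closure_bounded bO.
have hO : holomorphic_on Omega h by move=> x /subset_closure/closure_Omega_U; exact: h_holo.
(* If [h] vanishes on [Omega], the left-hand side is 0 and any positive constants do. *)
have [[z0 Oz0 hz0]|none] := pselect (exists2 z0, Omega z0 & h z0 != 0); last first.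
  exists 1, 1; split => // w z f Ow Oz hf.
  have -> : h z = 0.
    by apply/eqP; rewrite -[_ == _]negbK; apply/negP => hz; apply: none; exists z.
  by rewrite mul0r nrm0 mule_ge0// lee_fin mulr_ge0 ?divr_ge0 ?powR_ge0.
have [c [C [c0 C0 scale]]] := anisotropic_scale (ltn0Sn n) Omega_domain Omega_spc.
have [eta [Bh [eta0 eta1 Bh0 hU]]] := uniform_neighborhood U_open cK closure_Omega_U h_holo.
have [D D0 DP] : exists2 D, 0 < D & forall w, closure Omega w -> `|rho w| <= D.
  apply: (@compact_fun_le R _ _ (fun w => `|rho w|) cK) => x _.
  exact: (cvg_norm ((sm [::]).1 x)).
(* For parameters up to [R0] all admissible parabolas stay within [eta] of [w], by [curve_near],
   hence in [U]. *)
pose R0 := eta / (2 + 4 / c).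
have A1 : 2 <= 2 + 4 / c by rewrite lerDl divr_ge0// ltW.
have A0 : 0 < 2 + 4 / c by lra.
have R00 : 0 < R0 by rewrite divr_gt0.
have R01 : R0 <= 1 by rewrite ler_pdivrMr// mul1r; lra.
have t0 : 0 < R0 / 8 by rewrite divr_gt0.
have t1 : R0 / 8 <= 1 by lra.
have nC0 : 0 <= n.+1%:R * C by rewrite mulr_ge0// ltW.
have [eta' [eta'0 seed1 seed2]] := exists_seed_radius t0 t1 c0 nC0.
(* The lower bound is sought within [eta'], so that the point found lies on a parabola at parameter
   [R0 / 8]. *)
have [c1 c10 low] := @uniform_nonvanishing R n.+1 h _ eta' cK eta'0
  (nonvanishing_closure oO cO hO Oz0 hz0).
have [K [m [Th [c2 [K0 Th2 c20 fam]]]]] := @family_product_lower_bound R R0 Bh c1 R00 c10.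
(* The first four conditions keep the curves and the polydiscs around their points in the box, with
   [S = 1 + D]; the fifth is [e <= 1], and the last puts [Th * r] below [R0 / 8] for [r = e * s]. *)
have [e e0] := exists_small [:: 6 * (2 + 4 * (1 + D) / c) / c; 24 / c;
  6 * (4 * (1 + D) + n.+1%:R * 4) / c; 24 * C / c; 1; Th * (1 + D) / (R0 / 8)].
move=> /and4P[e1 e2 e3 /and4P[e4 e5 e6 _]]; rewrite mulr1 in e5.
pose C1 := 1 + C + C / c.
have Cc : 0 < C / c by rewrite divr_gt0.
have C10 : 0 < C1 by rewrite /C1; lra.
have C11 : 1 <= C1 by rewrite /C1; lra.
pose K2 := (Bh / c1 + 1) * K.
have K20 : 0 < K2 by rewrite mulr_gt0// ltr_wpDl// divr_ge0// ltW.
(* [m.+1] is the integral power provided by [final_coefficient]; [8 ^+ n.+1] comes from the mean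
   value inequality. *)
exists m.+1%:R, (8 ^+ n.+1 * (K2 * (C1 / e) ^+ m / (c2 * (e ^+ 2) ^+ n.+1))).
split.
- by rewrite ltr0n.
- have Ce0 : 0 < C1 / e by rewrite divr_gt0.
  apply: mulr_gt0; first exact: exprn_gt0.
  apply: divr_gt0; first by apply: mulr_gt0 K20 _; exact: exprn_gt0.
  by apply: mulr_gt0 c20 _; rewrite !exprn_gt0.
move=> w z f Ow Oz hf.
have cw := subset_closure Ow.
have [l [j [cl lC lle box reach]]] := scale w Ow.
have rw : 0 < `|rho w| by move: Ow; rewrite OE/= normr_gt0 => /ltr0_neq0.
pose s := Num.sqrt `|rho w|.
have s0 : 0 < s by rewrite sqrtr_gt0.
have sE : s ^+ 2 = `|rho w| by rewrite sqr_sqrtr// ltW.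
have sS : s <= 1 + D by have := DP w cw; rewrite -sE => h1; nra.
have {}box (v : 'rV[R[i]]_n.+1) : (forall k, nrm (v ord0 k) <= c * s) ->
    nrm (lform l v) <= c * s ^+ 2 -> Omega (w + v) by rewrite sE; exact: box.
have es0 : 0 < e * s by rewrite mulr_gt0.
have near (p : {p | admissible l p}) T : supn T <= R0 ->
    polysquare w eta (curve w l j (sval p) T).
  by move=> TR; apply: (curve_near w c0 cl eta1 (svalP p) TR).
have cO' (p : {p | admissible l p}) T : supn T <= e * s -> Omega (curve w l j (sval p) T).
  by move=> Ts; apply: (curve_Omega c0 cl s0 box sS e0 e5 e1 e2 (svalP p) Ts).
pose g (p : {p | admissible l p}) T := h (curve w l j (sval p) T).
have dg p T : supn T <= R0 -> differentiable (g p) T.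
  move=> /(near p)/(hU _ _ cw)[Up _].
  apply: (@differentiable_comp _ _ _ _ (curve w l j (sval p)) h).
    exact: differentiable_curve.
  exact: h_holo.
have gB p T : supn T <= R0 -> nrm (g p T) <= Bh by move=> /(near p)/(hU _ _ cw)[].
have glow : exists p, exists2 T, supn T <= R0 / 8 & c1 <= nrm (g p T).
  have [q wq hq] := low w cw.
  have wq' k : nrm ((q - w) ord0 k) <= 2 * eta'.
    by rewrite !mxE (le_trans (nrm_le_supn _))// ler_wpM2l.
  have lq := nrm_lform_bound (ltW C0) (fun k => le_trans (lle k) lC) wq'.
  have [k||p ap pq] := curve_reach (w := w) c0 cl (x := q) t0.
  - rewrite (le_trans _ seed2)// lerD// ler_wpM2r// invr_ge0 ltW//.
  - exact: le_trans lq seed1.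
  exists (exist _ p ap), (R0 / 8)%:C; last by rewrite /g/= pq.
  by rewrite (le_trans (supn_le_nrm _))// nrm_real ger0_norm// ltW.
have ThR : Th * (e * s) <= R0 / 8.
  move: e6; rewrite mulrA ler_pdivrMr// mul1r => /(le_trans _); apply.
  rewrite mulrCA ler_wpM2l ?(ltW e0)// ler_wpM2l//; lra.
have esR : e * s <= R0 / 8.
  by rewrite (le_trans _ ThR)// ler_peMl ?(ltW es0)//; lra.
have [Mr [p [Mr0 growth prod]]] := fam _ g (e * s) dg gB glow es0 ThR.
(* [f] is restricted to the same parabola, whose value at parameter 0 is [w]. *)
have [|T Ts] := prod (fun T => f (curve w l j (sval p) T)).
  move=> T Ts; apply: (@differentiable_comp _ _ _ _ (curve w l j (sval p)) f).
    exact: differentiable_curve.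
  by apply: hf; exact: cO'.
rewrite curve0 => Tprod.
pose F := F_fun rho z w; pose sF := Num.sqrt F.
have FE : `|rho w| <= F.
  rewrite (le_trans _ (F_fun_ge rho z w))// -addrA [leRHS]addrCA lerDl addr_ge0//.
  exact: sqnorm_ge0.
have F0 : 0 <= F by rewrite (le_trans _ FE).
have ssF : s <= sF by rewrite ler_wsqrtr.
have sF0 : 0 < sF by rewrite (lt_le_trans s0).
(* [growth] holds for every member of the family, in particular for the parabola that reaches [z]
   when [C1 * sF <= R0 / 8]. *)
have hz : nrm (h z) <= K2 * (C1 * sF / (e * s)) ^+ m * Mr.
  apply: (growth_two_ranges K0 Bh0 c10 es0 _ (ltW t0) Mr0) => //.
  - by rewrite mulr_gt0.
  - have [|_ ->//] := hU z z (subset_closure Oz).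
    by move=> k; rewrite subrr supn0 ltW.
  - move=> dR.
    have [z1 z2] := reach z Oz.
    have [d1 d2] := sqrt_scale_bound (ltW C0) c0 F0 t1 erefl dR.
    have d0 : 0 < C1 * sF by rewrite mulr_gt0.
    have [k||p' ap pz] := curve_reach (w := w) c0 cl (x := z) d0.
    + apply: le_trans d1; apply: lerD; first exact: z1.
      by rewrite ler_wpM2r ?invr_ge0 ?(ltW c0).
    + exact: le_trans z2 d2.
    have := growth (C1 * sF) (exist _ p' ap) (C1 * sF)%:C _ dR.
    rewrite /g/= pz; apply.
      by rewrite ler_pM ?(ltW e0) ?(ltW s0)// (le_trans e5).
    by rewrite (le_trans (supn_le_nrm _))// nrm_real ger0_norm// ltW.
  - have [p' [T' T'R hT']] := glow.
    exact: le_trans hT' (growth _ p' T' esR (lexx _) T'R).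
have hG : holomorphic_on Omega (fun x => h x * f x).
  by move=> x Ox; apply: (@differentiableM _ _ h f); [exact: hO|exact: hf].
have mv := mean_value_curve c0 cl lC lle s0 box sS e0 e5 e1 e2 e3 e4 (svalP p) Ts hG.
rewrite -/F nrmM.
have -> : F `^ m.+1%:R / `|rho w| `^ (m.+1%:R + n.+1%:R + 1) =
    (sF ^+ 2) ^+ m.+1 / (s ^+ 2) ^+ (m.+1 + n.+2).
  rewrite /sF sqr_sqrtr// sE powR_mulrn//; congr (_ / _).
  by rewrite -natrD natr1 powR_mulrn ?(ltW rw)// -addnS.
apply: (final_inequality _ c20 _ _ _ (int_ge0 w f) hz Tprod mv
  (final_coefficient n m K20 C10 c20 e0 s0 ssF)).
- by rewrite mulr_gt0 ?exprn_gt0 ?mulr_gt0 ?exprn_gt0.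
- by rewrite mulr_ge0 ?(ltW K20)// exprn_ge0// divr_ge0 ?mulr_ge0// ltW.
- exact: nrm_ge0.
- by rewrite exprn_ge0.
Qed.

End Conclusion.

Local Close Scope complex_scope.

Theorem theorem3p1 (R : realType) (n : nat) (n_gt0 : (0 < n)%N)
    (Omega : set 'rV[R[i]]_n) (rho : 'rV[R[i]]_n -> R)
    (Omega_domain : bounded_domain Omega)
    (Omega_spc : strongly_pseudoconvex Omega rho)
    (U : set 'rV[R[i]]_n) (h : 'rV[R[i]]_n -> R[i])
    (U_open : open U) (closure_Omega_U : closure Omega `<=` U)
    (h_holo : holomorphic_on U h) :
  exists N C : R, [/\ 0 < N, 0 < C &
    forall (w z : 'rV[R[i]]_n) (f : 'rV[R[i]]_n -> R[i]),
      Omega w -> Omega z -> holomorphic_on Omega f ->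
      ((Normc.normc (h z * f w))%:E <=
       (C * (F_fun rho z w `^ N / `|rho w| `^ (N + n%:R + 1)))%:E *
       \int[lebesgue_Cn]_(l in kobayashi_ball Omega w 1)
         (Normc.normc (h l * f l))%:E)%E].
Proof.
case: n n_gt0 Omega rho Omega_domain Omega_spc U h U_open closure_Omega_U h_holo => [//|n] _.
exact: main_estimate.
Qed.
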